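(* Let $k\ge 2$ be an integer and let $q$ be a prime with $q>k$. Let $p_0\in 2\mathbb{N}$ be an even integer and let $c(p_0)\ge 0$ be such that $$\mathfrak{D}_{p_0}(\delta)\le C_1\,\delta^{-\left(\frac12-\frac{k(k+1)}{2p_0}\right)-\frac{c(p_0)}{p_0}\left(1-\frac1k\right)^{p_0/(2k)}}\qquad\text{for all }\delta\in q^{-\mathbb{N}},$$ where $C_1$ is independent of $\delta$. If $p\in p_0+2k\mathbb{N}$ and $0<\varepsilon<1$, then $$\mathfrak{D}_{p}(\delta)\lesssim_{p,\varepsilon,C_1} q^{a(p,p_0)/p}\,\delta^{-\left(\frac12-\frac{k(k+1)}{2p}\right)-\frac{c(p_0)}{p}\left(1-\frac1k\right)^{p/(2k)}-\varepsilon}\qquad\text{for all }\delta\in q^{-\mathbb{N}},$$ where $$a(p,p_0):=\Big(\frac{p-p_0}{2k}\Big)\Big(\frac{p_0}{2}+\frac{k^2+7k-4}{2}\Big)+\frac k2\Big(\frac{p-p_0}{2k}\Big)\Big(\frac{p-p_0}{2k}+1\Big).$$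
   Context: Conventions: $\mathbb{N}=\{1,2,3,\dots\}$ and $q^{-\mathbb{N}}=\{q^{-n}:n\in\mathbb{N}\}$. $X\lesssim_{A}Y$ means $X\le CY$ with a constant $C$ depending only on $k$ and the parameters $A$ (so here only on $k,p,\varepsilon,C_1$). $\mathbb{Q}_q$ is the field of $q$-adic numbers with norm $|\cdot|$ normalized by $|q|=q^{-1}$, and $\mathbb{Z}_q=\{\xi:|\xi|\le1\}$. On $\mathbb{Q}_q^k$ use $|(\xi_1,\dots,\xi_k)|=\max_i|\xi_i|$. An interval of length $r$ (with $r\in q^{\mathbb{Z}}$) is a set $\{\xi\in\mathbb{Q}_q:|\xi-a|\le r\}$; $|I|$ denotes the length of the interval $I$. A cube of side length $r$ in $\mathbb{Q}_q^k$ is a product of $k$ intervals of length $r$. Schwartz functions on $\mathbb{Q}_q^k$ are finite complex linear combinations of characteristic functions of cubes. The Fourier transform is $\widehat f(\xi)=\int_{\mathbb{Q}_q^k}f(x)\chi(-x\cdot\xi)\,dx$, where $\chi$ is a fixed character of the additive group $\mathbb{Q}_q$ that is trivial on $\mathbb{Z}_q$ and non-trivial on $q^{-1}\mathbb{Z}_q$, $x\cdot\xi=\sum_i x_i\xi_i$, and $dx$ is Haar measure with $\int_{\mathbb{Z}_q^k}dx=1$. Let $\gamma(t)=(t,t^2,\dots,t^k)$. For $\delta\in q^{-\mathbb{N}}$, $P_\delta$ is the partition of $\mathbb{Z}_q$ into intervals of length $\delta$. For an interval $I\subset\mathbb{Z}_q$ and any $a\in I$, $$\theta_I=\Big\{\gamma(a)+\sum_{j=1}^k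 t_j\gamma^{(j)}(a): t_j\in\mathbb{Q}_q,\ |t_j|\le|I|^j\text{ for all }1\le j\le k\Big\},$$ which is independent of the choice of $a\in I$. For an interval $I\subset\mathbb{Z}_q$, $f_I$ is defined by $\widehat{f_I}=\widehat f\cdot 1_{I\times\mathbb{Q}_q^{k-1}}$. Decoupling constant: for $p\ge2$ and $\delta\in q^{-\mathbb{N}}$, $\mathfrak{D}_p(\delta)$ is the smallest constant such that $$\|f\|_{L^p(\mathbb{Q}_q^k)}\le\mathfrak{D}_p(\delta)\Big(\sum_{K\in P_\delta}\|f_K\|_{L^p(\mathbb{Q}_q^k)}^2\Big)^{1/2}$$ for every Schwartz function $f$ on $\mathbb{Q}_q^k$ whose Fourier transform is supported in $\bigcup_{K\in P_\delta}\theta_K$. *)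

(* Defs.v *)
From HB Require Import structures.
From mathcomp Require Import all_boot all_order all_algebra.
From mathcomp Require Import complex zify.
From mathcomp Require Import all_classical all_reals all_analysis.

Set Implicit Arguments.
Unset Strict Implicit.
Unset Printing Implicit Defensive.

Import Order.TTheory GRing.Theory Num.Theory.

Local Open Scope classical_set_scope.
Local Open Scope ring_scope.

(* Z_q is the inverse limit of the rings Z/q^n: x n is the representative of
   the n-th component in [0, q^n[. *)
Record qadic_int (q : nat) (q_pr : prime q) := QadicInt {
  qadic_int_seq :> nat -> int;
  _ : `[< forall n, qadic_int_seq n = (qadic_int_seq n.+1 %% (q ^ n)%:Z)%Z >] }.

Section QadicInt.
Variables (q : nat) (q_pr : prime q).
Local Notation Zq := (qadic_int q_pr).
Local Notation Q n := ((q ^ n)%N%:Z).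
Implicit Types (x y z : Zq) (u v w : nat -> int).

HB.instance Definition _ := [isSub for @qadic_int_seq q q_pr].
HB.instance Definition _ := [Choice of Zq by <:].

Lemma qadic_intE x n : x n = (x n.+1 %% Q n)%Z.
Proof. by case: x => u /= /asboolP. Qed.

Lemma qadic_int_red x n : (x n %% Q n)%Z = x n.
Proof. by rewrite qadic_intE modz_mod. Qed.

Lemma qadic_mod_mod (c : int) m n : (m <= n)%N ->
  ((c %% Q n)%Z %% Q m)%Z = (c %% Q m)%Z.
Proof.
move=> mn; apply/eqP; rewrite eqz_mod_dvd.
have /dvdz_trans : (Q m %| Q n)%Z by rewrite dvdzE /= dvdn_exp2l.
apply; rewrite {2}(divz_eq c (Q n)) opprD addrCA subrr addr0 -mulNr.
exact: dvdz_mull.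
Qed.

Lemma qadic_int_mod x m n : (m <= n)%N -> (x n %% Q m)%Z = x m.
Proof.
move=> /subnK <-; elim: (n - m)%N => [|d IH]; first exact: qadic_int_red.
by rewrite -[RHS]IH [x (d + m)%N]qadic_intE qadic_mod_mod ?leq_addl.
Qed.

Lemma eq_qadic_int x y : (forall n, x n = y n) -> x = y.
Proof. by move=> xy; apply/val_inj/funext. Qed.

Definition qadic_mk u (uP : forall n, (u n = u n.+1 %[mod Q n])%Z) : Zq.
Proof.
exists (fun n => (u n %% Q n)%Z); apply/asboolP => n.
by rewrite qadic_mod_mod.
Defined.

Lemma qadic_const_subproof (c : int) n : (c = c %[mod Q n])%Z.
Proof. by []. Qed.
Definition qadic_const c : Zq := qadic_mk (qadic_const_subproof c).

Lemma qadic_add_subproof x y n :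
  (x n + y n = x n.+1 + y n.+1 %[mod Q n])%Z.
Proof. by rewrite [x n]qadic_intE [y n]qadic_intE modzDml modzDmr. Qed.
Definition qadic_add x y := qadic_mk (qadic_add_subproof x y).

Lemma qadic_opp_subproof x n : (- x n = - x n.+1 %[mod Q n])%Z.
Proof. by rewrite [x n]qadic_intE modzNm. Qed.
Definition qadic_opp x := qadic_mk (qadic_opp_subproof x).

Lemma qadic_mul_subproof x y n :
  (x n * y n = x n.+1 * y n.+1 %[mod Q n])%Z.
Proof. by rewrite [x n]qadic_intE [y n]qadic_intE modzMml modzMmr. Qed.
Definition qadic_mul x y := qadic_mk (qadic_mul_subproof x y).

Fact qadic_addA : associative qadic_add.
Proof. by move=> x y z; apply: eq_qadic_int => n /=; rewrite modzDmr modzDml addrA. Qed.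
Fact qadic_addC : commutative qadic_add.
Proof. by move=> x y; apply: eq_qadic_int => n /=; rewrite addrC. Qed.
Fact qadic_add0 : left_id (qadic_const 0) qadic_add.
Proof. by move=> x; apply: eq_qadic_int => n /=; rewrite mod0z add0r qadic_int_red. Qed.
Fact qadic_addN : left_inverse (qadic_const 0) qadic_opp qadic_add.
Proof. by move=> x; apply: eq_qadic_int => n /=; rewrite modzDml addNr. Qed.
HB.instance Definition _ :=
  GRing.isZmodule.Build Zq qadic_addA qadic_addC qadic_add0 qadic_addN.

Fact qadic_mulA : associative qadic_mul.
Proof. by move=> x y z; apply: eq_qadic_int => n /=; rewrite modzMmr modzMml mulrA. Qed.
Fact qadic_mulC : commutative qadic_mul.
Proof. by move=> x y; apply: eq_qadic_int => n /=; rewrite mulrC. Qed.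
Fact qadic_mul1 : left_id (qadic_const 1) qadic_mul.
Proof. by move=> x; apply: eq_qadic_int => n /=; rewrite modzMml mul1r qadic_int_red. Qed.
Fact qadic_mulD : left_distributive qadic_mul qadic_add.
Proof.
by move=> x y z; apply: eq_qadic_int => n /=; rewrite modzMml modzDml modzDmr mulrDl.
Qed.
Fact qadic_one_neq0 : qadic_const 1 != 0.
Proof.
apply/eqP => /(congr1 (fun x : Zq => x 1%N)) /=.
by rewrite expn1 mod0z modz_small//= ltz_nat prime_gt1.
Qed.
HB.instance Definition _ := GRing.Zmodule_isComNzRing.Build Zq
  qadic_mulA qadic_mulC qadic_mul1 qadic_mulD qadic_one_neq0.

Definition qadic_unit : pred Zq := fun x => `[< exists y, y * x = 1 >].
Definition qadic_inv x : Zq := xget x [set y | y * x = 1].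
Fact qadic_mulV : {in qadic_unit, left_inverse 1 qadic_inv *%R}.
Proof. by move=> x /asboolP[y yx]; rewrite /qadic_inv; case: xgetP => // /(_ y). Qed.
Fact qadic_unitP x y : y * x = 1 -> qadic_unit x.
Proof. by move=> yx; apply/asboolP; exists y. Qed.
Fact qadic_inv_out : {in [predC qadic_unit], qadic_inv =1 id}.
Proof.
move=> x /= /negP xu; rewrite /qadic_inv; case: xgetP => // y _ yx.
by case: xu; exact: qadic_unitP yx.
Qed.
HB.instance Definition _ := GRing.ComNzRing_hasMulInverse.Build Zq
  qadic_mulV qadic_unitP qadic_inv_out.

Lemma qadic_int_neq0 x : x != 0 -> exists n, x n.+1 != 0.
Proof.
move=> /eqP x0; apply: contrapT => xP; apply: x0; apply: eq_qadic_int => n.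
rewrite /= mod0z qadic_intE.
have [->|xn] := eqVneq (x n.+1) 0; first exact: mod0z.
by case: xP; exists n.
Qed.

(* The largest n such that q^n divides x, for x nonzero. *)
Definition qadic_int_val x : nat :=
  if pselect (exists n, x n.+1 != 0) is left h then ex_minn h else 0%N.

Lemma qadic_int_valP x : x != 0 ->
  x (qadic_int_val x) = 0 /\ x (qadic_int_val x).+1 != 0.
Proof.
move=> /qadic_int_neq0 xP; rewrite /qadic_int_val; case: pselect => // h.
case: ex_minnP => -[|n] xn nmin; split => //.
  by rewrite qadic_intE expn0 modz1.
by apply: contrapT => /eqP /nmin; rewrite ltnn.
Qed.

Lemma qadic_int_val_uniq x n : x n = 0 -> x n.+1 != 0 -> qadic_int_val x = n.
Proof.
move=> xn xn1; have x0 : x != 0.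
  by apply: contraNneq xn1 => ->; rewrite /= mod0z.
have [xv xv1] := qadic_int_valP x0.
apply/eqP; rewrite eqn_leq; apply/andP; split; rewrite leqNgt; apply/negP => lt.
  by move: xn1; rewrite -(qadic_int_mod x lt) xv mod0z eqxx.
by move: xv1; rewrite -(qadic_int_mod x lt) xn mod0z eqxx.
Qed.

Lemma qadic_int_val_ge x n : x != 0 -> (n <= qadic_int_val x)%N = (x n == 0).
Proof.
move=> x0; have [xv xv1] := qadic_int_valP x0; apply/idP/eqP => [le|xn].
  by rewrite -(qadic_int_mod x le) xv mod0z.
rewrite leqNgt; apply/negP => lt.
by move: xv1; rewrite -(qadic_int_mod x lt) xn mod0z eqxx.
Qed.

Lemma qadic_int_val_dvd x n m : (n <= m)%N -> (Q n %| x m)%Z = (x n == 0).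
Proof. by move=> nm; rewrite (sameP dvdz_mod0P eqP) qadic_int_mod. Qed.

Lemma qadic_int_val_mul x y : x != 0 -> y != 0 ->
  x * y != 0 /\ qadic_int_val (x * y) = (qadic_int_val x + qadic_int_val y)%N.
Proof.
move=> x0 y0; have [xa xa1] := qadic_int_valP x0.
have [yb yb1] := qadic_int_valP y0.
set a := qadic_int_val x in xa xa1 *; set b := qadic_int_val y in yb yb1 *.
have q0 n : Q n != 0 by rewrite eqz_nat -lt0n expn_gt0 prime_gt0.
have fac (z : Zq) c N : (c < N)%N -> z c = 0 -> z c.+1 != 0 ->
    exists2 s : int, z N = s * Q c & ~~ (q%:Z %| s)%Z.
  move=> cN zc zc1; have /dvdzP[s zs] : (Q c %| z N)%Z.
    by rewrite qadic_int_val_dvd ?(ltnW cN)// zc.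
  exists s => //; apply: contra zc1 => qs.
  by rewrite -(qadic_int_val_dvd z cN) zs expnS PoszM dvdz_mul.
have [|s xs qs] := fac x a (a + b).+1 _ xa xa1; first by rewrite ltnS leq_addr.
have [|t yt qt] := fac y b (a + b).+1 _ yb yb1; first by rewrite ltnS leq_addl.
have xyn : (x * y) (a + b)%N = 0.
  by rewrite qadic_intE /= xs yt mulrACA -PoszM -expnD qadic_mod_mod// modzMl.
have xyn1 : (x * y) (a + b).+1 != 0.
  rewrite /= xs yt mulrACA -PoszM -expnD; apply/eqP => /dvdz_mod0P.
  rewrite expnS PoszM dvdz_mul2r// dvdzE abszM Euclid_dvdM//.
  by case/orP; apply/negP.
split; last exact: qadic_int_val_uniq.
by apply: contraNneq xyn1 => ->; rewrite /= mod0z.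
Qed.

Fact qadic_int_integral : GRing.integral_domain_axiom Zq.
Proof.
move=> x y xy; apply: contraT; rewrite negb_or => /andP[x0 y0].
by have [] := qadic_int_val_mul x0 y0; rewrite xy eqxx.
Qed.
HB.instance Definition _ :=
  GRing.ComUnitRing_isIntegral.Build Zq qadic_int_integral.

End QadicInt.

Section Qadic.
Variables (q : nat) (q_pr : prime q).

Definition qadic := {fraction (qadic_int q_pr)}.

HB.instance Definition _ := GRing.Field.on qadic.
HB.instance Definition _ := isPointed.Build qadic 0.

Implicit Types x y : qadic.

Definition qadic_num x : qadic_int q_pr := (frac (repr x)).1.
Definition qadic_den x : qadic_int q_pr := (frac (repr x)).2.

Definition qadic_val x : int :=
  (qadic_int_val (qadic_num x))%:Z - (qadic_int_val (qadic_den x))%:Z.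

Definition qadic_norm (R : realType) x : R :=
  if x == 0 then 0 else q%:R ^ (- qadic_val x).

End Qadic.

Section QadicTheory.
Variables (q : nat) (q_pr : prime q) (R : realType).
Local Notation Qq := (qadic q_pr).
Local Notation "x %:F" := (FracField.tofrac x : Qq).
Local Notation "`| x |_q" := (qadic_norm R x) (at level 0, x at level 99).
Implicit Types x y : Qq.

Lemma qadic_den_neq0 x : qadic_den x != 0.
Proof. exact: denom_ratioP. Qed.

Lemma qadic_numden x : x * (qadic_den x)%:F = (qadic_num x)%:F.
Proof.
rewrite /qadic_den /qadic_num; set r := repr x.
rewrite -[x]reprK -/r -[_ * _]/(FracField.mul _ _); unlock FracField.tofrac.
rewrite -FracField.pi_mul; apply/eqmodP.
rewrite /= FracField.equivfE /FracField.mulf.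
by rewrite !numden_Ratio ?mulf_neq0 ?oner_neq0 ?denom_ratioP// !mulr1 mulrC.
Qed.

Lemma qadic_valE x (a b : qadic_int q_pr) : a != 0 -> b != 0 ->
  x * b%:F = a%:F ->
  x != 0 /\ qadic_val x = (qadic_int_val a)%:Z - (qadic_int_val b)%:Z.
Proof.
move=> a0 b0 xba; have x0 : x != 0.
  apply: contraNneq a0 => x0; move: xba; rewrite x0 mul0r => /eqP.
  by rewrite eq_sym tofrac_eq0.
split=> //; have n0 : qadic_num x != 0.
  by rewrite -tofrac_eq0 -qadic_numden mulf_neq0 ?tofrac_eq0 ?qadic_den_neq0.
have : qadic_num x * b = a * qadic_den x.
  apply/eqP; rewrite -tofrac_eq !tofracM -qadic_numden -xba.
  by rewrite -!mulrA [_ * b%:F]mulrC.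
move=> nbad; have [_] := qadic_int_val_mul n0 b0; rewrite nbad.
have [_ ->] := qadic_int_val_mul a0 (qadic_den_neq0 x); rewrite /qadic_val; lia.
Qed.

Lemma qadic_num_eq0 x : (qadic_num x == 0) = (x == 0).
Proof.
by rewrite -tofrac_eq0 -qadic_numden mulf_eq0 tofrac_eq0 (negPf (qadic_den_neq0 x)) orbF.
Qed.

Lemma qadic_norm_frac x (a b : qadic_int q_pr) : a != 0 -> b != 0 ->
  x * b%:F = a%:F ->
  `|x|_q = q%:R ^ ((qadic_int_val b)%:Z - (qadic_int_val a)%:Z).
Proof.
move=> a0 b0 xba; have [x0 xE] := qadic_valE a0 b0 xba.
by rewrite /qadic_norm (negPf x0) xE opprB.
Qed.

Lemma qadic_norm0 : `|(0 : Qq)|_q = 0.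
Proof. by rewrite /qadic_norm eqxx. Qed.

Lemma qadic_normM x y : `|x * y|_q = `|x|_q * `|y|_q.
Proof.
have [->|x0] := eqVneq x 0; first by rewrite mul0r qadic_norm0 mul0r.
have [->|y0] := eqVneq y 0; first by rewrite mulr0 qadic_norm0 mulr0.
have nx0 : qadic_num x != 0 by rewrite qadic_num_eq0.
have ny0 : qadic_num y != 0 by rewrite qadic_num_eq0.
have [n0 nE] := qadic_int_val_mul nx0 ny0.
have [d0 dE] := qadic_int_val_mul (qadic_den_neq0 x) (qadic_den_neq0 y).
rewrite (qadic_norm_frac n0 d0); last by rewrite !tofracM mulrACA !qadic_numden.
rewrite /qadic_norm (negPf x0) (negPf y0) -expfzDr; last first.
  by rewrite pnatr_eq0 -lt0n prime_gt0.
by rewrite nE dE !PoszD /qadic_val !opprB addrACA -opprD.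
Qed.

Lemma qadic_int_natr (c n : nat) :
  (c%:R : qadic_int q_pr) n = (c%:Z %% (q ^ n)%N%:Z)%Z.
Proof.
elim: c => [|c IH]; first by rewrite /= mod0z.
by rewrite mulrS /= IH modzDml modzDmr -PoszD add1n.
Qed.

Lemma qadic_norm_prime : `|(q%:R : Qq)|_q = q%:R^-1.
Proof.
have q1 := prime_gt1 q_pr; have q0 := ltnW q1.
have v1 : qadic_int_val (1 : qadic_int q_pr) = 0%N.
  apply: qadic_int_val_uniq; first by rewrite /= expn0 modz1.
  by rewrite /= expn1 modz_nat modn_small.
have q10 : (q%:R : qadic_int q_pr) 1%N = 0 by rewrite qadic_int_natr expn1 modzz.
have q20 : (q%:R : qadic_int q_pr) 2%N != 0.
  by rewrite qadic_int_natr modz_nat modn_small ?eqz_nat -?lt0n// -{1}(expn1 q) ltn_exp2l.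
have vq := qadic_int_val_uniq q10 q20.
have qn0 : (q%:R : qadic_int q_pr) != 0.
  by apply: contraNneq q20 => ->; rewrite /= mod0z.
rewrite (qadic_norm_frac qn0 (oner_neq0 _)); last first.
  by rewrite tofrac1 mulr1 -[in RHS]mulr_natr tofracM tofrac1 mul1r tofracMn tofrac1.
by rewrite v1 vq sub0r -exprN1.
Qed.

Lemma qadic_int_valD (a b : qadic_int q_pr) : a != 0 -> b != 0 -> a + b != 0 ->
  (minn (qadic_int_val a) (qadic_int_val b) <= qadic_int_val (a + b)%R)%N.
Proof.
move=> a0 b0 ab0; rewrite qadic_int_val_ge//=.
have /eqP -> : a (minn (qadic_int_val a) (qadic_int_val b)) == 0.
  by rewrite -qadic_int_val_ge// geq_minl.
have /eqP -> : b (minn (qadic_int_val a) (qadic_int_val b)) == 0.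
  by rewrite -qadic_int_val_ge// geq_minr.
by rewrite addr0 mod0z.
Qed.

Lemma qadic_normD x y : `|x + y|_q <= Num.max `|x|_q `|y|_q.
Proof.
have norm_ge0 z : 0 <= `|z|_q by rewrite /qadic_norm; case: eqP => // _; rewrite exprz_ge0.
have [->|x0] := eqVneq x 0.
  by rewrite add0r qadic_norm0 le_max lexx orbT.
have [->|y0] := eqVneq y 0; first by rewrite addr0 le_max lexx.
have [->|xy0] := eqVneq (x + y) 0; first by rewrite qadic_norm0 le_max norm_ge0.
have nx0 : qadic_num x != 0 by rewrite qadic_num_eq0.
have ny0 : qadic_num y != 0 by rewrite qadic_num_eq0.
have [a0 aE] := qadic_int_val_mul nx0 (qadic_den_neq0 y).
have [b0 bE] := qadic_int_val_mul ny0 (qadic_den_neq0 x).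
have [d0 dE] := qadic_int_val_mul (qadic_den_neq0 x) (qadic_den_neq0 y).
have xyE : (x + y) * (qadic_den x * qadic_den y)%:F =
    (qadic_num x * qadic_den y + qadic_num y * qadic_den x)%:F.
  rewrite tofracD !tofracM -!qadic_numden mulrDl !mulrA; congr (_ + _).
  by rewrite mulrAC.
have ab0 : qadic_num x * qadic_den y + qadic_num y * qadic_den x != 0.
  by rewrite -tofrac_eq0 -xyE mulf_neq0 ?tofrac_eq0.
have key (n d n' d' v : nat) : (n + d' <= v)%N || (n' + d <= v)%N ->
    ((d + d')%N%:Z - v%:Z <= - (n%:Z - d%:Z)) ||
    ((d + d')%N%:Z - v%:Z <= - (n'%:Z - d'%:Z)) by lia.
have := qadic_int_valD a0 b0 ab0; rewrite geq_min aE bE.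
rewrite (qadic_norm_frac ab0 d0 xyE) dE le_max /qadic_norm (negPf x0) (negPf y0).
have q1 : (1 : R) < q%:R by rewrite ltr1n prime_gt1.
by rewrite !ler_eXz2l//; exact: key.
Qed.

End QadicTheory.

Section QadicSpace.
Variables (R : realType) (q : nat) (q_pr : prime q).
Local Notation Qq := (qadic q_pr).

Definition qadic_ring : set Qq := [set x | qadic_norm R x <= 1].

Definition qadic_interval (r : R) : set (set Qq) :=
  [set I | (exists n : int, r = q%:R ^ n) /\
           exists a, I = [set x | qadic_norm R (x - a) <= r]].

Definition qadic_scale : set R := [set q%:R ^- n | n in [set n | (0 < n)%N]].

Definition qadic_partition (delta : R) : set (set Qq) :=
  [set I | qadic_interval delta I /\ I `<=` qadic_ring].

Variable k : nat.
Local Notation point := 'rV[Qq]_k.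

Definition qadic_box (I : 'I_k -> set Qq) : set point :=
  [set x | forall i, I i (x 0 i)].

Definition qadic_cube : set (set point) :=
  [set A | exists r, exists2 I : 'I_k -> set Qq,
    forall i, qadic_interval r (I i) & A = qadic_box I].

(* The cubes are a countable base of the topology, so they generate the Borel
   sets. *)
Definition qadic_space := g_sigma_algebraType qadic_cube.
HB.instance Definition _ := Measurable.on qadic_space.

Definition dotp (x xi : point) : Qq := \sum_i x 0 i * xi 0 i.

Definition moment_curve (t : Qq) : point := \row_(i < k) t ^+ i.+1.

Definition moment_curve_deriv (j : nat) (t : Qq) : point :=
  \row_(i < k) ('X^(i.+1) : {poly Qq})^`(j).[t].

(* theta_I, for I an interval of length r; as the set does not depend on the
   base point a in I, the union over all base points is taken. *)
Definition theta (r : R) (I : set Qq) : set point :=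
  [set xi | exists2 a, I a & exists2 t : 'I_k -> Qq,
    forall j, qadic_norm R (t j) <= r ^+ j.+1 &
    xi = moment_curve a + \sum_j t j *: moment_curve_deriv j.+1 a].

(* I x Q_q^(k-1) *)
Definition strip (I : set Qq) : set point :=
  [set xi | forall i : 'I_k, i = 0%N :> nat -> I (xi 0 i)].

Definition schwartz (f : point -> R[i]) : Prop :=
  exists (n : nat) (c : 'I_n -> R[i]) (A : 'I_n -> set point),
    (forall i, qadic_cube (A i)) /\
    f = (fun x => \sum_i c i * \1_(A i) x).

Definition qadic_character (chi : Qq -> R[i]) : Prop :=
  [/\ forall x y, chi (x + y) = chi x * chi y,
      forall x, `|chi x| = 1,
      forall x, qadic_ring x -> chi x = 1 &
      exists2 x, qadic_ring x & chi (q%:R^-1 * x) != 1].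

Variables (mu : {measure set qadic_space -> \bar R}) (chi : Qq -> R[i]).

Definition normalized_haar : Prop :=
  (forall (x : point) (A : set point), measurable (A : set qadic_space) ->
     mu [set x + y | y in A] = mu A) /\
  mu (qadic_box (fun=> qadic_ring)) = 1%E.

Definition Cintegral (f : qadic_space -> R[i]) : R[i] :=
  ((\int[mu]_x complex.Re (f x)) +i* (\int[mu]_x complex.Im (f x)))%C.

Definition fourier (f : point -> R[i]) (xi : point) : R[i] :=
  Cintegral (fun x => f x * chi (- dotp x xi)).

Definition Lpnorm (p : R) (f : point -> R[i]) : \bar R :=
  'N[mu]_(p%:E)[(fun x : qadic_space => (ComplexField.Normc.normc (f x))%:E)]%E.

(* f_I, the unique Schwartz function with this Fourier transform. *)
Definition freq_restrict (I : set Qq) (f : point -> R[i]) : point -> R[i] :=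
  xget (fun=> 0) [set g | schwartz g /\
    forall xi, fourier g xi = fourier f xi * \1_(strip I) xi].

Definition decoupling_bound (p delta D : R) : Prop :=
  forall f : point -> R[i], schwartz f ->
    (forall xi, fourier f xi != 0 ->
       exists2 K, qadic_partition delta K & theta delta K xi) ->
    (Lpnorm p f <=
       D%:E * (\sum_(K \in qadic_partition delta)
                 Lpnorm p (freq_restrict K f) ^+ 2) `^ 2^-1)%E.

(* The admissible constants form a closed half-line, so this infimum is the
   smallest one. *)
Definition decoupling_constant (p delta : R) : \bar R :=
  ereal_inf [set D%:E | D in [set D | 0 <= D /\ decoupling_bound p delta D]].

End QadicSpace.

Definition a_exponent (R : realType) (k : nat) (p p0 : R) : R :=
  let m := (p - p0) / (2 * k%:R) in
  m * (p0 / 2 + (k%:R ^+ 2 + 7 * k%:R - 4) / 2) + k%:R / 2 * m * (m + 1).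

(* Main.v *)
Require Import Defs.
From HB Require Import structures.
From mathcomp Require Import all_boot all_order all_algebra.
From mathcomp Require Import complex zify ring lra.
From mathcomp Require Import all_classical all_reals all_analysis.
From mathcomp Require Import measurable_realfun.
Import Order.TTheory GRing.Theory Num.Theory.
Local Open Scope ring_scope.
Set Implicit Arguments. Unset Strict Implicit. Unset Printing Implicit Defensive.

(** Write delta = q^-n and p = 2r, and let X_r(n) be the p-th power of the
    decoupling constant. Passing from 2r to 2(r + k) costs a fixed power of q
    and turns a bound X_r(n) <= C q^(n e) into X_(r+k)(n) <= C' q^(n e') with
      e' = (k-1)/2 + r/k + (1 - 1/k) e + eps.
    This affine map sends r - k(k+1)/2 + c (1-1/k)^(r/k) to the same expression
    at r + k ([next_decoupling_exponent]); iterating it (p - p0)/(2k) times gives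
    the theorem, the powers of q adding up to a(p, p0).

    Everything is done on the spatial side. For t in Q_q^k let P_t be the
    polynomial with P_t(a) = gamma(a).t. A function has its Fourier transform
    supported in theta_K, with a in K and |K| = q^-n, exactly when a translation
    by t multiplies it by chi(P_t(a)) for every t such that the polynomial
    P_t(a + q^n Y) - P_t(a) has integral coefficients ([ft_equivariant],
    [equivariant_of_ft]): these t form the lattice dual to theta_K - gamma(a).
    Such functions are called waves. Substituting a0 + q^m Y in P_t is a linear
    change of variables that carries the waves over an interval of length q^-m
    to waves over Z_q ([decoupling_rescale]), so that decoupling at scale q^-n
    holds, with the same constant, for the pieces of such an interval of length
    q^-(m+n).

    The step from r to r + k is made for a restricted inequality, in which each
    wave f_a comes with a bound h_a of its modulus besides a bound b_a of its
    L^2r norm. Fix a scale q^m0, bounded by q times a constant. At each point,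
    either the sum S of the waves is at most k times one of its pieces f_c over
    the intervals of length q^-m0, or k different pieces are all at least
    q^(-2 m0) |S| ([broad_narrow]). The first case is handled by rescaling and
    induction on n. In the second case |S|^(2k) is bounded by a product of k
    squared pieces, |S|^(2r) remains, and Minkowski's inequality splits the
    latter into the contributions |f_J|^(2r) of intervals J of length q^-m, with
    m = n/k rounded up. Expanding the product over k-tuples phi of
    waves, the integral of F_phi (F_psi)^* |f_J|^(2r) vanishes unless the j-th
    power sums of phi and psi around the centre of J agree modulo
    q^min(mj, n) for all j <= k: otherwise some translation leaving |f_J|
    invariant multiplies the integrand by a phase different from 1
    ([separating_translation], [haar_phase]). As q > k, Newton's identities
    hold over Z/q^n with denominators prime to q, so that tuples with entries in
    k distinct residue classes are almost determined by their power sums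
    ([power_sums_rigid]) and each phi meets few psi ([count_power_sums]). Hence
    the product behaves as if its terms were orthogonal
    ([transversal_orthogonality]), and the integral of |f_J|^(2r) is bounded by
    the hypothesis on r at relative scale q^-(n-m)
    ([decouples_restricted_step], [restricted_bound]).

    The restricted inequality gives back the full one at the price of a power
    of n log q, which is absorbed in eps. Waves have constant modulus on balls
    of radius q^n and the lattices above lie in the ball of radius q^(nk). So
    the problem localises to balls of that radius, where each wave is cut
    according to the dyadic size of its modulus relative to its L^p norm and
    O(n log q) sizes matter ([decouples_of_restricted]).

    The constants also need e >= 0, which holds because a single wave shows
    that X_r(n) >= 1 ([decouples_ge1]). *)

(** * Convexity and the broad-narrow inequality *)

Section RealInequalities.
Variable R : realFieldType.

Lemma tangent_power (u v : R) (N : nat) : 0 <= u -> 0 <= v ->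
  N.+1%:R * v ^+ N * u <= u ^+ N.+1 + N%:R * v ^+ N.+1.
Proof.
move=> u0 v0; elim: N => [|N IH]; first by rewrite expr0 !expr1 mul0r addr0 mulr1 mul1r.
have h1 : 0 <= u * (u ^+ N.+1 + N%:R * v ^+ N.+1 - N.+1%:R * v ^+ N * u).
  by rewrite mulr_ge0// subr_ge0.
have h2 : 0 <= N.+1%:R * v ^+ N * (u - v) ^+ 2.
  by rewrite mulr_ge0 ?sqr_ge0// mulr_ge0 ?exprn_ge0.
rewrite -subr_ge0; have -> : u ^+ N.+2 + N.+1%:R * v ^+ N.+2 - N.+2%:R * v ^+ N.+1 * u =
  u * (u ^+ N.+1 + N%:R * v ^+ N.+1 - N.+1%:R * v ^+ N * u) + N.+1%:R * v ^+ N * (u - v) ^+ 2.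
  by rewrite !exprS -!natr1; ring.
exact: addr_ge0.
Qed.

(** Weighted power mean inequality, from the tangent line of the power function at
    the mean ratio. It replaces Hoelder's and Minkowski's inequalities throughout:
    it is linear in the powers y i ^+ N.+1 and involves no roots. *)
Lemma power_sum_le (I : finType) (y b : I -> R) (N : nat) :
  (forall i, 0 <= y i) -> (forall i, 0 <= b i) -> (forall i, b i = 0 -> y i = 0) ->
  (\sum_i y i) ^+ N.+1 <= (\sum_i b i) ^+ N * \sum_i y i ^+ N.+1 / b i ^+ N.
Proof.
move=> y0 b0 by0; set S := \sum_i y i; set B := \sum_i b i.
have S0 : 0 <= S by exact: sumr_ge0.
have : 0 <= B by exact: sumr_ge0.
rewrite le_eqVlt => /predU1P[B0|B0].
  have bi0 i : b i = 0.
    by apply/eqP; move/esym/eqP: B0; rewrite psumr_eq0// => /allP/(_ i)/=; apply; rewrite mem_index_enum.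
  rewrite [S]big1 => [|i _]; last by rewrite by0.
  rewrite expr0n mulr_ge0 ?exprn_ge0 ?sumr_ge0// => i _.
  by rewrite divr_ge0 ?exprn_ge0.
set v := S / B.
have v0 : 0 <= v by rewrite divr_ge0// ltW.
suff h : B * v ^+ N.+1 <= \sum_i y i ^+ N.+1 / b i ^+ N.
  have -> : S ^+ N.+1 = B ^+ N * (B * v ^+ N.+1).
    by rewrite mulrA -exprSr -exprMn /v mulrC divfK// gt_eqF.
  by rewrite ler_wpM2l// exprn_ge0// ltW.
have -> : B * v ^+ N.+1 = \sum_i (N.+1%:R * v ^+ N * y i - N%:R * v ^+ N.+1 * b i).
  rewrite sumrB -!mulr_sumr -/S -/B.
  have -> : S = B * v by rewrite /v mulrC divfK// gt_eqF.
  by rewrite exprS -natr1; ring.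
apply: ler_sum => i _; have := b0 i; rewrite le_eqVlt => /predU1P[bi|bi].
  by rewrite (by0 i)// -bi !mulr0 subrr expr0n mul0r.
have h := tangent_power N (divr_ge0 (y0 i) (b0 i)) v0.
rewrite -(ler_pM2l bi) in h.
rewrite lerBlDr; apply: le_trans (le_trans h _).
  by rewrite le_eqVlt; apply/orP; left; apply/eqP; field; rewrite gt_eqF.
rewrite le_eqVlt; apply/orP; left; apply/eqP.
rewrite exprMn exprVn mulrDr; congr (_ + _); last by ring.
by rewrite !exprS; field; rewrite expf_neq0// gt_eqF.
Qed.

Lemma sqr_sum_le (I : finType) (b : I -> R) : (forall i, 0 <= b i) ->
  (\sum_i b i) ^+ 2 <= #|I|%:R * \sum_i b i ^+ 2.
Proof.
move=> b0; have := @power_sum_le I b (fun=> 1) 1 b0 (fun=> ler01).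
rewrite sumr_const expr1 => /(_ _)/le_trans; apply.
  by move=> i /eqP; rewrite oner_eq0.
rewrite ler_wpM2l// ler_sum// => i _; by rewrite expr1 divr1.
Qed.

Lemma sum_prod_pow_le (I : finType) (x y : I -> R) (k r : nat) : (0 < k)%N ->
  (forall i, 0 <= x i) -> (forall i, 0 <= y i) ->
  \sum_i x i ^+ k * y i ^+ r <= (\sum_i x i) ^+ k * (\sum_i y i) ^+ r.
Proof.
case: k => // k _ x0 y0.
have lx i : x i <= \sum_i x i by rewrite (bigD1 i)//= lerDl sumr_ge0.
have ly i : y i <= \sum_i y i by rewrite (bigD1 i)//= lerDl sumr_ge0.
rewrite exprS -mulrA mulr_suml ler_sum// => i _.
by rewrite exprS -mulrA ler_wpM2l// ler_pM ?exprn_ge0// lerXn2r ?nnegrE// sumr_ge0.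
Qed.

(** Let A be the largest z i. Either fewer than k of the z i reach A / rho, and
    then S <= k A because the others add up to at most A; or k different ones
    do, and S <= rho A bounds S by rho^2 times each of them. *)
Lemma broad_narrow (rho k r : nat) (z : 'I_rho -> R) (S : R) :
  (0 < rho)%N -> (0 < k)%N -> (forall i, 0 <= z i) -> 0 <= S -> S <= \sum_i z i ->
  S ^+ (2 * r + 2 * k) <=
   k%:R ^+ (2 * r + 2 * k) * (\sum_i z i ^+ (2 * r + 2 * k)) +
   rho%:R ^+ (4 * k) * \sum_(phi : {ffun 'I_k -> 'I_rho} | injectiveb phi)
       (\prod_i z (phi i) ^+ 2) * S ^+ (2 * r).
Proof.
move=> rho0 k0 z0 S0 Sz; set p := (_ + _)%N.
have prodge0 (phi : {ffun 'I_k -> 'I_rho}) : 0 <= \prod_i z (phi i) ^+ 2.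
  by rewrite prodr_ge0// => i _; rewrite exprn_ge0.
case: (@arg_maxP _ _ _ (Ordinal rho0) xpredT z isT) => c _ cmax.
set A := z c in cmax *.
have A0 : 0 <= A by exact: z0.
pose T := [set i | A <= rho%:R * z i].
have rho0' : 0 < rho%:R :> R by rewrite ltr0n.
have SA : S <= rho%:R * A.
  apply: (le_trans Sz); rewrite mulr_natl -[X in _ *+ X]card_ord -sumr_const.
  by apply: ler_sum => i _; exact: cmax.
case: (ltnP #|T| k) => hT.
  have SkA : S <= k%:R * A.
    apply: (le_trans Sz); rewrite (bigID (mem T))/=.
    apply: (@le_trans _ _ (#|T|%:R * A + A)); last first.
      by rewrite -{2}[A]mul1r -mulrDl natr1 ler_wpM2r// ler_nat.
    apply: lerD.
      by rewrite mulr_natl -sumr_const; apply: ler_sum => i _; exact: cmax.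
    apply: (@le_trans _ _ (\sum_(i : 'I_rho) A / rho%:R)).
      rewrite big_mkcond/= ler_sum// => i _; rewrite inE -ltNge; case: ifP => h.
        by rewrite ler_pdivlMr// mulrC ltW.
      by rewrite divr_ge0.
    by rewrite sumr_const card_ord -[leLHS]mulr_natr divfK// gt_eqF.
  apply: (le_trans (lerXn2r p _ _ SkA)); rewrite ?nnegrE ?mulr_ge0//.
  rewrite exprMn ler_wpDr//.
    by rewrite mulr_ge0 ?exprn_ge0// sumr_ge0// => phi _; rewrite mulr_ge0 ?exprn_ge0.
  rewrite ler_wpM2l ?exprn_ge0// (bigD1 c)//= lerDl sumr_ge0// => i _.
  by rewrite exprn_ge0.
pose phi : {ffun 'I_k -> 'I_rho} := [ffun i : 'I_k => nth c (enum T) i].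
have phiT i : phi i \in T by rewrite ffunE -mem_enum mem_nth// -cardE (leq_trans (ltn_ord i)).
have phi_inj : injectiveb phi.
  apply/injectiveP => i j; rewrite !ffunE => /eqP.
  by rewrite nth_uniq ?enum_uniq -?cardE ?(leq_trans (ltn_ord _))// => /eqP/val_inj.
rewrite ler_wpDl//.
  by rewrite mulr_ge0 ?exprn_ge0// sumr_ge0// => i _; rewrite exprn_ge0.
apply: (@le_trans _ _ (rho%:R ^+ (4 * k) * (\prod_i z (phi i) ^+ 2 * S ^+ (2 * r)))); last first.
  rewrite ler_wpM2l ?exprn_ge0// (bigD1 phi)//= lerDl sumr_ge0// => psi _.
  by rewrite mulr_ge0 ?exprn_ge0.
rewrite /p addnC exprD mulrA ler_wpM2r ?exprn_ge0//.
have -> : rho%:R ^+ (4 * k) * \prod_i z (phi i) ^+ 2 = \prod_(i < k) (rho%:R ^+ 2 * z (phi i)) ^+ 2.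
  under [RHS]eq_bigr do rewrite exprMn.
  rewrite [RHS]big_split/= prodr_const card_ord -!exprM; congr (_ ^+ _ * _).
  by rewrite mulnA.
rewrite exprM -[k in _ ^+ k]card_ord -prodr_const ler_prod// => i _.
rewrite exprn_ge0//= lerXn2r ?nnegrE// ?mulr_ge0 ?exprn_ge0//.
apply: (le_trans SA); rewrite expr2 -mulrA ler_wpM2l//.
by have := phiT i; rewrite inE.
Qed.

End RealInequalities.

(** * Newton's identities and tuples with nearby power sums *)

Section Newton.
Variable S : comNzRingType.

Lemma deriv_prod_seq (I : eqType) (s : seq I) (F : I -> {poly S}) : uniq s ->
  (\prod_(i <- s) F i)^`() =
  \sum_(i <- s) (F i)^`() * \prod_(l <- s | l != i) F l.
Proof.
elim: s => [|x s IH] /=; first by rewrite !big_nil derivC.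
case/andP=> xs us; rewrite !big_cons derivM eqxx (IH us); congr (_ + _).
  congr (_ * _); rewrite big_seq [RHS]big_seq_cond; apply: eq_bigl => i.
  by case: (boolP (i \in s)) => //= is_; apply/esym; apply: contraNneq xs => <-.
rewrite mulr_sumr; apply: eq_big_seq => i is_.
rewrite big_cons; have -> : x != i by apply: contraNneq xs => ->.
by rewrite mulrCA.
Qed.

Variables (k : nat).
Implicit Types (x y : 'I_k -> S).

Let P x : {poly S} := \prod_i ('X - (x i)%:P).
Let cofactor x i : {poly S} := \prod_(l | l != i) ('X - (x l)%:P).
Let U x j m : S := \sum_i x i ^+ m * (cofactor x i)`_j.
Let psum x m : S := \sum_i x i ^+ m.

Let PE x i : P x = ('X - (x i)%:P) * cofactor x i.
Proof. by rewrite /P (bigD1 i). Qed.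

Let size_P x : size (P x) = k.+1.
Proof.
rewrite /P -(eq_bigl _ _ (fun i => finset.in_setT i)) -big_enum size_prod_XsubC.
by rewrite -cardE finset.cardsT card_ord.
Qed.

Let size_cofactor x i : size (cofactor x i) = k.
Proof.
have := size_P x; rewrite (PE x i) size_monicM ?monicXsubC ?monic_neq0 ?monic_prod_XsubC//.
by rewrite size_XsubC /= => -[].
Qed.

Let coefP_cofactor x i j :
  (P x)`_j = (if j is j'.+1 then (cofactor x i)`_j' else 0) - x i * (cofactor x i)`_j.
Proof. by rewrite (PE x i) mulrBl coefB coefXM coefCM; case: j. Qed.

Let U_rec x j m : U x j m = psum x m * (P x)`_j.+1 + U x j.+1 m.+1.
Proof.
rewrite /U /psum mulr_suml -big_split/=; apply: eq_bigr => i _.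
by rewrite (coefP_cofactor x i) exprSr; ring.
Qed.

Let coefP_U x j : (P x)`_j *+ k + U x j 1 = (P x)`_j *+ j.
Proof.
have -> : (P x)`_j *+ k = \sum_(i < k) (P x)`_j by rewrite sumr_const card_ord.
rewrite /U -big_split/=; under eq_bigr => i _ do
  rewrite (coefP_cofactor x i) expr1 subrK.
case: j => [|j]; first by rewrite big1 ?mulr0n.
have /(congr1 (fun p : {poly S} => p`_j)) :
    (P x)^`() = \sum_i cofactor x i.
  rewrite /P deriv_prod_seq ?index_enum_uniq//; apply: eq_bigr => i _.
  by rewrite derivB derivX derivC subr0 mul1r.
by rewrite coef_deriv => ->; rewrite coef_sum.
Qed.

(** The power-weighted coefficient sums U x j m of the cofactors of P satisfy a
    recursion ([U_rec]) that trades the index j of a coefficient against the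
    weight m, and P' is the sum of the cofactors ([coefP_U]). Together these
    express (k - j) P_j through power sums and higher coefficients: Newton's
    identities, which determine P when 1, ..., k can be cancelled. *)
Lemma prod_XsubC_power_sums x y :
  (forall j, (0 < j <= k)%N -> forall a : S, a *+ j = 0 -> a = 0) ->
  (forall j, (0 < j <= k)%N -> \sum_i x i ^+ j = \sum_i y i ^+ j) ->
  \prod_i ('X - (x i)%:P) = \prod_i ('X - (y i)%:P).
Proof.
move=> kreg xy.
have xy' m : (m <= k)%N -> psum x m = psum y m.
  by case: m => [_|m mk]; [rewrite /psum; apply: eq_bigr | exact: xy].
have main d j : (j + d = k)%N ->
    (P x)`_j = (P y)`_j /\ forall m, (m <= j.+1)%N -> U x j m = U y j m.
  elim: d j => [|d IH] j.
    rewrite addn0 => ->; split.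
      have := monicP (monic_prod_XsubC (index_enum 'I_k) xpredT x).
      have := monicP (monic_prod_XsubC (index_enum 'I_k) xpredT y).
      by rewrite !lead_coefE -/(P x) -/(P y) !size_P /= => -> ->.
    by move=> m _; apply: eq_bigr => i _; rewrite !nth_default ?size_cofactor ?mulr0.
  rewrite addnS -addSn => /[dup] jk /IH [ePS eU].
  have eU' m : (m <= j.+1)%N -> U x j m = U y j m.
    move=> mj; rewrite U_rec [RHS]U_rec ePS eU ?xy'//.
    by rewrite (leq_trans mj)// -jk leq_addr.
  split=> //; apply/eqP; rewrite -subr_eq0; apply/eqP.
  apply: (kreg (k - j)%N); first by lia.
  have jk' : (j <= k)%N by lia.
  rewrite mulrnBr// mulrnBl; have := coefP_U x j; have := coefP_U y j.
  rewrite eU'// => hy hx; rewrite mulrnBl.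
  have -> : (P x)`_j *+ k = (P x)`_j *+ j - U y j 1 by rewrite -hx addrK.
  have -> : (P y)`_j *+ k = (P y)`_j *+ j - U y j 1 by rewrite -hy addrK.
  by ring.
apply/polyP => j; case: (leqP j k) => jk; last by rewrite !nth_default// size_P.
by have [] := main (k - j)%N j (subnKC jk).
Qed.

End Newton.

Lemma dvdz_intr_Zp (Q : nat) (z : int) : (1 < Q)%N -> ((z%:~R : 'Z_Q) == 0) = (Q %| z)%Z.
Proof.
move=> Q1; have natP (m : nat) : ((m%:R : 'Z_Q) == 0) = (Q %| m)%N.
  rewrite /dvdn -(val_Zp_nat Q1); apply/eqP/eqP => [->//|h].
  exact: val_inj.
case: z => m; first by rewrite dvdzE -natP.
by rewrite dvdzE NegzE abszN /= -natP mulrNz oppr_eq0.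
Qed.

Lemma dvdn_cancel_nonmultiple (q n m a b : nat) : prime q -> (0 < m)%N ->
  (q ^ n %| a * b)%N -> ~~ (q ^ m %| b)%N -> (q ^ (n - m.-1) %| a)%N.
Proof.
move=> qp m0 hab hb; have [->|a0] := posnP a; first exact: dvdn0.
have b0 : (0 < b)%N by case: b hb {hab} => //; rewrite dvdn0.
move: hab hb; rewrite !pfactor_dvdn ?muln_gt0 ?a0// lognM//; lia.
Qed.

Lemma dvdn_cancel_nonmultiples (I : eqType) (q n m a : nat) (s : seq I) (P : pred I) (b : I -> nat) :
  prime q -> (0 < m)%N -> (forall i, P i -> ~~ (q ^ m %| b i)%N) ->
  (q ^ n %| a * \prod_(i <- s | P i) b i)%N -> (q ^ (n - m.-1 * count P s) %| a)%N.
Proof.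
move=> qp m0 hb; elim: s a => [|i s IH] a; first by rewrite big_nil muln1 muln0 subn0.
rewrite big_cons /=; case: ifP => Pi; last by move=> /IH; rewrite add0n.
rewrite mulnA => /IH /(dvdn_cancel_nonmultiple qp m0) /(_ (hb i Pi)).
by rewrite mulnDr muln1 subnDA subnAC.
Qed.

Section Counting.
Variables (q n m k : nat) (q_pr : prime q) (kq : (k < q)%N) (m_gt0 : (0 < m)%N).

(** By Newton's identities modulo q^n, y_i is a root modulo q^n of the polynomial
    with roots x_l. In the product of the y_i - x_l all factors with l <> i are
    divisible by at most q^(m-1), so the factor y_i - x_i carries the rest. *)
Lemma power_sums_rigid (x y : 'I_k -> int) :
  (forall j : 'I_k, ((q ^ n)%N %| \sum_i x i ^+ j.+1 - \sum_i y i ^+ j.+1)%Z) ->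
  (forall i l, i != l -> ~~ ((q ^ m)%N %| y i - x l)%Z) ->
  forall i, ((q ^ (n - m.-1 * k.-1))%N %| y i - x i)%Z.
Proof.
move=> hs hd i.
have [->|n0] := posnP n; first by rewrite sub0n expn0 dvd1z.
have Q1 : (1 < q ^ n)%N by rewrite -(expn0 q) ltn_exp2l// prime_gt1.
have : ((q ^ n)%N %| \prod_l (y i - x l))%Z.
  rewrite -dvdz_intr_Zp// rmorph_prod/=.
  have kreg j : (0 < j <= k)%N -> forall a : 'Z_(q ^ n), a *+ j = 0 -> a = 0.
    move=> /andP[j0 jk] a aj; have ju : (j%:R : 'Z_(q ^ n)) \is a GRing.unit.
      rewrite unitZpE// coprimeXl// prime_coprime//.
      by apply/negP => /dvdn_leq; rewrite j0 => /(_ isT); lia.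
    by apply: (mulIr ju); rewrite mulr_natr aj mul0r.
  have eqs j : (0 < j <= k)%N ->
      \sum_l ((x l)%:~R : 'Z_(q ^ n)) ^+ j = \sum_l (y l)%:~R ^+ j.
    move=> /andP[j0 jk]; have jk' : (j.-1 < k)%N by lia.
    have := hs (Ordinal jk'); rewrite /= prednK// -dvdz_intr_Zp// rmorphB/= subr_eq0.
    rewrite !rmorph_sum/= => /eqP; under eq_bigr do rewrite rmorphXn/=.
    by under [in RHS]eq_bigr do rewrite rmorphXn/=.
  have := prod_XsubC_power_sums kreg eqs.
  move=> /(congr1 (fun p : {poly _} => p.[(y i)%:~R])).
  rewrite !horner_prod [RHS](bigD1 i)//= !hornerE subrr mul0r => h.
  apply/eqP; rewrite -[RHS]h; apply: eq_bigr => l _.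
  by rewrite rmorphB/= !hornerE.
rewrite (bigD1 i)//= dvdzE abszM => h.
rewrite dvdzE.
have -> : k.-1 = count (fun l => l != i) (index_enum 'I_k).
  have := cardC1 i; rewrite card_ord => <-; rewrite -sum1_card -sum1_count.
  by apply: eq_bigl => l; rewrite !inE.
apply: (@dvdn_cancel_nonmultiples _ q n m _ _ _ (fun l => `|(y i - x l)%R|%N)) => //.
  by move=> l li; have := hd i l; rewrite eq_sym => /(_ li); rewrite dvdzE.
by move: h; rewrite (big_morph absz (id1 := 1%N) (op1 := muln))// => u v; rewrite abszM.
Qed.

End Counting.

Section CountTuples.
Variables (q n m k : nat) (q_pr : prime q) (kq : (k < q)%N) (m_gt0 : (0 < m)%N).
Variables (a0 : int) (e : 'I_k -> nat) (c : 'I_k -> nat) (sigma : 'I_k -> int).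
Hypothesis e_le : forall j, (e j <= n)%N.
Hypothesis c_inj : forall i l, c i = c l %[mod q ^ m] -> i = l.

Let q0 : (0 < q)%N := prime_gt0 q_pr.
Let w := (m.-1 * k.-1)%N.
Let s (phi : {ffun 'I_k -> 'I_(q ^ n)}) (j : 'I_k) : int :=
  \sum_i ((phi i)%:Z - a0) ^+ j.+1.

(** If the j-th power sum is prescribed modulo q^(e_j), then q^(n - e_j) classes
    modulo q^n remain for it; and once all power sums are known modulo q^n, each
    entry is known up to its top w digits by rigidity. The pair of these data
    separates the tuples. *)
Lemma count_power_sums :
  (#|[set phi : {ffun 'I_k -> 'I_(q ^ n)} | [forall i, phi i == c i %[mod q ^ m]]
     && [forall j, ((q ^ e j)%N %| (s phi j - sigma j)%R)%Z]]|
   <= (\prod_j q ^ (n - e j)) * (q ^ w) ^ k)%N.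
Proof.
set A := [set phi | _].
pose tz phi j : int := modz (divz (s phi j - sigma j) (q ^ e j)%N) (q ^ (n - e j))%N.
have lt_tau phi j : (absz (tz phi j) < q ^ n)%N.
  have q1 : (0 : int) < (q ^ (n - e j))%N by rewrite ltz_nat expn_gt0 q0.
  have := modz_ge0 (divz (s phi j - sigma j) (q ^ e j)%N) (lt0r_neq0 q1).
  have := ltz_pmod (divz (s phi j - sigma j) (q ^ e j)%N) q1.
  have : (q ^ (n - e j) <= q ^ n)%N by rewrite leq_pexp2l// leq_subr.
  rewrite -/(tz phi j); lia.
have lt_kap (phi : {ffun 'I_k -> 'I_(q ^ n)}) i : (phi i %/ q ^ (n - w) < q ^ w)%N.
  rewrite ltn_divLR ?expn_gt0 ?q0// -expnD (leq_trans (ltn_ord _))// leq_pexp2l//; lia.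
(* tau records the power sums modulo q^n, kap the digits left open by rigidity. *)
pose tau phi : {ffun 'I_k -> 'I_(q ^ n)} := [ffun j => Ordinal (lt_tau phi j)].
pose kap phi : {ffun 'I_k -> 'I_(q ^ w)} := [ffun i => Ordinal (lt_kap phi i)].
pose F (j : 'I_k) : pred 'I_(q ^ n) := fun x => (x < q ^ (n - e j))%N.
have inj : {in A &, injective (fun phi => (tau phi, kap phi))}.
  move=> phi psi; rewrite !inE => /andP[/forallP phic /forallP phis].
  case/andP => /forallP psic /forallP psis [tE kE].
  have rig := @power_sums_rigid q n m k q_pr kq m_gt0
    (fun i => (phi i)%:Z - a0) (fun i => (psi i)%:Z - a0).
  have h1 (j : 'I_k) : ((q ^ n)%N %| \sum_i ((phi i)%:Z - a0) ^+ j.+1 - \sum_i ((psi i)%:Z - a0) ^+ j.+1)%Z.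
    have := phis j; have := psis j; have := congr1 (fun f : {ffun _ -> _} => val (f j)) tE.
    rewrite !ffunE /= /tz -/(s phi j) -/(s psi j).
    move=> h /dvdzP[u hu] /dvdzP[v hv].
    have qe0 : (q ^ e j)%N%:Z != 0 by rewrite eqz_nat -lt0n expn_gt0 q0.
    move: h; rewrite hu hv !mulzK// => h.
    have {}h : modz v (q ^ (n - e j))%N = modz u (q ^ (n - e j))%N.
      have qd0 : (q ^ (n - e j))%N%:Z != 0 by rewrite eqz_nat -lt0n expn_gt0 q0.
      by have := modz_ge0 u qd0; have := modz_ge0 v qd0; lia.
    have -> : s phi j - s psi j = (v - u) * (q ^ e j)%N.
      by rewrite mulrBl -hu -hv; ring.
    have -> : (q ^ n)%N = (q ^ (n - e j) * q ^ e j)%N by rewrite -expnD subnK.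
    by rewrite PoszM dvdz_mul// -eqz_mod_dvd; apply/eqP.
  have h2 (i l : 'I_k) : i != l -> ~~ ((q ^ m)%N %| ((psi i)%:Z - a0) - ((phi l)%:Z - a0))%Z.
    move=> il; have := phic l; have := psic i => /eqP pi /eqP pl.
    rewrite opprB addrA subrK -eqz_mod_dvd !modz_nat eqz_nat pi pl.
    by apply: contra il => /eqP/c_inj ->.
  apply/ffunP => i; apply: val_inj => /=.
  have := congr1 (fun f : {ffun _ -> _} => val (f i)) kE; rewrite !ffunE /=.
  have := rig h1 h2 i; rewrite opprB addrA subrK -eqz_mod_dvd !modz_nat eqz_nat -/w => /eqP hm hd.
  by rewrite (divn_eq (phi i) (q ^ (n - w))) hd -hm -divn_eq.
rewrite -(card_in_imset inj).
apply: (@leq_trans #|finset.setX [set t in family F] [set: {ffun 'I_k -> 'I_(q ^ w)}]|).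
  apply/subset_leq_card/fintype.subsetP => _ /imsetP[phi _ ->]; rewrite !inE andbT.
  apply/forallP => j; rewrite ffunE /F unfold_in /=.
  have q1 : (0 : int) < (q ^ (n - e j))%N by rewrite ltz_nat expn_gt0 q0.
  have := modz_ge0 (divz (s phi j - sigma j) (q ^ e j)%N) (lt0r_neq0 q1).
  have := ltz_pmod (divz (s phi j - sigma j) (q ^ e j)%N) q1.
  rewrite -/(tz phi j); lia.
rewrite cardsX finset.cardsT card_ffun !card_ord leq_mul2r; apply/orP; right.
rewrite cardsE card_family foldrE big_map big_enum/= leq_prod// => j _.
rewrite -[leqRHS]card_ord.
pose g (x : 'I_(q ^ n)) : 'I_(q ^ (n - e j)).+1 := inord x.
have gi : {in F j &, injective g}.
  move=> x y; rewrite !unfold_in => xF yF /(congr1 (@nat_of_ord _)); rewrite /g !inordK ?ltnS ?(ltnW xF) ?(ltnW yF)//.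
  by move/val_inj.
rewrite -(card_in_image gi); apply: (@leq_trans #|[set~ (ord_max : 'I_(q ^ (n - e j)).+1)]|); last first.
  by rewrite cardsC1 !card_ord.
apply/subset_leq_card/fintype.subsetP => y /fintype.imageP[x xF ->]; rewrite !inE.
move: xF; rewrite unfold_in => xF; apply/eqP => /(congr1 (@nat_of_ord _)).
by rewrite /g inordK ?ltnS ?(ltnW xF)//= => h; rewrite h ltnn in xF.
Qed.

End CountTuples.

Local Open Scope classical_set_scope.

(** * Discretely valued fields, balls and polynomials *)

(** Taylor expansion at a, with divided derivatives. *)
Lemma coef_comp_affine (F : comNzRingType) (p : {poly F}) (a c : F) (l : nat) :
  (p \Po (a%:P + c *: 'X))`_l = c ^+ l * p^`N(l).[a].
Proof.
have -> : p \Po (a%:P + c *: 'X) = \sum_(i < size p) (p^`N(i).[a] * c ^+ i) *: 'X^i.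
  rewrite /comp_poly nderiv_taylor; last exact: mulrC.
  rewrite size_map_polyC; apply: eq_bigr => i _.
  by rewrite nderivn_map horner_map /= exprZn mul_polyC scalerA.
rewrite -(poly_def (size p) (fun i => p^`N(i).[a] * c ^+ i)) coef_poly mulrC.
by case: ltnP => // ls; rewrite nderivn_poly0// horner0 mulr0.
Qed.

Lemma cell_identity (F : fieldType) (u v x m : F) : u != 0 -> v != 0 ->
  u * (x - (u * v)^-1 * m) = (u * v * x - m) / v.
Proof. by move=> u0 v0; field; rewrite u0 v0. Qed.

Lemma exprD_divK (F : fieldType) (u : F) (a n j : nat) : u != 0 ->
  u ^+ (a + n * j) * (u ^- n) ^+ j = u ^+ a.
Proof. by move=> u0; rewrite exprD exprVn -exprM mulfK// expf_neq0. Qed.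

(** A field with the features of Q_q that matter here: a ring of integers O with
    uniformizer w and residue field Z/q, in which the integers are dense. *)
Structure discreteField := DiscreteField {
  df_sort :> fieldType;
  valring : {pred df_sort};
  unif : df_sort;
  resid : nat;
  df_subring : subring_closed valring;
  resid_prime : prime resid;
  unifE : unif = resid%:R;
  unif_neq0 : unif != 0;
  unifO : unif \in valring;
  valring_bounded : forall x, exists N : nat, unif ^+ N * x \in valring;
  valring_dense : forall n x, x \in valring ->
    exists2 l : nat, (l < resid ^ n)%N & (x - l%:R) / unif ^+ n \in valring;
  valring_intV : forall (z : int) (n : nat),
    (z%:~R / unif ^+ n \in valring) = ((resid ^ n)%N %| z)%Z }.
Arguments valring {d}.
HB.instance Definition _ (K : discreteField) :=
  GRing.isSubringClosed.Build K (@valring K) (df_subring K).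

Section Points.
Variables (K : discreteField) (k : nat).
Local Notation w := (unif K).
Local Notation q := (resid K).
Local Notation O := (@valring K).
Local Notation pt := 'rV[K]_k.
Implicit Types (x y t : pt) (z : int).

Let w0 : w != 0 := unif_neq0 K.

Lemma residue_unique (x : K) (a a' n : nat) : (a < q ^ n)%N -> (a' < q ^ n)%N ->
  (x - a%:R) / w ^+ n \in O -> (x - a'%:R) / w ^+ n \in O -> a = a'.
Proof.
move=> an a'n ha ha'; have := rpredB ha ha'; rewrite -mulrBl opprB addrC addrA subrK.
have -> : a'%:R - a%:R = (a'%:Z - a%:Z)%:~R :> K by rewrite rmorphB.
by rewrite valring_intV -eqz_mod_dvd !modz_nat !modn_small// => /eqP[->].
Qed.

Lemma residue_recenter (x b c : K) (n : nat) : (b - c) / w ^+ n \in O ->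
  ((x - b) / w ^+ n \in O) = ((x - c) / w ^+ n \in O).
Proof.
move=> bc; have -> : (x - c) / w ^+ n = (x - b) / w ^+ n + (b - c) / w ^+ n.
  by rewrite -mulrDl addrA subrK.
apply/idP/idP => [xb|h]; first exact: rpredD.
by rewrite -[_ / _](addrK ((b - c) / w ^+ n)) rpredB.
Qed.

(** The ball of radius q^z around 0. *)
Definition qball (z : int) : pred pt := fun x => [forall i, w ^ z * x 0 i \in O].

Lemma qballP z x : reflect (forall i, w ^ z * x 0 i \in O) (qball z x).
Proof. exact: forallP. Qed.

Lemma qball0 z : qball z 0.
Proof. by apply/qballP => i; rewrite mxE mulr0 rpred0. Qed.

Lemma qballD z x y : qball z x -> qball z y -> qball z (x + y).
Proof.
by move=> /qballP xz /qballP yz; apply/qballP => i; rewrite mxE mulrDr rpredD.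
Qed.

Lemma qballN z x : qball z (- x) = qball z x.
Proof. by apply: eq_forallb => i; rewrite mxE mulrN rpredN. Qed.

Lemma qballB z x y : qball z x -> qball z y -> qball z (x - y).
Proof. by move=> xz yz; rewrite qballD// qballN. Qed.

Lemma qballDr z x y : qball z y -> qball z (x + y) = qball z x.
Proof.
move=> yz; apply/idP/idP => [h|h]; last exact: qballD.
by rewrite -[x](addrK y) qballB.
Qed.

Lemma uniformizerX_integral (n : nat) : w ^+ n \in O.
Proof. by rewrite rpredX// unifO. Qed.

Lemma qball_mono z z' x : z <= z' -> qball z x -> qball z' x.
Proof.
move=> zz' /qballP xz; apply/qballP => i.
have -> : w ^ z' = w ^+ `|z' - z|%N * w ^ z.
  by rewrite exprnP -expfzDr//; congr (_ ^ _); lia.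
by rewrite -mulrA rpredM// uniformizerX_integral.
Qed.

Lemma qball_exists x : exists N : nat, qball N x.
Proof.
have /choice[N hN] i : exists N : nat, w ^+ N * x 0 i \in O by exact: valring_bounded.
exists (\max_i N i)%N; apply/qballP => i.
rewrite -exprnP -(subnK (leq_bigmax i)) exprD -mulrA rpredM// uniformizerX_integral.
by [].
Qed.

(** Representatives of the cosets of the ball of radius q^z in that of radius
    q^(z + d). *)
Definition grid (z : int) (d : nat) (l : {ffun 'I_k -> 'I_(q ^ d)}) : pt :=
  \row_i (w ^ (- (z + d%:Z)) * (l i)%:R).

Lemma grid_ball z d (l : {ffun 'I_k -> 'I_(q ^ d)}) : qball (z + d%:Z) (grid z l).
Proof.
apply/qballP => i; rewrite mxE mulrA -expfzDr// subrr expr0z mul1r.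
exact: rpred_nat.
Qed.

Lemma grid_sum (V : zmodType) (z : int) (d : nat) (v : V) x : qball (z + d%:Z) x ->
  \sum_(l : {ffun 'I_k -> 'I_(q ^ d)}) (if qball z (x - grid z l) then v else 0) = v.
Proof.
move=> /qballP xz.
have /choice[l hl] i : exists l : 'I_(q ^ d), (w ^ (z + d%:Z) * x 0 i - l%:R) / w ^+ d \in O.
  by have [l lq h] := valring_dense d (xz i); exists (Ordinal lq).
pose l0 : {ffun 'I_k -> 'I_(q ^ d)} := [ffun i => l i].
have wz i (m : nat) : w ^ z * (x 0 i - w ^ (- (z + d%:Z)) * m%:R) =
    (w ^ (z + d%:Z) * x 0 i - m%:R) / w ^+ d.
  rewrite -invr_expz expfzDr// -exprnP.
  by apply: cell_identity; rewrite ?expfz_neq0 ?expf_neq0.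
have l0x : qball z (x - grid z l0).
  by apply/qballP => i; rewrite !mxE wz ffunE.
rewrite (bigD1 l0)//= l0x big1 ?addr0// => l1 l1l0; case: ifP => // l1x.
case/eqP: l1l0; apply/ffunP => i; apply: val_inj => /=.
move/qballP: l1x => /(_ i); rewrite !mxE wz => h1.
move/qballP: l0x => /(_ i); rewrite !mxE wz => h0.
exact: residue_unique (ltn_ord _) (ltn_ord _) h1 h0.
Qed.

(** The value of ppoly x at a is gamma(a).x; row_of reads off the coefficients
    and forgets the constant term, which ppoly does not have. *)
Definition ppoly x : {poly K} := \sum_(i < k) x 0 i *: 'X^(i.+1).
Definition row_of (p : {poly K}) : pt := \row_i p`_i.+1.

Lemma coef_ppoly x (i : 'I_k) : (ppoly x)`_i.+1 = x 0 i.
Proof.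
rewrite /ppoly coef_sum (bigD1 i)//= coefZ coefXn eqxx mulr1 big1 ?addr0// => j ji.
by rewrite coefZ coefXn eqSS eq_sym val_eqE (negPf ji) mulr0.
Qed.

Lemma coef0_ppoly x : (ppoly x)`_0 = 0.
Proof. by rewrite /ppoly coef_sum big1// => j _; rewrite coefZ coefXn mulr0. Qed.

Lemma size_ppoly x : (size (ppoly x) <= k.+1)%N.
Proof.
apply: (leq_trans (size_sum _ _ _)); apply/bigmax_leqP => i _.
by rewrite (leq_trans (size_scale_leq _ _))// size_polyXn ltnS.
Qed.

Lemma row_of_ppoly x : row_of (ppoly x) = x.
Proof. by apply/rowP => i; rewrite mxE coef_ppoly. Qed.

Lemma ppoly_row_of (p : {poly K}) : (size p <= k.+1)%N -> ppoly (row_of p) = p - (p`_0)%:P.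
Proof.
move=> pk; apply/polyP => i; rewrite coefB coefC.
case: i => [|i]; first by rewrite coef0_ppoly subrr.
rewrite subr0; case: (ltnP i k) => ik.
  by rewrite (coef_ppoly _ (Ordinal ik)) mxE.
by rewrite nth_default ?(leq_trans (size_ppoly _))// nth_default// (leq_trans pk).
Qed.

Lemma ppoly_is_additive : additive ppoly.
Proof.
move=> x y; rewrite /ppoly -sumrB; apply: eq_bigr => i _.
by rewrite !mxE scalerBl.
Qed.
HB.instance Definition _ := GRing.isZmodMorphism.Build _ _ ppoly ppoly_is_additive.

Lemma row_of_is_additive : additive row_of.
Proof. by move=> x y; apply/rowP => i; rewrite !mxE coefB. Qed.
HB.instance Definition _ := GRing.isZmodMorphism.Build _ _ row_of row_of_is_additive.

(** The lattice dual to theta_K - gamma(a), for K of centre a and length q^-n. *)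
Definition Tset (a : K) (n : nat) t : Prop :=
  forall i, (ppoly t \Po (a%:P + w ^+ n *: 'X))`_i.+1 \in O.

Lemma qball_polyOver (n : nat) t : qball n t -> w ^+ n *: ppoly t \is a polyOver O.
Proof.
move=> /qballP tn; apply/polyOverP => -[|i]; rewrite coefZ.
  by rewrite coef0_ppoly mulr0 rpred0.
case: (ltnP i k) => ik; first by rewrite (coef_ppoly _ (Ordinal ik)) exprnP.
by rewrite nth_default ?mulr0 ?rpred0// (leq_trans (size_ppoly _)).
Qed.

Lemma Tset_qball (a : K) (n : nat) t : a \in O -> qball n t -> Tset a n t.
Proof.
move=> aO /qball_polyOver tn i; rewrite coef_comp_affine exprSr -mulrA rpredM//.
  by rewrite rpredX// uniformizerX_integral.
by rewrite -hornerZ -nderivnZ rpred_horner// polyOver_nderivn.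
Qed.

(** Recover P_t from its expansion around a by substituting (Y - a) / w^n; the
    degree k of P_t accounts for the factor k in the radius. *)
Lemma qball_Tset (a : K) (n : nat) t : a \in O -> Tset a n t -> qball (n * k)%N t.
Proof.
move=> aO tT; pose p := ppoly t; pose r := p \Po (a%:P + w ^+ n *: 'X).
pose s := (w ^+ n)^-1 *: 'X - ((w ^+ n)^-1 * a)%:P.
have wn0 : w ^+ n != 0 by rewrite expf_neq0.
have pr : p = r \Po s.
  rewrite /r -comp_polyA comp_polyD comp_polyC comp_polyZ comp_polyX /s scalerBr scalerA.
  by rewrite mulfV// scale1r -mul_polyC -polyCM mulrA mulfV// mul1r addrC subrK comp_polyXr.
have size_r : (size r <= k.+1)%N.
  apply: (leq_trans (size_comp_poly_leq _ _)); rewrite ltnS.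
  have sa : (size (a%:P + w ^+ n *: 'X)).-1 = 1%N.
    by rewrite addrC size_addl ?size_scale// size_polyX// ltnS size_polyC leq_b1.
  by rewrite sa muln1 /p; case: (size (ppoly t)) (size_ppoly t).
apply/qballP => i; rewrite -exprnP -(coef_ppoly t) -/p pr comp_polyE coef_sum mulr_sumr.
rewrite rpred_sum// => j _; rewrite coefZ.
have -> : s = (w ^+ n)^-1 *: ('X - a%:P) by rewrite scalerBr /s polyCM mul_polyC.
rewrite exprZn coefZ; case: j => -[|j] jr /=.
  by rewrite !expr0 coef1 !mulr0 rpred0.
have jk : (j.+1 <= k)%N by rewrite -ltnS (leq_trans jr).
rewrite mulrCA; apply: rpredM; first exact: tT.
rewrite mulrA; apply: rpredM.
  have -> : (n * k = n * (k - j.+1) + n * j.+1)%N by rewrite -mulnDr subnK.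
  by rewrite exprD_divK// uniformizerX_integral.
suff /polyOverP : ('X - a%:P) ^+ j.+1 \is a polyOver O by apply.
by rewrite rpredX// polyOverXsubC.
Qed.

(** On the interval a + w^n O the polynomial P_t varies by integers only, so chi
    does not see the choice of the base point in the interval. *)
Lemma Tset_horner (a b : K) (n : nat) t : b \in O -> Tset a n t ->
  (ppoly t).[a + w ^+ n * b] - (ppoly t).[a] \in O.
Proof.
move=> bO tT; set r := ppoly t \Po (a%:P + w ^+ n *: 'X).
have rb c : r.[c] = (ppoly t).[a + w ^+ n * c] by rewrite horner_comp !hornerE.
have -> : (ppoly t).[a] = r`_0 by rewrite -horner_coef0 rb mulr0 addr0.
have -> : (ppoly t).[a + w ^+ n * b] - r`_0 = (r - (r`_0)%:P).[b] by rewrite -rb !hornerE.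
apply: rpred_horner => //; apply/polyOverP => -[|i].
  by rewrite coefB coefC /= subrr rpred0.
by rewrite coefB coefC /= subr0; exact: tT.
Qed.

(** The linear map of the spatial variable that is dual to the affine map
    Y |-> a + c Y of the parameter of the curve. *)
Definition rescale (a c : K) x : pt := row_of (ppoly x \Po (a%:P + c *: 'X)).

Lemma size_affine_comp (p : {poly K}) (a c : K) : c != 0 ->
  size (p \Po (a%:P + c *: 'X)) = size p.
Proof.
move=> c0; rewrite size_comp_poly2// addrC size_addl size_scale// size_polyX//.
by rewrite ltnS size_polyC leq_b1.
Qed.

Lemma ppoly_rescale a c x : c != 0 ->
  ppoly (rescale a c x) = ppoly x \Po (a%:P + c *: 'X) - (ppoly x).[a]%:P.
Proof.
move=> c0; rewrite ppoly_row_of ?size_affine_comp ?size_ppoly//.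
by rewrite -horner_coef0 horner_comp !hornerE.
Qed.

Lemma rescaleB a c : additive (rescale a c).
Proof. by move=> x y; rewrite /rescale raddfB comp_polyB raddfB. Qed.
HB.instance Definition _ a c :=
  GRing.isZmodMorphism.Build _ _ (rescale a c) (rescaleB a c).

Lemma rescaleK a c : c != 0 -> cancel (rescale a c) (rescale (- (a / c)) c^-1).
Proof.
move=> c0 x; rewrite /rescale ppoly_rescale// comp_polyB comp_polyC -comp_polyA.
have -> : (a%:P + c *: 'X) \Po ((- (a / c))%:P + c^-1 *: 'X) = 'X.
  rewrite comp_polyD comp_polyC comp_polyZ comp_polyX scalerDr scalerA mulfV// scale1r.
  by rewrite -mul_polyC -polyCM mulrN [c * _]mulrC divfK// polyCN addNKr.
rewrite comp_polyXr raddfB/= row_of_ppoly; apply/rowP => i.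
by rewrite !mxE coefC subr0.
Qed.

Lemma rescaleVK a c : c != 0 -> cancel (rescale (- (a / c)) c^-1) (rescale a c).
Proof.
move=> c0; have c0' : c^-1 != 0 by rewrite invr_eq0.
have := rescaleK (- (a / c)) c0'; rewrite invrK mulNr opprK divfK//.
Qed.

Lemma horner_rescale a c x b : c != 0 ->
  (ppoly (rescale a c x)).[b] = (ppoly x).[a + c * b] - (ppoly x).[a].
Proof. by move=> c0; rewrite ppoly_rescale// hornerD hornerN hornerC horner_comp !hornerE. Qed.

Lemma Tset_rescale (a b : K) (m n : nat) t :
  Tset b n (rescale a (w ^+ m) t) <-> Tset (a + w ^+ m * b) (m + n) t.
Proof.
suff h i : (ppoly (rescale a (w ^+ m) t) \Po (b%:P + w ^+ n *: 'X))`_i.+1 =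
    (ppoly t \Po ((a + w ^+ m * b)%:P + w ^+ (m + n) *: 'X))`_i.+1.
  by split=> tT i; have := tT i; rewrite h.
rewrite ppoly_rescale ?expf_neq0// comp_polyB comp_polyC coefB coefC subr0 -comp_polyA.
congr (_ \Po _)`_ _; rewrite comp_polyD comp_polyC comp_polyZ comp_polyX scalerDr scalerA.
by rewrite -exprD addrA -mul_polyC -polyCM polyCD.
Qed.

Lemma rescale_bounded a c : exists M : nat,
  forall z x, qball z x -> qball (z + M%:Z) (rescale a c x).
Proof.
have /choice[N hN] (ij : 'I_k * 'I_k) : exists N : nat,
    w ^+ N * (('X^(ij.1.+1) : {poly K}) \Po (a%:P + c *: 'X))`_ij.2.+1 \in O.
  exact: valring_bounded.
exists (\max_ij N ij)%N => z x /qballP xz; apply/qballP => j.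
rewrite mxE /ppoly linear_sum/= coef_sum mulr_sumr rpred_sum// => i _.
rewrite comp_polyZ coefZ expfzDr// mulrACA rpredM// -exprnP.
rewrite -(subnK (leq_bigmax (i, j))) exprD -mulrA rpredM// ?uniformizerX_integral//.
Qed.

End Points.

(** * Schwartz functions and Haar functionals *)

Section SchwartzClass.
Variables (K : discreteField) (k : nat).
Local Notation pt := 'rV[K]_k.
Implicit Types (x y t : pt) (z : int).

Definition locconst (V : Type) (f : pt -> V) : Prop :=
  exists N : nat, forall x t, qball (- N%:Z) t -> f (x + t) = f x.

Definition bounded_support (V : nmodType) (f : pt -> V) : Prop :=
  exists N : nat, forall x, f x != 0 -> qball N x.

(** Schwartz functions. Values in any additive group are allowed, so that the same
    closure lemmas serve real and complex functions. *)
Definition Sch (V : nmodType) (f : pt -> V) : Prop := locconst f /\ bounded_support f.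

Lemma locconst_comp2 (V1 V2 V : Type) (F : V1 -> V2 -> V) f g :
  locconst f -> locconst g -> locconst (fun x => F (f x) (g x)).
Proof.
move=> [N hN] [M hM]; exists (N + M)%N => x t xt.
by rewrite hN ?hM//; apply: (qball_mono _ xt); lia.
Qed.

Lemma locconst_comp (V1 V : Type) (F : V1 -> V) f :
  locconst f -> locconst (fun x => F (f x)).
Proof. by move=> [N hN]; exists N => x t xt; rewrite hN. Qed.

Lemma locconst_cst (V : Type) (v : V) : locconst (fun=> v).
Proof. by exists 0%N. Qed.

Lemma locconst_shift (V : Type) (f : pt -> V) t : locconst f -> locconst (fun x => f (x + t)).
Proof. by move=> [N hN]; exists N => x s xs; rewrite addrAC; exact: hN. Qed.

Lemma locconst_big (V : Type) (op : V -> V -> V) (idx : V) (I : Type) (s : seq I)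
    (P : pred I) (f : I -> pt -> V) : (forall i, P i -> locconst (f i)) ->
  locconst (fun x => \big[op/idx]_(i <- s | P i) f i x).
Proof.
move=> hf; elim: s => [|i s IH].
  rewrite (_ : (fun _ => _) = fun=> idx); first exact: locconst_cst.
  by apply/funext => x; rewrite big_nil.
rewrite (_ : (fun _ => _) = fun x => if P i then op (f i x) (\big[op/idx]_(j <- s | P j) f j x)
    else \big[op/idx]_(j <- s | P j) f j x).
  by case: (boolP (P i)) => Pi //; apply: locconst_comp2 => //; exact: hf.
by apply/funext => x; rewrite big_cons.
Qed.

Lemma Sch_comp2 (V1 V2 V : nmodType) (F : V1 -> V2 -> V) f g : F 0 0 = 0 ->
  Sch f -> Sch g -> Sch (fun x => F (f x) (g x)).
Proof.
move=> F0 [lf [N hN]] [lg [M hM]]; split; first exact: locconst_comp2.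
exists (N + M)%N => x; have [fx|fx _] := eqVneq (f x) 0; last first.
  by apply: (qball_mono _ (hN _ fx)); lia.
have [gx|gx _] := eqVneq (g x) 0; first by rewrite fx gx F0 eqxx.
by apply: (qball_mono _ (hM _ gx)); lia.
Qed.

Lemma Sch_comp (V1 V : nmodType) (F : V1 -> V) f : F 0 = 0 -> Sch f -> Sch (fun x => F (f x)).
Proof.
move=> F0 [lf [N hN]]; split; first exact: locconst_comp.
exists N => x; have [fx|fx _] := eqVneq (f x) 0; first by rewrite fx F0 eqxx.
exact: hN.
Qed.

(** A Schwartz function may be combined with a function that is merely locally
    constant, such as a character. *)
Lemma Sch_lc (V1 V : nmodType) (V2 : Type) (F : V1 -> V2 -> V) f g : (forall v, F 0 v = 0) ->
  Sch f -> locconst g -> Sch (fun x => F (f x) (g x)).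
Proof.
move=> F0 [lf [N hN]] lg; split; first exact: locconst_comp2.
exists N => x; have [fx|fx _] := eqVneq (f x) 0; first by rewrite fx F0 eqxx.
exact: hN.
Qed.

Lemma Sch0 (V : nmodType) : Sch (fun=> (0 : V)).
Proof. by split; [exact: locconst_cst|exists 0%N => x; rewrite eqxx]. Qed.

Lemma Sch_sum (V : nmodType) (I : Type) (s : seq I) (P : pred I) (f : I -> pt -> V) :
  (forall i, P i -> Sch (f i)) -> Sch (fun x => \sum_(i <- s | P i) f i x).
Proof.
move=> hf; elim: s => [|i s IH].
  rewrite (_ : (fun _ => _) = fun=> 0); first exact: Sch0.
  by apply/funext => x; rewrite big_nil.
rewrite (_ : (fun _ => _) = fun x => if P i then f i x + \sum_(j <- s | P j) f j x
    else \sum_(j <- s | P j) f j x).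
  by case: (boolP (P i)) => Pi //; apply: (Sch_comp2 (addr0 0)) => //; exact: hf.
by apply/funext => x; rewrite big_cons.
Qed.

Lemma Sch_prod (V : comNzRingType) (I : finType) (f : I -> pt -> V) (i0 : I) :
  (forall i, Sch (f i)) -> Sch (fun x => \prod_i f i x).
Proof.
move=> hf; rewrite (_ : (fun _ => _) = fun x => f i0 x * \prod_(i | i != i0) f i x); last first.
  by apply/funext => x; rewrite (bigD1 i0).
apply: (Sch_lc (fun v => mul0r v)) => //.
by apply: locconst_big => i _; case: (hf i).
Qed.

Lemma Sch_shift (V : nmodType) (f : pt -> V) t : Sch f -> Sch (fun x => f (x + t)).
Proof.
move=> [lf [N hN]]; split; first exact: locconst_shift.
have [M hM] := qball_exists t; exists (N + M)%N => x /hN h.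
rewrite -[x](addrK t); apply: qballB; [apply: (qball_mono _ h)|apply: (qball_mono _ hM)]; lia.
Qed.

Lemma locconst_ball z c : locconst (fun x => qball z (x - c)).
Proof.
exists `|z|%N => x t xt; rewrite addrAC; apply: qballDr; apply: (qball_mono _ xt); lia.
Qed.

Lemma Sch_ball (V : nzSemiRingType) z c : Sch (fun x => (qball z (x - c))%:R : V).
Proof.
split; first exact: (locconst_comp (fun b : bool => b%:R) (locconst_ball z c)).
have [M hM] := qball_exists c; exists (`|z| + M)%N => x.
case: (boolP (qball z (x - c))) => [h _|]; last by rewrite eqxx.
rewrite -[x](subrK c); apply: qballD; [apply: (qball_mono _ h)|apply: (qball_mono _ hM)]; lia.
Qed.

Lemma Sch_indic (V : nmodType) (f : pt -> V) (b : pt -> bool) :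
  Sch f -> locconst b -> Sch (fun x => if b x then f x else 0).
Proof.
move=> Sf lb; apply: (@Sch_lc _ _ _ (fun v (b : bool) => if b then v else 0)) => //.
by case.
Qed.

Lemma locconst_rescale (V : Type) (f : pt -> V) a c : locconst f ->
  locconst (fun x => f (rescale a c x)).
Proof.
have [M hM] := rescale_bounded k a c; move=> [N hN]; exists (N + M)%N => x t xt.
rewrite raddfD/= hN//.
by have := hM _ _ xt; congr qball; lia.
Qed.

Lemma Sch_rescale (V : nmodType) (f : pt -> V) a c : c != 0 -> Sch f ->
  Sch (fun x => f (rescale a c x)).
Proof.
move=> c0 [lf [N hN]]; split; first exact: locconst_rescale.
have [M hM] := rescale_bounded k (- (a / c)) c^-1; exists (N + M)%N => x /hN /hM.
by rewrite rescaleK// PoszD.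
Qed.

Lemma Sch_stage (V : nmodType) (f : pt -> V) : Sch f -> exists N : nat,
  (forall x t, qball (- N%:Z) t -> f (x + t) = f x) /\ (forall x, f x != 0 -> qball N x).
Proof.
move=> [[N hN] [M hM]]; exists (N + M)%N; split => [x t xt|x fx].
  by apply: hN; apply: (qball_mono _ xt); lia.
by apply: (qball_mono _ (hM _ fx)); lia.
Qed.

End SchwartzClass.

Section HaarFunctional.
Variables (R : realType) (K : discreteField) (k : nat).
Local Notation pt := 'rV[K]_k.
Local Notation q := (resid K).
Implicit Types (x y t : pt) (f g : pt -> R).

(** The properties of integration against a Haar measure on Schwartz functions. An
    axiomatic description is convenient because rescaling turns one such
    functional into another. *)
Record invariant_functional (I : (pt -> R) -> R) : Prop := InvariantFunctional {
  inv_funD : forall f g, Sch f -> Sch g -> I (fun x => f x + g x) = I f + I g;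
  inv_funZ : forall a f, Sch f -> I (fun x => a * f x) = a * I f;
  inv_fun_ge0 : forall f, Sch f -> (forall x, 0 <= f x) -> 0 <= I f;
  inv_fun_shift : forall f t, Sch f -> I (fun x => f (x + t)) = I f }.

Definition unit_cube : pt -> R := fun x => (qball 0 x)%:R.

Lemma Sch_unit_cube : Sch unit_cube.
Proof.
have := @Sch_ball K k R 0 0; rewrite /unit_cube.
by rewrite (_ : (fun _ => _) = unit_cube)//; apply/funext => x; rewrite subr0.
Qed.

Section Invariant.
Variable (I : (pt -> R) -> R).
Hypothesis hI : invariant_functional I.

Lemma inv_fun0 : I (fun=> 0) = 0.
Proof.
have := inv_funZ hI 0 (@Sch0 K k R); rewrite [RHS]mul0r.
by move=> h; rewrite -[RHS]h; congr I; apply/funext => x; rewrite mulr0.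
Qed.

Lemma inv_fun_sum (J : Type) (s : seq J) (P : pred J) (f : J -> pt -> R) :
  (forall j, P j -> Sch (f j)) ->
  I (fun x => \sum_(j <- s | P j) f j x) = \sum_(j <- s | P j) I (f j).
Proof.
move=> hf; elim: s => [|j s IH].
  by rewrite big_nil -[RHS]inv_fun0; congr I; apply/funext => x; rewrite big_nil.
rewrite big_cons -IH; case: (boolP (P j)) => Pj.
  rewrite -inv_funD//; [|exact: hf|exact: Sch_sum].
  by congr I; apply/funext => x; rewrite big_cons Pj.
by congr I; apply/funext => x; rewrite big_cons (negPf Pj).
Qed.

Lemma inv_fun_le f g : Sch f -> Sch g -> (forall x, f x <= g x) -> I f <= I g.
Proof.
move=> Sf Sg fg.
have Sgf : Sch (fun x => g x - f x) by exact: (@Sch_comp2 _ _ _ _ _ (fun a b => a - b) g f (subr0 0) Sg Sf).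
have -> : I g = I (fun x => f x + (g x - f x)).
  by congr I; apply/funext => x; rewrite addrC subrK.
by rewrite inv_funD// lerDl inv_fun_ge0// => x; rewrite subr_ge0.
Qed.

Lemma inv_fun_ball z c : I (fun x => (qball z (x - c))%:R) = I (fun x => (qball z x)%:R).
Proof.
have := inv_fun_shift hI c (Sch_ball R z c) => <-.
by congr I; apply/funext => x; rewrite addrK.
Qed.

Lemma inv_fun_cells (z : int) (d : nat) f : Sch f ->
  (forall x, f x != 0 -> qball (z + d%:Z) x) ->
  I f = \sum_(l : {ffun 'I_k -> 'I_(q ^ d)})
     I (fun x => if qball z (x - grid z l) then f x else 0).
Proof.
move=> Sf fz; rewrite -inv_fun_sum; last first.
  by move=> l _; apply: Sch_indic => //; exact: locconst_ball.
congr I; apply/funext => x; have [fx|fx] := eqVneq (f x) 0.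
  by rewrite big1// => l _; rewrite fx; case: ifP.
by rewrite grid_sum// fz.
Qed.

(** A Schwartz function is a step function on a grid, so its integral is a finite
    sum times the volume of a small ball. *)
Lemma inv_fun_grid (N : nat) f : Sch f ->
  (forall x t, qball (- N%:Z) t -> f (x + t) = f x) -> (forall x, f x != 0 -> qball N x) ->
  I f = I (fun x => (qball (- N%:Z) x)%:R) *
    \sum_(l : {ffun 'I_k -> 'I_(q ^ (N + N))}) f (grid (- N%:Z) l).
Proof.
move=> Sf fc fs; have e : - N%:Z + (N + N)%N%:Z = N by lia.
have cell (l : {ffun 'I_k -> 'I_(q ^ (N + N))}) x :
    qball (- N%:Z) (x - grid (- N%:Z) l) -> f x = f (grid (- N%:Z) l).
  by move=> h; rewrite -[in LHS](subrK (grid (- N%:Z) l) x) addrC fc.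
rewrite (inv_fun_cells (z := - N%:Z) (d := (N + N)%N) Sf); last by move=> x; rewrite e; exact: fs.
rewrite mulr_sumr; apply: eq_bigr => l _; rewrite mulrC -(inv_fun_ball _ (grid (- N%:Z) l)).
rewrite -inv_funZ//; last exact: Sch_ball.
congr I; apply/funext => x; case: ifP => [/cell ->|]; by rewrite ?mulr1 ?mulr0.
Qed.

Lemma inv_fun_balls (z : int) (d : nat) :
  I (fun x => (qball (z + d%:Z) x)%:R) = (q ^ d)%:R ^+ k * I (fun x => (qball z x)%:R).
Proof.
have Sb : Sch (fun x => (qball (z + d%:Z) x)%:R : R).
  have := @Sch_ball K k R (z + d%:Z) 0; congr Sch.
  by apply/funext => x; rewrite subr0.
rewrite (inv_fun_cells (z := z) (d := d) Sb); last first.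
  by move=> x; case: qball => //; rewrite eqxx.
have zz : z <= z + d%:Z by lia.
rewrite (eq_bigr (fun=> I (fun x => (qball z x)%:R))) => [|l _].
  by rewrite sumr_const card_ffun !card_ord -[LHS]mulr_natl natrX.
rewrite -(inv_fun_ball z (grid z l)); congr I; apply/funext => x.
case: ifP => // h; have := qball_mono zz h => /qballD/(_ (grid_ball z l)).
by rewrite subrK => ->.
Qed.

End Invariant.

(** Uniqueness of Haar measure: both sides are the same finite sum, and the volume
    of a small ball is a fixed fraction of that of the unit cube. *)
Lemma inv_fun_unique I J : invariant_functional I -> invariant_functional J ->
  forall f, Sch f -> J unit_cube * I f = I unit_cube * J f.
Proof.
move=> hI hJ f Sf; have [N [fc fs]] := Sch_stage Sf.
rewrite (inv_fun_grid hI Sf fc fs) (inv_fun_grid hJ Sf fc fs).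
have := inv_fun_balls hI (- N%:Z) N; have := inv_fun_balls hJ (- N%:Z) N.
by rewrite addNr => -> ->; ring.
Qed.

End HaarFunctional.

Section Haar.
Variables (R : realType) (K : discreteField) (k : nat).
Local Notation pt := 'rV[K]_k.
Local Notation q := (resid K).
Implicit Types (x y t : pt) (f g : pt -> R).
Variable (I : (pt -> R) -> R).
Hypotheses (hI : invariant_functional I) (I1 : I (@unit_cube R K k) = 1).

Lemma haar_gt0 f x0 : Sch f -> (forall x, 0 <= f x) -> 0 < f x0 -> 0 < I f.
Proof.
move=> Sf f0 fx0; have [N [fc fs]] := Sch_stage Sf.
have Iball : 0 < I (fun x => (qball (- N%:Z) x)%:R).
  have := inv_fun_balls hI (- N%:Z) N; rewrite addNr -/(@unit_cube R K k) I1 => h.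
  have : 0 < (q ^ N)%:R ^+ k * I (fun x => (qball (- N%:Z) x)%:R) by rewrite -h ltr01.
  by rewrite pmulr_rgt0// exprn_gt0// ltr0n expn_gt0 prime_gt0// resid_prime.
have Sb : Sch (fun x => f x0 * (qball (- N%:Z) (x - x0))%:R).
  by apply: (@Sch_comp _ _ _ _ (fun v => f x0 * v)); [rewrite mulr0|exact: Sch_ball].
apply: (@lt_le_trans _ _ (I (fun x => f x0 * (qball (- N%:Z) (x - x0))%:R))).
  by rewrite inv_funZ//; [rewrite inv_fun_ball// mulr_gt0|exact: Sch_ball].
apply: inv_fun_le => // x; case: (boolP (qball _ _)) => [h|_]; last by rewrite mulr0.
by rewrite mulr1 -[X in _ <= f X](subrK x0) addrC fc.
Qed.

Lemma haar_eq0 f : Sch f -> (forall x, 0 <= f x) -> I f <= 0 -> forall x, f x = 0.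
Proof.
move=> Sf f0 If x; apply/eqP; rewrite eq_le f0 andbT leNgt; apply/negP => fx.
by have := haar_gt0 Sf f0 fx; rewrite ltNge If.
Qed.

Lemma haar_ball (d : nat) : I (fun x => (qball d x)%:R) = (q ^ d)%:R ^+ k.
Proof.
by have := inv_fun_balls hI 0 d; rewrite add0r -/(@unit_cube R K k) I1 mulr1.
Qed.

(** By uniqueness of Haar measure no determinant has to be computed. *)
Lemma haar_rescale a c : c != 0 -> exists2 s : R, 0 < s &
  forall f, Sch f -> I (fun x => f (rescale a c x)) = s * I f.
Proof.
move=> c0; pose J f := I (fun x => f (rescale a c x)).
have hJ : invariant_functional J.
  split => [f g Sf Sg|b f Sf|f Sf f0|f t Sf].
  - by apply: (inv_funD hI); exact: Sch_rescale.
  - by apply: (inv_funZ hI); exact: Sch_rescale.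
  - by apply: (inv_fun_ge0 hI) => //; exact: Sch_rescale.
  - rewrite /J -[in RHS](inv_fun_shift hI (rescale (- (a / c)) c^-1 t) (Sch_rescale a c0 Sf)).
    by congr I; apply/funext => x; rewrite raddfD/= rescaleVK.
exists (J (@unit_cube R K k)); last first.
  by move=> f Sf; have := inv_fun_unique hI hJ Sf; rewrite I1 mul1r => ->.
apply: (@haar_gt0 _ 0); first exact/Sch_rescale/Sch_unit_cube.
  by move=> x; rewrite /unit_cube ler0n.
by rewrite /unit_cube raddf0 qball0 ltr01.
Qed.

Local Notation Re := complex.Re.
Local Notation Im := complex.Im.

(** The complex integral of G equals z times itself. *)
Lemma haar_phase (G : pt -> R[i]) (t : pt) (z : R[i]) : Sch G ->
  (forall x, G (x + t) = z * G x) -> z != 1 -> I (fun x => Re (G x)) = 0.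
Proof.
move=> SG Gt z1.
have SR : Sch (fun x => Re (G x)) by exact: (Sch_comp (F := @Re R)).
have SI : Sch (fun x => Im (G x)) by exact: (Sch_comp (F := @Im R)).
have SR' b : Sch (fun x => b * Re (G x)) by apply: (Sch_comp (F := fun v => b * v)) => //; rewrite mulr0.
have SI' b : Sch (fun x => b * Im (G x)) by apply: (Sch_comp (F := fun v => b * v)) => //; rewrite mulr0.
have eR : I (fun x => Re (G x)) = Re z * I (fun x => Re (G x)) - Im z * I (fun x => Im (G x)).
  rewrite -[in LHS](inv_fun_shift hI t SR) -mulNr -!inv_funZ// -inv_funD//.
  by congr I; apply/funext => x; rewrite Gt; case: (G x) => u v; case: (z) => a b /=; rewrite mulNr.
have eI : I (fun x => Im (G x)) = Re z * I (fun x => Im (G x)) + Im z * I (fun x => Re (G x)).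
  rewrite -[in LHS](inv_fun_shift hI t SI) -!inv_funZ// -inv_funD//.
  by congr I; apply/funext => x; rewrite Gt; case: (G x) => u v; case: (z) => a b /=.
pose c : R[i] := (I (fun x => Re (G x)) +i* I (fun x => Im (G x)))%C.
have : (z - 1) * c = 0.
  rewrite mulrBl mul1r; apply/eqP; rewrite subr_eq0; apply/eqP.
  rewrite /c; move: eR eI; case: (z) => a b /= eR eI.
  by apply/eqP; rewrite eq_complex /= -eR -eI !eqxx.
by move/eqP; rewrite mulf_eq0 subr_eq0 (negPf z1)/= => /eqP[].
Qed.

(** Minkowski's inequality with a weight u, in the form needed to bound a sum by
    its terms when all are measured against the b j: it is the power mean
    inequality, integrated. *)
Lemma haar_minkowski (J : finType) (u : pt -> R) (y : J -> pt -> R) (b : J -> R) (V : R) (n : nat) :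
  locconst u -> (forall x, 0 <= u x) -> (forall j, Sch (y j)) -> (forall j x, 0 <= y j x) ->
  (forall j, 0 <= b j) ->
  (forall j, I (fun x => u x * y j x ^+ n.+1) <= V * b j ^+ n.+1) ->
  I (fun x => u x * (\sum_j y j x) ^+ n.+1) <= V * (\sum_j b j) ^+ n.+1.
Proof.
move=> lu u0 Sy y0 b0 hy.
have Sp f : Sch f -> Sch (fun x => u x * f x ^+ n.+1).
  move=> Sf; apply: (@Sch_lc _ _ _ _ _ (fun v w => w * v ^+ n.+1) f u) => //.
  by move=> v; rewrite expr0n mulr0.
have S1 : Sch (fun x => u x * (\sum_j y j x) ^+ n.+1) by apply: Sp; exact: Sch_sum.
have S2 j : Sch (fun x => (b j ^+ n)^-1 * (u x * y j x ^+ n.+1)).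
  by apply: (Sch_comp (F := fun v => _ * v)); [rewrite mulr0|exact: Sp].
have S3 : Sch (fun x => (\sum_j b j) ^+ n * \sum_j (b j ^+ n)^-1 * (u x * y j x ^+ n.+1)).
  by apply: (Sch_comp (F := fun v => _ * v)); [rewrite mulr0|exact: Sch_sum].
have zero j x : b j = 0 -> u x * y j x ^+ n.+1 = 0.
  move=> bj; apply: (haar_eq0 (f := fun x => u x * y j x ^+ n.+1)); first exact: Sp.
    by move=> x'; rewrite mulr_ge0 ?exprn_ge0.
  by rewrite (le_trans (hy j))// bj expr0n mulr0.
apply: (@le_trans _ _ (I (fun x => (\sum_j b j) ^+ n * \sum_j (b j ^+ n)^-1 * (u x * y j x ^+ n.+1)))).
  apply: inv_fun_le => // x; have := u0 x; rewrite le_eqVlt => /predU1P[<-|ux].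
    rewrite mul0r mulr_ge0 ?exprn_ge0 ?sumr_ge0// => j _.
    by rewrite mul0r mulr0.
  have -> : \sum_j (b j ^+ n)^-1 * (u x * y j x ^+ n.+1) = u x * \sum_j y j x ^+ n.+1 / b j ^+ n.
    by rewrite mulr_sumr; apply: eq_bigr => j _; rewrite mulrC -mulrA.
  rewrite mulrCA ler_wpM2l ?u0//; apply: power_sum_le => //.
  move=> j /(zero j x)/eqP; rewrite mulf_eq0 gt_eqF//= expf_eq0/=.
  by move=> /eqP.
rewrite inv_funZ//; last exact: Sch_sum.
rewrite inv_fun_sum// exprSr mulrCA ler_wpM2l ?exprn_ge0 ?sumr_ge0// mulr_sumr.
apply: ler_sum => j _; rewrite inv_funZ//; last exact: Sp.
have := b0 j; rewrite le_eqVlt => /predU1P[bj|bj].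
  rewrite (_ : (fun _ => _) = fun=> 0); first by rewrite (inv_fun0 hI) mulr0 -bj mulr0.
  by apply/funext => x; rewrite zero.
rewrite ler_pdivrMl ?exprn_gt0//; apply: (le_trans (hy j)).
by rewrite exprSr mulrCA.
Qed.

End Haar.

(** * Decoupling inequalities and affine rescaling *)

Lemma powR_rootK (R : realType) (x : R) (n : nat) : (0 < n)%N -> 0 <= x ->
  (x `^ n%:R^-1) ^+ n = x.
Proof.
by move=> n0 x0; rewrite -powR_mulrn ?powR_ge0// -powRrM mulVf ?pnatr_eq0 -?lt0n// powRr1.
Qed.

Lemma root_exists (R : realType) (x : R) (n : nat) : 0 <= x -> (0 < n)%N ->
  exists2 y : R, 0 <= y & y ^+ n = x.
Proof.
by move=> x0 n0; exists (x `^ n%:R^-1); [exact: powR_ge0|exact: powR_rootK].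
Qed.

Lemma sum_residues (V : nmodType) (Q Q' : nat) (F : nat -> V) :
  \sum_(a < Q * Q') F a = \sum_(a0 < Q) \sum_(a' < Q') F (a0 + Q * a')%N.
Proof.
elim: Q' => [|Q' IH]; first by rewrite muln0 big_ord0 big1// => i _; rewrite big_ord0.
rewrite mulnSr big_split_ord /= IH.
under [in RHS]eq_bigr => a0 _ do rewrite big_ord_recr/=.
by rewrite big_split/=; congr (_ + _); apply: eq_bigr => i _; rewrite addnC.
Qed.

Lemma Re_le_normc (R : rcfType) (z : R[i]) : complex.Re z <= ComplexField.Normc.normc z.
Proof.
case: z => a b /=; apply: (le_trans (ler_norm a)).
by rewrite -sqrtr_sqr ler_wsqrtr// lerDl sqr_ge0.
Qed.

Lemma normc_ge0 (R : rcfType) (z : R[i]) : 0 <= ComplexField.Normc.normc z.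
Proof. by case: z => a b; exact: sqrtr_ge0. Qed.

Lemma normc_sum (R : rcfType) (I : Type) (s : seq I) (P : pred I) (F : I -> R[i]) :
  ComplexField.Normc.normc (\sum_(i <- s | P i) F i) <=
  \sum_(i <- s | P i) ComplexField.Normc.normc (F i).
Proof.
elim/big_ind2 : _ => // [|x1 x2 y1 y2 h1 h2]; first by rewrite ComplexField.Normc.normc0.
by apply: (le_trans (le_normcD _ _)); exact: lerD.
Qed.

Lemma normc_prod (R : rcfType) (I : Type) (s : seq I) (P : pred I) (F : I -> R[i]) :
  ComplexField.Normc.normc (\prod_(i <- s | P i) F i) =
  \prod_(i <- s | P i) ComplexField.Normc.normc (F i).
Proof.
apply: (big_morph (@ComplexField.Normc.normc R)); last exact: ComplexField.Normc.normc1.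
exact: ComplexField.Normc.normcM.
Qed.

Section Decoupling.
Variables (R : realType) (K : discreteField) (k : nat).
Local Notation pt := 'rV[K]_k.
Local Notation q := (resid K).
Local Notation w := (unif K).
Local Notation O := (@valring K).
Local Notation C := R[i].
Local Notation nc := ComplexField.Normc.normc.
Implicit Types (x y t : pt).

(** The properties of the character chi that are used: it is unitary and its kernel
    is exactly the ring of integers. *)
Record standard_char (chi : K -> C) : Prop := StandardChar {
  std_charD : forall x y : K, chi (x + y) = chi x * chi y;
  std_char_norm : forall x : K, nc (chi x) = 1;
  std_char_ker : forall x : K, (chi x == 1) = (x \in O) }.

Variables (chi : K -> C) (I : (pt -> R) -> R).
Hypotheses (hchi : standard_char chi) (hI : invariant_functional I)
  (I1 : I (@unit_cube R K k) = 1).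

Let q_gt0 : (0 < q)%N := prime_gt0 (resid_prime K).

(** Having Fourier support in theta_K, for K of centre a and length q^-n, expressed
    without the Fourier transform: translation by t in the dual lattice of
    theta_K - gamma(a) acts by the phase chi(gamma(a).t). *)
Definition equivariant (a n : nat) (f : pt -> C) : Prop :=
  forall x t, Tset a%:R n t -> f (x + t) = chi (ppoly t).[a%:R] * f x.

Definition wave (n a : nat) (f : pt -> C) : Prop := Sch f /\ equivariant a n f.

(** X is an upper bound for the 2r-th power of the decoupling constant at scale
    q^-n. The norms of the f a are replaced by upper bounds b a, so that no root
    has to be taken; the centres of the intervals are the integers below q^n. *)
Definition decouples (n r : nat) (X : R) : Prop :=
  forall (f : nat -> pt -> C) (b : nat -> R),
    (forall a, (a < q ^ n)%N -> wave n a (f a)) -> (forall a, 0 <= b a) ->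
    (forall a, (a < q ^ n)%N -> I (fun x => nc (f a x) ^+ (2 * r)) <= b a ^+ (2 * r)) ->
    I (fun x => nc (\sum_(a < q ^ n) f a x) ^+ (2 * r)) <=
      X * (\sum_(a < q ^ n) b a ^+ 2) ^+ r.

(** The restricted inequality in L^(2r+2k): of the 2r+2k powers, 2k are measured
    in the supremum norm and 2r in L^2r. The supremum norms are what the
    orthogonality argument produces. *)
Definition decouples_restricted (n r : nat) (X : R) : Prop :=
  forall (f : nat -> pt -> C) (h b : nat -> R),
    (forall a, (a < q ^ n)%N -> wave n a (f a)) ->
    (forall a, 0 <= h a) -> (forall a, 0 <= b a) ->
    (forall a, (a < q ^ n)%N -> forall x, nc (f a x) <= h a) ->
    (forall a, (a < q ^ n)%N -> I (fun x => nc (f a x) ^+ (2 * r)) <= b a ^+ (2 * r)) ->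
    I (fun x => nc (\sum_(a < q ^ n) f a x) ^+ (2 * r + 2 * k)) <=
      X * (\sum_(a < q ^ n) h a ^+ 2) ^+ k * (\sum_(a < q ^ n) b a ^+ 2) ^+ r.

Lemma std_char0 : chi 0 = 1.
Proof. by apply/eqP; rewrite (std_char_ker hchi) rpred0. Qed.

Lemma std_charN (x : K) : chi (- x) * chi x = 1.
Proof. by rewrite -(std_charD hchi) addNr std_char0. Qed.

Lemma std_char_conj (x : K) : (chi x)^*%C = chi (- x).
Proof.
have h : chi x * (chi x)^*%C = 1.
  rewrite -sqr_normc; have -> : `|chi x| = (nc (chi x))%:C%C by [].
  by rewrite (std_char_norm hchi) expr1n.
rewrite -[RHS]mulr1 -h mulrA std_charN mul1r //.
Qed.

Lemma Sch_nc_exp (f : pt -> C) (n : nat) : (0 < n)%N -> Sch f -> Sch (fun x => nc (f x) ^+ n).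
Proof.
move=> n0; apply: (Sch_comp (F := fun z : C => nc z ^+ n)).
by rewrite ComplexField.Normc.normc0 expr0n gtn_eqF.
Qed.

Lemma nat_valring (n : nat) : (n%:R : K) \in O.
Proof. exact: rpred_nat. Qed.

(** The substitution S alone would leave waves over a0 + w^m O twisted by the
    common phase chi(P(a0)), of modulus 1; g removes it. *)
Lemma decoupling_rescale (n m a0 : nat) (f : nat -> pt -> C) :
  (a0 < q ^ m)%N ->
  (forall a, (a < q ^ (m + n))%N -> wave (m + n) a (f a)) ->
  exists (g : nat -> pt -> C) (S : pt -> pt) (s : R),
  [/\ 0 < s, forall F, Sch F -> I (fun x => F (S x)) = s * I F,
      forall a, (a < q ^ n)%N -> wave n a (g a),
      forall a y, nc (g a y) = nc (f (a0 + q ^ m * a)%N (S y)) &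
      forall y, nc (\sum_(a < q ^ n) g a y) = nc (\sum_(a < q ^ n) f (a0 + q ^ m * a)%N (S y))].
Proof.
move=> a0m fw; have wm0 : w ^+ m != 0 by rewrite expf_neq0// unif_neq0.
have wm0' : (w ^+ m)^-1 != 0 by rewrite invr_eq0.
pose S : pt -> pt := rescale (- (a0%:R / w ^+ m)) (w ^+ m)^-1.
have [s s0 hs] := haar_rescale hI I1 (- (a0%:R / w ^+ m)) wm0'.
pose g a (y : pt) := chi (- (ppoly (S y)).[a0%:R]) * f (a0 + q ^ m * a)%N (S y).
exists g, S, s; split => //.
- move=> a aq; have aq' : (a0 + q ^ m * a < q ^ (m + n))%N.
    rewrite expnD; apply: (@leq_trans (q ^ m * a.+1)); first by rewrite mulnS ltn_add2r.
    by rewrite leq_mul2l aq orbT.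
  have [Sf ef] := fw _ aq'; split.
    have : Sch (fun y => f (a0 + q ^ m * a)%N (S y)) by exact: Sch_rescale.
    move=> /(@Sch_lc _ _ _ _ _ (fun v c => c * v)); apply; first by move=> v; rewrite mulr0.
    rewrite /S; apply: (@locconst_rescale _ _ _ (fun x => chi (- (ppoly x).[a0%:R]))).
    exists 0%N => x t xt; rewrite raddfD/= hornerD opprD (std_charD hchi).
    suff /eqP -> : chi (- (ppoly t).[a0%:R]) == 1 by rewrite mulr1.
    have := qball_polyOver (n := 0) xt; rewrite expr0 scale1r => tO.
    by rewrite (std_char_ker hchi) rpredN rpred_horner// nat_valring.
  move=> y u uT; have uE : u = rescale a0%:R (w ^+ m) (S u) by rewrite /S rescaleVK.
  have aE : (a0 + q ^ m * a)%N%:R = a0%:R + w ^+ m * a%:R :> K.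
    by rewrite natrD natrM natrX unifE.
  rewrite /g /S raddfD/= -/S ef; last first.
    rewrite aE; apply: (iffLR (Tset_rescale a0%:R a%:R m n (S u))).
    by rewrite -uE.
  have -> : (ppoly u).[a%:R] = (ppoly (S u)).[(a0 + q ^ m * a)%N%:R] - (ppoly (S u)).[a0%:R].
    by rewrite {1}uE horner_rescale// aE.
  rewrite raddfD/= hornerD opprD !(std_charD hchi) mulrACA [RHS]mulrACA.
  by congr (_ * _); exact: mulrC.
- by move=> a y; rewrite /g ComplexField.Normc.normcM (std_char_norm hchi) mul1r.
- move=> y; rewrite /g -mulr_sumr.
  by rewrite ComplexField.Normc.normcM (std_char_norm hchi) mul1r.
Qed.

Lemma lt_residue (n m a0 a : nat) : (a0 < q ^ m)%N -> (a < q ^ n)%N ->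
  (a0 + q ^ m * a < q ^ (m + n))%N.
Proof.
move=> a0m aq; rewrite expnD; apply: (@leq_trans (q ^ m * a.+1)).
  by rewrite mulnS ltn_add2r.
by rewrite leq_mul2l aq orbT.
Qed.

Lemma decouples_sub (n m r : nat) X a0 (f : nat -> pt -> C) (b : nat -> R) : (0 < r)%N ->
  decouples n r X -> (a0 < q ^ m)%N ->
  (forall a, (a < q ^ (m + n))%N -> wave (m + n) a (f a)) -> (forall a, 0 <= b a) ->
  (forall a, (a < q ^ (m + n))%N -> I (fun x => nc (f a x) ^+ (2 * r)) <= b a ^+ (2 * r)) ->
  I (fun x => nc (\sum_(a < q ^ n) f (a0 + q ^ m * a)%N x) ^+ (2 * r)) <=
    X * (\sum_(a < q ^ n) b (a0 + q ^ m * a)%N ^+ 2) ^+ r.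
Proof.
move=> r0 dX a0m fw b0 fb; have r20 : (0 < 2 * r)%N by rewrite muln_gt0.
have [g [S [s [s0 hS gw gE gsE]]]] := decoupling_rescale a0m fw.
have [tau tau0 tauE] := root_exists (ltW s0) r20.
have := dX g (fun a => tau * b (a0 + q ^ m * a)%N) gw _ _.
have Sf a : (a < q ^ n)%N -> Sch (f (a0 + q ^ m * a)%N).
  by move=> aq; case: (fw _ (lt_residue a0m aq)).
have Ssum : Sch (fun x => \sum_(a < q ^ n) f (a0 + q ^ m * a)%N x).
  by apply: Sch_sum => a _; exact: Sf.
rewrite (_ : (fun x => nc (\sum_(a < q ^ n) g a x) ^+ (2 * r)) = fun x =>
  nc (\sum_(a < q ^ n) f (a0 + q ^ m * a)%N (S x)) ^+ (2 * r)); last first.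
  by apply/funext => x; rewrite gsE.
rewrite (hS _ (Sch_nc_exp r20 Ssum)).
have -> : \sum_(a < q ^ n) (tau * b (a0 + q ^ m * a)%N) ^+ 2 =
    tau ^+ 2 * \sum_(a < q ^ n) b (a0 + q ^ m * a)%N ^+ 2.
  by rewrite mulr_sumr; apply: eq_bigr => a _; rewrite exprMn.
rewrite exprMn -exprM tauE [X * _]mulrCA ler_pM2l//; apply.
  by move=> a; rewrite mulr_ge0.
move=> a aq; rewrite exprMn tauE.
rewrite (_ : (fun _ => _) = fun x => nc (f (a0 + q ^ m * a)%N (S x)) ^+ (2 * r)); last first.
  by apply/funext => x; rewrite gE.
rewrite (hS _ (Sch_nc_exp r20 (Sf a aq))) ler_pM2l//.
exact: fb (lt_residue a0m aq).
Qed.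

Lemma decouples_restricted_sub (n m r : nat) X a0 (f : nat -> pt -> C) (h b : nat -> R) :
  (0 < r)%N -> decouples_restricted n r X -> (a0 < q ^ m)%N ->
  (forall a, (a < q ^ (m + n))%N -> wave (m + n) a (f a)) ->
  (forall a, 0 <= h a) -> (forall a, 0 <= b a) ->
  (forall a, (a < q ^ (m + n))%N -> forall x, nc (f a x) <= h a) ->
  (forall a, (a < q ^ (m + n))%N -> I (fun x => nc (f a x) ^+ (2 * r)) <= b a ^+ (2 * r)) ->
  I (fun x => nc (\sum_(a < q ^ n) f (a0 + q ^ m * a)%N x) ^+ (2 * r + 2 * k)) <=
    X * (\sum_(a < q ^ n) h (a0 + q ^ m * a)%N ^+ 2) ^+ k *
        (\sum_(a < q ^ n) b (a0 + q ^ m * a)%N ^+ 2) ^+ r.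
Proof.
move=> r0 dX a0m fw h0 b0 fh fb; have r20 : (0 < 2 * r)%N by rewrite muln_gt0.
have [g [S [s [s0 hS gw gE gsE]]]] := decoupling_rescale a0m fw.
have [tau tau0 tauE] := root_exists (ltW s0) r20.
have := dX g (fun a => h (a0 + q ^ m * a)%N) (fun a => tau * b (a0 + q ^ m * a)%N) gw _ _ _ _.
have Sf a : (a < q ^ n)%N -> Sch (f (a0 + q ^ m * a)%N).
  by move=> aq; case: (fw _ (lt_residue a0m aq)).
have Ssum : Sch (fun x => \sum_(a < q ^ n) f (a0 + q ^ m * a)%N x).
  by apply: Sch_sum => a _; exact: Sf.
have p0 : (0 < 2 * r + 2 * k)%N by rewrite addn_gt0 r20.
rewrite (_ : (fun x => nc (\sum_(a < q ^ n) g a x) ^+ (2 * r + 2 * k)) = fun x =>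
  nc (\sum_(a < q ^ n) f (a0 + q ^ m * a)%N (S x)) ^+ (2 * r + 2 * k)); last first.
  by apply/funext => x; rewrite gsE.
rewrite (hS _ (Sch_nc_exp p0 Ssum)).
have -> : \sum_(a < q ^ n) (tau * b (a0 + q ^ m * a)%N) ^+ 2 =
    tau ^+ 2 * \sum_(a < q ^ n) b (a0 + q ^ m * a)%N ^+ 2.
  by rewrite mulr_sumr; apply: eq_bigr => a _; rewrite exprMn.
rewrite exprMn -exprM tauE [X * _ * _]mulrCA ler_pM2l//; apply => //.
- by move=> a; rewrite mulr_ge0.
- by move=> a aq x; rewrite gE; exact: fh (lt_residue a0m aq) _.
move=> a aq; rewrite exprMn tauE.
rewrite (_ : (fun _ => _) = fun x => nc (f (a0 + q ^ m * a)%N (S x)) ^+ (2 * r)); last first.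
  by apply/funext => x; rewrite gE.
rewrite (hS _ (Sch_nc_exp r20 (Sf a aq))) ler_pM2l//.
exact: fb (lt_residue a0m aq).
Qed.

Lemma sum_minkowski (J : finType) (f : J -> pt -> C) (b : J -> R) (n : nat) :
  (forall j, Sch (f j)) -> (forall j, 0 <= b j) ->
  (forall j, I (fun x => nc (f j x) ^+ n.+1) <= b j ^+ n.+1) ->
  I (fun x => nc (\sum_j f j x) ^+ n.+1) <= (\sum_j b j) ^+ n.+1.
Proof.
move=> Sf b0 fb.
have Sn j : Sch (fun x => nc (f j x)).
  by apply: (Sch_comp (F := fun z : C => nc z)) => //; rewrite ComplexField.Normc.normc0.
have := @haar_minkowski R K k I hI I1 J (fun=> 1) (fun j x => nc (f j x)) b 1 n.
rewrite mul1r => /(_ (@locconst_cst _ _ _ _) (fun=> ler01) Sn (fun j x => normc_ge0 _) b0) h.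
apply: (@le_trans _ _ (I (fun x => 1 * (\sum_j nc (f j x)) ^+ n.+1))); last first.
  apply: h => j; rewrite mul1r (_ : (fun _ => _) = fun x => nc (f j x) ^+ n.+1)//.
  by apply/funext => x; rewrite mul1r.
apply: (inv_fun_le hI).
- by apply: Sch_nc_exp => //; exact: Sch_sum.
- apply: (Sch_comp (F := fun v : R => 1 * v ^+ n.+1)); first by rewrite expr0n mulr0.
  exact: Sch_sum.
by move=> x; rewrite mul1r lerXn2r ?nnegrE ?normc_ge0 ?sumr_ge0 ?normc_sum// => j _; exact: normc_ge0.
Qed.

(** The triangle inequality and Cauchy-Schwarz; it starts the induction on n. *)
Lemma decouples_restricted_trivial (n r : nat) : (0 < r)%N ->
  decouples_restricted n r ((q ^ n)%:R ^+ (k + r)).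
Proof.
case: r => // r _ f h b fw h0 b0 fh fb.
have Sf (a : 'I_(q ^ n)) : Sch (f a) by case: (fw a (ltn_ord a)).
have Ssum : Sch (fun x => \sum_(a < q ^ n) f a x) by exact: Sch_sum.
set H := \sum_(a < q ^ n) h a ^+ 2; set B := \sum_(a < q ^ n) b a ^+ 2.
pose h1 := \sum_(a < q ^ n) h a.
have hle : h1 ^+ (2 * k) <= (q ^ n)%:R ^+ k * H ^+ k.
  rewrite exprM -exprMn lerXn2r ?nnegrE ?exprn_ge0 ?mulr_ge0 ?sumr_ge0//.
    by move=> a _; rewrite exprn_ge0.
  by have := @sqr_sum_le R _ (fun a : 'I_(q ^ n) => h a); rewrite card_ord; apply.
have ble : (\sum_(a < q ^ n) b a) ^+ (2 * r.+1) <= (q ^ n)%:R ^+ r.+1 * B ^+ r.+1.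
  rewrite exprM -exprMn lerXn2r ?nnegrE ?exprn_ge0 ?mulr_ge0 ?sumr_ge0//.
    by move=> a _; rewrite exprn_ge0.
  by have := @sqr_sum_le R _ (fun a : 'I_(q ^ n) => b a); rewrite card_ord; apply.
have mink : I (fun x => nc (\sum_(a < q ^ n) f a x) ^+ (2 * r.+1)) <= (\sum_(a < q ^ n) b a) ^+ (2 * r.+1).
  have e : (2 * r.+1 = (2 * r + 1).+1)%N by lia.
  rewrite e; apply: sum_minkowski => // a; rewrite -e; exact: fb.
apply: (@le_trans _ _ (h1 ^+ (2 * k) * I (fun x => nc (\sum_(a < q ^ n) f a x) ^+ (2 * r.+1)))).
  have S2 : Sch (fun x => nc (\sum_(a < q ^ n) f a x) ^+ (2 * r.+1)) by exact: Sch_nc_exp.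
  rewrite -(inv_funZ hI)//; apply: (inv_fun_le hI).
  - by apply: Sch_nc_exp.
  - by apply: (Sch_comp (F := fun v : R => _ * v)) => //; rewrite mulr0.
  move=> x; rewrite exprD mulrC ler_wpM2r ?exprn_ge0 ?normc_ge0//.
  rewrite lerXn2r ?nnegrE ?normc_ge0 ?sumr_ge0//.
  by apply: (le_trans (normc_sum _ _ _)); apply: ler_sum => a _; exact: fh.
apply: (@le_trans _ _ (((q ^ n)%:R ^+ k * H ^+ k) * ((q ^ n)%:R ^+ r.+1 * B ^+ r.+1))).
  apply: ler_pM => //; rewrite ?exprn_ge0 ?sumr_ge0//.
    apply: (inv_fun_ge0 hI); first exact: Sch_nc_exp.
    by move=> x; rewrite exprn_ge0 ?normc_ge0.
  exact: (le_trans mink).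
by rewrite mulrACA -exprD mulrA.
Qed.

Lemma TsetD a n s t : Tset a n s -> Tset a n t -> Tset a n (s + t : pt).
Proof. by move=> hs ht i; rewrite raddfD/= comp_polyD coefD rpredD. Qed.

Lemma TsetN a n t : Tset a n t -> Tset a n (- t : pt).
Proof. by move=> ht i; rewrite raddfN/= -scaleN1r comp_polyZ coefZ mulN1r rpredN. Qed.

(** Test with one wave, the indicator function of the dual lattice T_(0,n): its
    phases are chi(P_t(0)) = 1. *)
Lemma decouples_ge1 n r X : (0 < r)%N -> decouples n r X -> 1 <= X.
Proof.
move=> r0 dX; have r20 : (0 < 2 * r)%N by rewrite muln_gt0.
pose T0 (x : pt) : bool := `[< Tset 0 n x >].
have T0D x t : Tset 0 n t -> T0 (x + t) = T0 x.
  move=> ht; apply/asboolP/asboolP => h; last exact: TsetD.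
  by rewrite -[x](addrK t); apply: TsetD => //; exact: TsetN.
pose g (x : pt) : C := (T0 x)%:R.
have gw : wave n 0 g.
  split; last first.
    move=> x t ht; rewrite /g T0D//.
    have : (ppoly t).[0] = 0 by rewrite horner_coef0 coef0_ppoly.
    by rewrite -[0%:R]/(0 : K) => ->; rewrite std_char0 mul1r.
  split; first exists 0%N => x t xt.
    by rewrite /g T0D//; apply: Tset_qball; [exact: rpred0|exact: (qball_mono _ xt)].
  exists (n * k)%N => x; rewrite /g /T0; case: asboolP => [h _|]; last by rewrite eqxx.
  by apply: (qball_Tset _ h); exact: rpred0.
pose f (a : nat) : pt -> C := if a == 0%N then g else fun=> 0.
have ncg x : nc (g x) ^+ (2 * r) = (T0 x)%:R.
  rewrite /g; case: (T0 x).
    by rewrite ComplexField.Normc.normc1 expr1n.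
  by rewrite ComplexField.Normc.normc0 expr0n gtn_eqF.
set V := I (fun x => (T0 x)%:R).
have VE : I (fun x => nc (g x) ^+ (2 * r)) = V by congr I; apply/funext => x.
have V0 : 0 < V.
  rewrite -VE; apply: (haar_gt0 hI I1 (x0 := 0)).
  - by apply: Sch_nc_exp => //; case: gw.
  - by move=> x; rewrite exprn_ge0 ?normc_ge0.
  - rewrite ncg /T0 asboolT ?ltr01// => i.
    have -> : ppoly (0 : pt) = 0 by exact: raddf0.
    by rewrite comp_poly0 coef0 rpred0.
have [v v0 vE] := root_exists (ltW V0) r20.
pose b (a : nat) : R := if a == 0%N then v else 0.
have qn0 : (0 < q ^ n)%N by rewrite expn_gt0 q_gt0.
have hf a : (a < q ^ n)%N -> wave n a (f a).
  by case: a => [|a] _; [exact: gw|split; [exact: Sch0|move=> x t _; rewrite /f/= mulr0]].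
have hb a : 0 <= b a by rewrite /b; case: eqP.
have hfb a : (a < q ^ n)%N -> I (fun x => nc (f a x) ^+ (2 * r)) <= b a ^+ (2 * r).
  case: a => [|a] _; first by rewrite /f /b/= VE vE.
  rewrite (_ : (fun _ => _) = fun=> 0).
    by rewrite (inv_fun0 hI) /b/= expr0n gtn_eqF.
  apply/funext => x; rewrite -[f a.+1 x]/(0 : C).
  by rewrite ComplexField.Normc.normc0 expr0n gtn_eqF.
have := dX f b hf hb hfb.
rewrite (_ : (fun _ => _) = fun x => nc (g x) ^+ (2 * r)); last first.
  apply/funext => x; congr (nc _ ^+ _); rewrite (bigD1 (Ordinal qn0))//= big1 ?addr0// => i i0.
  by rewrite /f; case: eqP => // i0'; case/eqP: i0; exact: val_inj.
rewrite VE (bigD1 (Ordinal qn0))//= big1 ?addr0 => [|i i0]; last first.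
  by rewrite /b; case: eqP => [i0'|]; [case/eqP: i0; exact: val_inj|rewrite expr0n].
by rewrite /b/= -exprM vE -{1}[V]mul1r ler_pM2r.
Qed.

End Decoupling.

(** * Orthogonality of transversal products *)

Section RestrictedRecursion.
Variables (R : realType) (K : discreteField) (k : nat).
Local Notation pt := 'rV[K]_k.
Local Notation q := (resid K).
Local Notation w := (unif K).
Local Notation O := (@valring K).
Local Notation C := R[i].
Local Notation nc := ComplexField.Normc.normc.
Local Notation Re := complex.Re.
Implicit Types (x y t : pt).

Variables (chi : K -> C) (I : (pt -> R) -> R).
Hypotheses (hchi : standard_char chi) (hI : invariant_functional I)
  (I1 : I (@unit_cube R K k) = 1).
Hypotheses (k_gt0 : (0 < k)%N) (kq : (k < q)%N).

Let q_gt0 : (0 < q)%N := prime_gt0 (resid_prime K).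
Local Notation wave := (wave chi).

Lemma sum_residue_class (V : nmodType) (Q Q' a0 : nat) (F : nat -> V) : (a0 < Q)%N ->
  \sum_(a < Q * Q' | (a %% Q == a0)%N) F a = \sum_(a < Q') F (a0 + Q * a)%N.
Proof.
move=> a0Q; rewrite big_mkcond/= (sum_residues Q Q' (fun a => if (a %% Q == a0)%N then F a else 0)).
rewrite (bigD1 (Ordinal a0Q))//= [X in _ + X]big1 ?addr0 => [|c ca0].
  by apply: eq_bigr => a _; rewrite addnC mulnC modnMDl modn_small// eqxx addnC.
rewrite big1// => a _; rewrite addnC mulnC modnMDl modn_small//.
by case: eqP => // ca; case/eqP: ca0; exact: val_inj.
Qed.

(** On translations by t in T_(a0,m) the phases chi(P_t(a)) of all the waves over
    the interval a0 + q^m Z_q coincide, so the modulus of their sum is invariant.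
    The bound on t makes it an admissible translation for each single wave. *)
Lemma equivariant_sum (m n a0 : nat) (f : nat -> pt -> C) x t : (a0 < q ^ m)%N ->
  (forall a, (a < q ^ (m + n))%N -> wave (m + n) a (f a)) ->
  Tset a0%:R m t -> qball (m + n)%N t ->
  \sum_(a < q ^ n) f (a0 + q ^ m * a)%N (x + t) =
  chi (ppoly t).[a0%:R] * \sum_(a < q ^ n) f (a0 + q ^ m * a)%N x.
Proof.
move=> a0m fw tT tb; rewrite mulr_sumr; apply: eq_bigr => a _.
have [_ ->] := fw _ (lt_residue a0m (ltn_ord a)); last by apply: Tset_qball => //; exact: rpred_nat.
congr (_ * _).
have aE : (a0 + q ^ m * a)%N%:R = a0%:R + w ^+ m * a%:R :> K.
  by rewrite natrD natrM natrX unifE.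
have /eqP : chi ((ppoly t).[a0%:R + w ^+ m * a%:R] - (ppoly t).[a0%:R]) == 1.
  by rewrite (std_char_ker hchi) Tset_horner// rpred_nat.
by rewrite aE => h; rewrite -[in LHS](subrK (ppoly t).[a0%:R] (ppoly t).[_]) (std_charD hchi) h mul1r.
Qed.

Section Interaction.
Variables (m n a0 : nat).

Definition power_dist (phi psi : {ffun 'I_k -> 'I_(q ^ n)}) (j : 'I_k) : int :=
  \sum_i ((phi i)%:Z - a0%:Z) ^+ j.+1 - \sum_i ((psi i)%:Z - a0%:Z) ^+ j.+1.

(** The pairs of k-tuples whose products F_phi and F_psi need not be orthogonal
    with respect to weights invariant under the part of T_(a0,m) in the ball of
    radius q^n. *)
Definition interacting (phi psi : {ffun 'I_k -> 'I_(q ^ n)}) : bool :=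
  [forall j : 'I_k, ((q ^ minn (m * j.+1) n)%N %| power_dist phi psi j)%Z].

Lemma interacting_sym phi psi : interacting phi psi = interacting psi phi.
Proof.
by apply: eq_forallb => j; rewrite -[power_dist phi psi j]opprB rpredN.
Qed.

(** If the j-th congruence fails, take for t the coefficient vector of
    w^-e (X - a0)^j, with e = min(mj, n): then chi is evaluated at w^-e times the
    difference of the j-th power sums, which is not an integer. *)
Lemma separating_translation phi psi : ~~ interacting phi psi ->
  exists t, [/\ Tset a0%:R m t, qball n t &
    chi (\sum_i (ppoly t).[(phi i)%:R] - \sum_i (ppoly t).[(psi i)%:R]) != 1].
Proof.
rewrite negb_forall => /existsP[j hj].
set e := minn (m * j.+1) n in hj.
have we0 : w ^+ e != 0 by rewrite expf_neq0// unif_neq0.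
pose Q : {poly K} := (w ^+ e)^-1 *: ('X - a0%:R%:P) ^+ j.+1.
have sQ : (size Q <= k.+1)%N.
  by rewrite (leq_trans (size_scale_leq _ _))// size_exp_XsubC ltnS ltn_ord.
pose t : pt := row_of k Q.
have tE : ppoly t = Q - (Q`_0)%:P by rewrite /t ppoly_row_of.
have wO (l l' : nat) : (l <= l')%N -> w ^+ l' * (w ^+ l)^-1 \in O.
  move=> ll'; rewrite -(subnK ll') exprD mulfK ?expf_neq0 ?unif_neq0//.
  exact: uniformizerX_integral.
have evalQ (b : K) : Q.[b] = (w ^+ e)^-1 * (b - a0%:R) ^+ j.+1 by rewrite !hornerE.
exists t; split.
- move=> i; rewrite tE comp_polyB comp_polyC coefB coefC subr0 /Q comp_polyZ coefZ.
  have -> : (('X - a0%:R%:P : {poly K}) ^+ j.+1) \Po (a0%:R%:P + w ^+ m *: 'X) =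
      w ^+ (m * j.+1) *: 'X^(j.+1).
    by rewrite rmorphXn/= comp_polyB comp_polyX comp_polyC addrAC subrr add0r exprZn exprM.
  rewrite coefZ mulrA coefXn; case: eqP => _; last by rewrite mulr0 rpred0.
  by rewrite mulr1 mulrC wO// geq_minl.
- apply/qballP => i; rewrite mxE -exprnP coefZ mulrA rpredM ?wO ?geq_minr//.
  suff /polyOverP : ('X - a0%:R%:P : {poly K}) ^+ j.+1 \is a polyOver O by apply.
  by rewrite rpredX// polyOverXsubC rpred_nat.
have -> : \sum_i (ppoly t).[(phi i)%:R] - \sum_i (ppoly t).[(psi i)%:R] =
    (power_dist phi psi j)%:~R / w ^+ e.
  rewrite -sumrB rmorphB/= !rmorph_sum/= -sumrB mulr_suml; apply: eq_bigr => i _.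
  rewrite tE !hornerD !hornerN !hornerC opprB addrA subrK !evalQ.
  by rewrite -mulrBr mulrC !rmorphXn/= !rmorphB.
by rewrite (std_char_ker hchi) valring_intV.
Qed.

Variables (f : nat -> pt -> C) (u : pt -> R).
Hypotheses (fw : forall a, (a < q ^ n)%N -> wave n a (f a)).
Hypotheses (Su : Sch u) (u_ge0 : forall x, 0 <= u x)
  (ut : forall x t, Tset a0%:R m t -> qball n t -> u (x + t) = u x).

Let F (phi : {ffun 'I_k -> 'I_(q ^ n)}) x : C := \prod_i f (phi i) x.

Let SF phi : Sch (F phi).
Proof.
apply: (Sch_prod (Ordinal k_gt0)) => i; by case: (fw (ltn_ord (phi i))).
Qed.

Let SG phi psi : Sch (fun x => F phi x * (F psi x)^*%C * (u x)%:C%C).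
Proof.
apply: (@Sch_comp2 _ _ _ _ _ (fun (a : C) (b : R) => a * b%:C%C)) => //; first by rewrite mul0r.
apply: (@Sch_comp2 _ _ _ _ _ (fun (a b : C) => a * b^*%C)) => //; by rewrite mul0r.
Qed.

Lemma non_interacting_orthogonal phi psi : ~~ interacting phi psi ->
  I (fun x => Re (F phi x * (F psi x)^*%C * (u x)%:C%C)) = 0.
Proof.
move=> /separating_translation[t [tT tb tchi]].
apply: (haar_phase hI (t := t) (SG phi psi) _ tchi) => x.
have Ft phi' : F phi' (x + t) = chi (\sum_i (ppoly t).[(phi' i)%:R]) * F phi' x.
  rewrite /F (big_morph chi (std_charD hchi) (std_char0 hchi)) -big_split/=.
  apply: eq_bigr => i _; have [_ ->] // := fw (ltn_ord (phi' i)).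
  by apply: Tset_qball => //; exact: rpred_nat.
rewrite !Ft ut// rmorphM/= std_char_conj// (std_charD hchi).
by rewrite [X in X * _ = _]mulrACA -!mulrA.
Qed.

Variables (h : nat -> R) (m0 : nat) (c : 'I_k -> nat).
Hypotheses (h_ge0 : forall a, 0 <= h a)
  (fh : forall a, (a < q ^ n)%N -> forall x, nc (f a x) <= h a)
  (m0_gt0 : (0 < m0)%N) (c_lt : forall i, (c i < q ^ m0)%N)
  (c_inj : injective c).

Definition interaction_bound : nat :=
  (\prod_(j < k) q ^ (n - minn (m * j.+1) n)) * (q ^ (m0.-1 * k.-1)) ^ k.

Let A : pred {ffun 'I_k -> 'I_(q ^ n)} :=
  family (fun i => [pred a : 'I_(q ^ n) | (a %% q ^ m0 == c i)%N]).

Let H (phi : {ffun 'I_k -> 'I_(q ^ n)}) : R := \prod_i h (phi i).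

Lemma count_interacting phi :
  (#|[pred psi | (psi \in A) && interacting phi psi]| <= interaction_bound)%N.
Proof.
apply: leq_trans (@count_power_sums q n m0 k (resid_prime K) kq m0_gt0 a0%:Z
  (fun j => minn (m * j.+1) n) c
  (fun j => \sum_i ((phi i)%:Z - a0%:Z) ^+ j.+1) _ _).
- apply: subset_leq_card; apply/fintype.subsetP => psi; rewrite !inE => /andP[psiA].
  rewrite interacting_sym => /forallP hp; apply/andP; split.
    apply/forallP => i; move/familyP: psiA => /(_ i); rewrite inE => /eqP ->.
    by rewrite modn_small.
  by apply/forallP => j; have := hp j.
- by move=> j; exact: geq_minr.
- by move=> i l; rewrite !modn_small// => /c_inj.
Qed.

(** Expand the product of squares over pairs of tuples (phi, psi) with phi_i, psi_i
    in the class c_i modulo q^m0. Non-interacting pairs contribute nothing; for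
    the others |F_phi F_psi| <= (H_phi^2 + H_psi^2) / 2, and each tuple interacts
    with a bounded number of tuples, as in Schur's test. *)
Lemma transversal_orthogonality :
  I (fun x => (\prod_i nc (\sum_(a < q ^ n | (a %% q ^ m0 == c i)%N) f a x) ^+ 2) * u x) <=
  interaction_bound%:R * (\prod_i \sum_(a < q ^ n | (a %% q ^ m0 == c i)%N) h a ^+ 2) * I u.
Proof.
have expand x : (\prod_i nc (\sum_(a < q ^ n | (a %% q ^ m0 == c i)%N) f a x) ^+ 2) * u x =
    \sum_(phi in A) \sum_(psi in A) Re (F phi x * (F psi x)^*%C * (u x)%:C%C).
  have -> : \prod_i nc (\sum_(a < q ^ n | (a %% q ^ m0 == c i)%N) f a x) ^+ 2 =
      nc (\sum_(phi in A) F phi x) ^+ 2.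
    rewrite prodrXl -normc_prod; congr (nc _ ^+ 2).
    exact: (bigA_distr_big_dep (fun i => [pred a : 'I_(q ^ n) | (a %% q ^ m0 == c i)%N])
      (fun i (a : 'I_(q ^ n)) => f a x)).
  set S := \sum_(phi in A) F phi x.
  have -> : nc S ^+ 2 * u x = Re (S * S^*%C * (u x)%:C%C).
    rewrite -sqr_normc; have -> : `|S| = (nc S)%:C%C by [].
    by rewrite -rmorphXn -rmorphM.
  rewrite rmorph_sum/= mulr_suml mulr_suml raddf_sum/=; apply: eq_bigr => phi _.
  by rewrite mulr_sumr mulr_suml raddf_sum.
have SRe phi psi : Sch (fun x => Re (F phi x * (F psi x)^*%C * (u x)%:C%C)).
  exact: (Sch_comp (F := fun z : C => Re z)).
have Iu0 : 0 <= I u by exact: (inv_fun_ge0 hI).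
have H0 phi : 0 <= H phi by apply: prodr_ge0 => i _.
have FH phi x : nc (F phi x) <= H phi.
  rewrite /F normc_prod; apply: ler_prod => i _.
  by rewrite normc_ge0 fh.
have term phi psi : I (fun x => Re (F phi x * (F psi x)^*%C * (u x)%:C%C)) <=
    (interacting phi psi)%:R * ((H phi ^+ 2 + H psi ^+ 2) / 2 * I u).
  case: (boolP (interacting phi psi)) => [_|/non_interacting_orthogonal ->]; last first.
    by rewrite mul0r.
  rewrite mul1r -(inv_funZ hI)//; apply: (inv_fun_le hI) => //.
    by apply: (Sch_comp (F := fun v : R => _ * v)) => //; rewrite mulr0.
  move=> x; apply: (le_trans (Re_le_normc _)).
  rewrite !ComplexField.Normc.normcM.
  have -> : nc (u x)%:C%C = u x by rewrite /= expr0n addr0 sqrtr_sqr ger0_norm.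
  rewrite ler_wpM2r//; have -> : nc (F psi x)^*%C = nc (F psi x).
    by case: (F psi x) => a b /=; rewrite sqrrN.
  apply: (@le_trans _ _ (H phi * H psi)); first by rewrite ler_pM ?normc_ge0.
  rewrite ler_pdivlMr// -subr_ge0.
  have -> : H phi ^+ 2 + H psi ^+ 2 - H phi * H psi * 2 = (H phi - H psi) ^+ 2 by ring.
  exact: sqr_ge0.
rewrite (_ : (fun _ => _) = fun x => \sum_(phi in A) \sum_(psi in A)
    Re (F phi x * (F psi x)^*%C * (u x)%:C%C)); last by apply/funext.
rewrite (inv_fun_sum hI); last by move=> phi _; exact: Sch_sum.
rewrite (eq_bigr _ (fun phi _ => inv_fun_sum hI (P := mem A) _ (fun psi _ => SRe phi psi))).
apply: (@le_trans _ _ (\sum_(phi in A) \sum_(psi in A)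
    (interacting phi psi)%:R * ((H phi ^+ 2 + H psi ^+ 2) / 2 * I u))).
  by apply: ler_sum => phi _; apply: ler_sum => psi _; exact: term.
have half (g : {ffun 'I_k -> 'I_(q ^ n)} -> R) : (forall phi, 0 <= g phi) ->
    \sum_(phi in A) \sum_(psi in A) (interacting phi psi)%:R * g phi <=
    interaction_bound%:R * \sum_(phi in A) g phi.
  move=> g0; rewrite mulr_sumr; apply: ler_sum => phi _.
  rewrite -mulr_suml ler_wpM2r// -natr_sum ler_nat.
  apply: leq_trans (count_interacting phi).
  by rewrite -sum1_card big_mkcondr/= leq_sum// => psi _; case: interacting.
pose g phi := H phi ^+ 2 / 2 * I u.
have g0 phi : 0 <= g phi by rewrite /g mulr_ge0// divr_ge0// exprn_ge0.
apply: (@le_trans _ _ (\sum_(phi in A) \sum_(psi in A) (interacting phi psi)%:R * g phi +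
    \sum_(phi in A) \sum_(psi in A) (interacting phi psi)%:R * g psi)).
  rewrite -big_split/= ler_sum// => phi _; rewrite -big_split/= ler_sum// => psi _.
  by rewrite -mulrDr /g !mulrDl.
rewrite [X in _ + X]exchange_big/=.
under [X in _ + X]eq_bigr => phi _ do under eq_bigr => psi _ do rewrite interacting_sym.
apply: (le_trans (lerD (half g g0) (half g g0))).
rewrite -mulrDr -mulrA ler_wpM2l// -big_split/=.
under eq_bigr => phi _ do rewrite /g -mulrDl -splitr.
rewrite -mulr_suml ler_wpM2r//.
have -> : \prod_i \sum_(a < q ^ n | (a %% q ^ m0 == c i)%N) h a ^+ 2 =
    \sum_(phi in A) \prod_i h (phi i) ^+ 2.
  exact: (bigA_distr_big_dep (fun i => [pred a : 'I_(q ^ n) | (a %% q ^ m0 == c i)%N])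
    (fun i (a : 'I_(q ^ n)) => h a ^+ 2)).
by apply: ler_sum => phi _; rewrite /H prodrXl.
Qed.

End Interaction.
End RestrictedRecursion.

(** * The inductive step for the restricted inequality *)

Section RestrictedStep.
Variables (R : realType) (K : discreteField) (k : nat).
Local Notation pt := 'rV[K]_k.
Local Notation q := (resid K).
Local Notation C := R[i].
Local Notation nc := ComplexField.Normc.normc.
Implicit Types (x y t : pt).

Variables (chi : K -> C) (I : (pt -> R) -> R).
Hypotheses (hchi : standard_char chi) (hI : invariant_functional I)
  (I1 : I (@unit_cube R K k) = 1).
Hypotheses (k_gt0 : (0 < k)%N) (kq : (k < q)%N).

Let q_gt0 : (0 < q)%N := prime_gt0 (resid_prime K).
Local Notation wave := (wave chi).
Local Notation decouples := (decouples chi I).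
Local Notation decouples_restricted := (decouples_restricted chi I).

Lemma sum_residues_exp (V : nmodType) (m n : nat) (F : nat -> V) :
  \sum_(a < q ^ (m + n)) F a = \sum_(a0 < q ^ m) \sum_(a < q ^ n) F (a0 + q ^ m * a)%N.
Proof. by rewrite expnD sum_residues. Qed.

Lemma sum_residue_class_exp (V : nmodType) (m n a0 : nat) (F : nat -> V) : (a0 < q ^ m)%N ->
  \sum_(a < q ^ (m + n) | (a %% q ^ m == a0)%N) F a =
  \sum_(a < q ^ n) F (a0 + q ^ m * a)%N.
Proof. by move=> a0m; rewrite expnD sum_residue_class. Qed.

(** The broad part for one choice c of classes: |S|^2r is split over intervals J of
    length q^-m by Minkowski's inequality with the product of squares as a weight.
    Orthogonality, applied with |f_J|^2r in place of u, removes that weight, and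
    the integral of |f_J|^2r is bounded by decoupling at relative scale q^-n. The
    factor (q^m)^r is the Cauchy-Schwarz loss in the sum over J. *)
Lemma transversal_estimate (m n r m0 : nat) (X : R) (f : nat -> pt -> C) (h b : nat -> R)
    (c : 'I_k -> nat) : (0 < r)%N -> 0 <= X -> (0 < m0)%N ->
  decouples n r X ->
  (forall a, (a < q ^ (m + n))%N -> wave (m + n) a (f a)) ->
  (forall a, 0 <= h a) -> (forall a, 0 <= b a) ->
  (forall a, (a < q ^ (m + n))%N -> forall x, nc (f a x) <= h a) ->
  (forall a, (a < q ^ (m + n))%N -> I (fun x => nc (f a x) ^+ (2 * r)) <= b a ^+ (2 * r)) ->
  (forall i, (c i < q ^ m0)%N) -> injective c ->
  I (fun x => (\prod_i nc (\sum_(a < q ^ (m + n) | (a %% q ^ m0 == c i)%N) f a x) ^+ 2) *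
       nc (\sum_(a < q ^ (m + n)) f a x) ^+ (2 * r)) <=
  (interaction_bound K k m (m + n) m0)%:R *
  (\prod_i \sum_(a < q ^ (m + n) | (a %% q ^ m0 == c i)%N) h a ^+ 2) * X *
  (q ^ m)%:R ^+ r * (\sum_(a < q ^ (m + n)) b a ^+ 2) ^+ r.
Proof.
move=> r0 X0 m00 dX fw h0 b0 fh fb clt cinj.
have r20 : (0 < 2 * r)%N by rewrite muln_gt0.
set M := (interaction_bound _ _ _ _ _)%:R; set H := \prod_i \sum_(a < _ | _) _.
have H0 : 0 <= H by apply: prodr_ge0 => i _; apply: sumr_ge0 => a _; rewrite exprn_ge0.
have Sf (a : 'I_(q ^ (m + n))) : Sch (f a) by case: (fw a (ltn_ord a)).
pose fJ (J : nat) x := \sum_(a < q ^ n) f (J + q ^ m * a)%N x.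
have SJ (J : 'I_(q ^ m)) : Sch (fJ J).
  by apply: Sch_sum => a _; case: (fw _ (lt_residue (ltn_ord J) (ltn_ord a))).
pose beta (J : 'I_(q ^ m)) := Num.sqrt (\sum_(a < q ^ n) b (J + q ^ m * a)%N ^+ 2).
have beta2 J : beta J ^+ 2 = \sum_(a < q ^ n) b (J + q ^ m * a)%N ^+ 2.
  by rewrite sqr_sqrtr// sumr_ge0// => a _; rewrite exprn_ge0.
pose u x := \prod_i nc (\sum_(a < q ^ (m + n) | (a %% q ^ m0 == c i)%N) f a x) ^+ 2.
have lu : locconst u.
  apply: locconst_big => i _; apply: (@locconst_comp _ _ _ _ (fun z : C => nc z ^+ 2)).
  by apply: locconst_big => a _; case: (Sf a).
have u0 x : 0 <= u x by apply: prodr_ge0 => i _; rewrite exprn_ge0 ?normc_ge0.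
have SnJ (J : 'I_(q ^ m)) : Sch (fun x => nc (fJ J x)).
  by apply: (Sch_comp (F := fun z : C => nc z)) => //; rewrite ComplexField.Normc.normc0.
have eN : (2 * r = (2 * r).-1.+1)%N by rewrite prednK.
have each (J : 'I_(q ^ m)) : I (fun x => u x * nc (fJ J x) ^+ (2 * r).-1.+1) <=
    (M * H * X) * beta J ^+ (2 * r).-1.+1.
  rewrite -eN; apply: (@le_trans _ _ (M * H * I (fun x => nc (fJ J x) ^+ (2 * r)))).
    apply: (@transversal_orthogonality R K k chi I hchi hI k_gt0 kq m (m + n) J f
      (fun x => nc (fJ J x) ^+ (2 * r)) fw) => //.
    - exact: Sch_nc_exp.
    - by move=> x; rewrite exprn_ge0 ?normc_ge0.
    - move=> x t tT tb; rewrite /fJ (equivariant_sum hchi _ (ltn_ord J) fw tT tb).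
      by rewrite ComplexField.Normc.normcM (std_char_norm hchi) mul1r.
  rewrite -[leRHS]mulrA ler_wpM2l ?mulr_ge0 ?ler0n//.
  rewrite exprM beta2.
  exact: (decouples_sub hchi hI I1 r0 dX (ltn_ord J) fw b0 fb).
have := haar_minkowski hI I1 lu u0 SnJ (fun J x => normc_ge0 _) (fun J => sqrtr_ge0 _) each.
rewrite -eN => mink.
apply: (@le_trans _ _ (I (fun x => u x * (\sum_(J < q ^ m) nc (fJ J x)) ^+ (2 * r)))).
  have Su (g : pt -> R) : Sch g -> Sch (fun x => u x * g x ^+ (2 * r)).
    move=> Sg; apply: (@Sch_lc _ _ _ _ _ (fun v w => w * v ^+ (2 * r)) g u) => //.
    by move=> v; rewrite expr0n gtn_eqF// mulr0.
  apply: (inv_fun_le hI).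
  - apply: (Su (fun x => nc (\sum_(a < q ^ (m + n)) f a x))).
    apply: (Sch_comp (F := fun z : C => nc z)); first exact: ComplexField.Normc.normc0.
    exact: Sch_sum.
  - by apply: Su; exact: Sch_sum.
  move=> x; apply: ler_wpM2l; first exact: u0.
  rewrite lerXn2r ?nnegrE ?normc_ge0 ?sumr_ge0//.
    by move=> J _; exact: normc_ge0.
  by rewrite (sum_residues_exp m n (fun a => f a x)); exact: normc_sum.
apply: (le_trans mink); rewrite -[leRHS]mulrA ler_wpM2l ?mulr_ge0 ?ler0n//.
rewrite exprM -exprMn lerXn2r ?nnegrE ?exprn_ge0 ?mulr_ge0 ?sumr_ge0//.
- by move=> a _; rewrite exprn_ge0.
have := @sqr_sum_le R _ beta (fun J => sqrtr_ge0 _); rewrite card_ord => /le_trans; apply.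
rewrite ler_wpM2l// (sum_residues_exp m n (fun a => b a ^+ 2)) ler_sum// => J _.
by rewrite beta2.
Qed.

(** The narrow part is summed over the classes c modulo q^m0 without loss, because
    the restricted inequality is homogeneous of degree k + r >= 1 in the squares;
    the broad part is summed over all c, which reassembles (sum of h^2)^k. *)
Lemma decouples_restricted_step (m n r m0 n0 : nat) (X Y : R) :
  (0 < r)%N -> 0 <= X -> 0 <= Y -> (0 < m0)%N -> (m + n = m0 + n0)%N ->
  decouples n r X -> decouples_restricted n0 r Y ->
  decouples_restricted (m + n) r
    (k%:R ^+ (2 * r + 2 * k) * Y +
     (q ^ m0)%:R ^+ (4 * k) * ((interaction_bound K k m (m + n) m0)%:R * X * (q ^ m)%:R ^+ r)).
Proof.
move=> r0 X0 Y0 m00 e dX dY f h b fw h0 b0 fh fb.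
have r20 : (0 < 2 * r)%N by rewrite muln_gt0.
have p0 : (0 < 2 * r + 2 * k)%N by rewrite addn_gt0 r20.
have Sf (a : 'I_(q ^ (m + n))) : Sch (f a) by case: (fw a (ltn_ord a)).
pose fc (c : nat) x := \sum_(a < q ^ (m + n) | (a %% q ^ m0 == c)%N) f a x.
pose Hc (c : nat) := \sum_(a < q ^ (m + n) | (a %% q ^ m0 == c)%N) h a ^+ 2.
pose Bc (c : nat) := \sum_(a < q ^ (m + n) | (a %% q ^ m0 == c)%N) b a ^+ 2.
set H := \sum_(a < q ^ (m + n)) h a ^+ 2; set B := \sum_(a < q ^ (m + n)) b a ^+ 2.
have by_class (V : nmodType) (F : nat -> V) : \sum_(a < q ^ (m + n)) F a =
    \sum_(c < q ^ m0) \sum_(a < q ^ (m + n) | (a %% q ^ m0 == c)%N) F a.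
  rewrite e (sum_residues_exp _ _ F); apply: eq_bigr => c _.
  by rewrite (sum_residue_class_exp _ F).
have HE : H = \sum_(c < q ^ m0) Hc c by rewrite /H (by_class _ (fun a => h a ^+ 2)).
have BE : B = \sum_(c < q ^ m0) Bc c by rewrite /B (by_class _ (fun a => b a ^+ 2)).
have H0 : 0 <= H by apply: sumr_ge0 => a _; rewrite exprn_ge0.
have B0 : 0 <= B by apply: sumr_ge0 => a _; rewrite exprn_ge0.
have Hc0 c : 0 <= Hc c by apply: sumr_ge0 => a _; rewrite exprn_ge0.
have Bc0 c : 0 <= Bc c by apply: sumr_ge0 => a _; rewrite exprn_ge0.
have Sfc c : Sch (fc c) by apply: Sch_sum.
have Sall : Sch (fun x => \sum_(a < q ^ (m + n)) f a x) by exact: Sch_sum.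
have Snc (g : pt -> C) : Sch g -> Sch (fun x => nc (g x)).
  by apply: (Sch_comp (F := fun z : C => nc z)); rewrite ComplexField.Normc.normc0.
have narrow (c : 'I_(q ^ m0)) : I (fun x => nc (fc c x) ^+ (2 * r + 2 * k)) <=
    Y * (Hc c ^+ k * Bc c ^+ r).
  move: fw fh fb; rewrite /fc /Hc /Bc e => fw fh fb.
  rewrite (_ : (fun _ => _) = fun x => nc (\sum_(a < q ^ n0) f (c + q ^ m0 * a)%N x) ^+ (2 * r + 2 * k)).
    rewrite (sum_residue_class_exp _ (fun a => h a ^+ 2))//.
    rewrite (sum_residue_class_exp _ (fun a => b a ^+ 2))// mulrA.
    exact: (decouples_restricted_sub hchi hI I1 r0 dY (ltn_ord c) fw h0 b0 fh fb).
  by apply/funext => x; rewrite (sum_residue_class_exp _ (fun a => f a x)).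
set M := (interaction_bound K k m (m + n) m0)%:R.
set Z := X * (q ^ m)%:R ^+ r * B ^+ r.
have Z0 : 0 <= Z by rewrite !mulr_ge0 ?exprn_ge0.
pose br (phi : {ffun 'I_k -> 'I_(q ^ m0)}) x :=
  (\prod_i nc (fc (phi i) x) ^+ 2) * nc (\sum_(a < q ^ (m + n)) f a x) ^+ (2 * r).
have Sbr phi : Sch (br phi).
  apply: (@Sch_lc _ _ _ _ _ (fun v w => w * v) (fun x => nc (\sum_(a < q ^ (m + n)) f a x) ^+ (2 * r))
    (fun x => \prod_i nc (fc (phi i) x) ^+ 2)).
  - by move=> v; rewrite mulr0.
  - exact: Sch_nc_exp.
  - apply: locconst_big => i _; apply: (@locconst_comp _ _ _ _ (fun z : C => nc z ^+ 2)).
    by case: (Sfc (phi i)).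
have broad (phi : {ffun 'I_k -> 'I_(q ^ m0)}) : injectiveb phi ->
    I (br phi) <= M * Z * \prod_i Hc (phi i).
  move=> /injectiveP phi_inj.
  apply: le_trans (transversal_estimate r0 X0 m00 dX fw h0 b0 fh fb
    (c := fun i => phi i) _ _) _.
  - by move=> i; exact: ltn_ord.
  - by move=> i j ij; apply: phi_inj; exact: val_inj.
  by rewrite le_eqVlt; apply/orP; left; apply/eqP; rewrite /Z -/B -/M /Hc; ring.
have Snar : Sch (fun x => \sum_(c < q ^ m0) nc (fc c x) ^+ (2 * r + 2 * k)).
  by apply: Sch_sum => c _; exact: Sch_nc_exp.
have Sbroad : Sch (fun x => \sum_(phi : {ffun 'I_k -> 'I_(q ^ m0)} | injectiveb phi) br phi x).
  by apply: Sch_sum => phi _.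
have scal (v : R) (g : pt -> R) : Sch g -> Sch (fun x => v * g x).
  by apply: (Sch_comp (F := fun v' : R => v * v')); rewrite mulr0.
apply: (@le_trans _ _ (I (fun x => k%:R ^+ (2 * r + 2 * k) *
     (\sum_(c < q ^ m0) nc (fc c x) ^+ (2 * r + 2 * k)) +
   (q ^ m0)%:R ^+ (4 * k) *
     \sum_(phi : {ffun 'I_k -> 'I_(q ^ m0)} | injectiveb phi) br phi x))).
  apply: (inv_fun_le hI).
  - exact: Sch_nc_exp.
  - by apply: (@Sch_comp2 _ _ _ _ _ (fun v v' : R => v + v')); rewrite ?addr0//; exact: scal.
  move=> x; apply: (@broad_narrow R (q ^ m0) k r (fun c => nc (fc c x))) => //.
  - by rewrite expn_gt0 q_gt0.
  - by move=> c; exact: normc_ge0.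
  - exact: normc_ge0.
  - by rewrite (by_class _ (fun a => f a x)); exact: normc_sum.
rewrite (inv_funD hI); [|exact: scal|exact: scal].
rewrite !(inv_funZ hI)// !(inv_fun_sum hI)//; last by move=> c _; exact: Sch_nc_exp.
rewrite -mulrA mulrDl; apply: lerD.
  rewrite -mulrA ler_wpM2l ?exprn_ge0//.
  apply: (@le_trans _ _ (\sum_(c < q ^ m0) Y * (Hc c ^+ k * Bc c ^+ r))); first exact: ler_sum.
  by rewrite -mulr_sumr ler_wpM2l// HE BE; exact: sum_prod_pow_le.
rewrite -[leRHS]mulrA ler_wpM2l ?exprn_ge0//.
apply: (@le_trans _ _ (\sum_(phi : {ffun 'I_k -> 'I_(q ^ m0)}) M * Z * \prod_i Hc (phi i))).
  rewrite big_mkcond/=; apply: ler_sum => phi _; case: ifP => [/broad//|_].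
  by apply: mulr_ge0; [rewrite mulr_ge0// ler0n|apply: prodr_ge0].
rewrite -mulr_sumr.
have -> : \sum_(phi : {ffun 'I_k -> 'I_(q ^ m0)}) \prod_i Hc (phi i) = H ^+ k.
  rewrite -(bigA_distr_bigA (fun _ (c : 'I_(q ^ m0)) => Hc c)) prodr_const card_ord.
  by rewrite HE.
by rewrite le_eqVlt; apply/orP; left; apply/eqP; rewrite /Z; ring.
Qed.

End RestrictedStep.

(** * From the restricted inequality to decoupling *)

Section Interpolation.
Variables (R : realType) (K : discreteField) (k : nat).
Local Notation pt := 'rV[K]_k.
Local Notation q := (resid K).
Local Notation C := R[i].
Local Notation nc := ComplexField.Normc.normc.
Implicit Types (x y t : pt).

Variables (chi : K -> C) (I : (pt -> R) -> R).
Hypotheses (hchi : standard_char chi) (hI : invariant_functional I)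
  (I1 : I (@unit_cube R K k) = 1).
Hypotheses (k_gt0 : (0 < k)%N).

Let q_gt0 : (0 < q)%N := prime_gt0 (resid_prime K).
Local Notation wave := (wave chi).
Local Notation decouples := (decouples chi I).
Local Notation decouples_restricted := (decouples_restricted chi I).

Lemma wave_comp (n a : nat) (f : pt -> C) (F : C -> C) : F 0 = 0 ->
  (forall z v, nc z = 1 -> F (z * v) = z * F v) -> wave n a f -> wave n a (fun x => F (f x)).
Proof.
move=> F0 Fh [Sf ef]; split; first exact: Sch_comp.
by move=> x t tT; rewrite ef// Fh// (std_char_norm hchi).
Qed.

Lemma nc_wave_shift (n a : nat) (f : pt -> C) x t : wave n a f -> qball n t ->
  nc (f (x + t)) = nc (f x).
Proof.
move=> [_ ef] tn; rewrite ef; last by apply: Tset_qball => //; exact: rpred_nat.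
by rewrite ComplexField.Normc.normcM (std_char_norm hchi) mul1r.
Qed.

Lemma Sch_nc (f : pt -> C) : Sch f -> Sch (fun x => nc (f x)).
Proof.
by apply: (Sch_comp (F := fun z : C => nc z)); rewrite ComplexField.Normc.normc0.
Qed.

(** A wave has constant modulus on unit cubes, which have measure 1. *)
Lemma wave_sup_le (n a p : nat) (f : pt -> C) (b : R) : (0 < p)%N -> wave n a f -> 0 <= b ->
  I (fun x => nc (f x) ^+ p) <= b ^+ p -> forall x, nc (f x) <= b.
Proof.
move=> p0 fw b0 fb x; rewrite -(ler_pXn2r p0) ?nnegrE ?normc_ge0//.
apply: le_trans fb; have Sb := @Sch_ball K k R 0 x.
have -> : nc (f x) ^+ p = I (fun y => nc (f x) ^+ p * (qball 0 (y - x))%:R).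
  rewrite (inv_funZ hI)// (inv_fun_ball hI) -[X in _ = _ * X]/(I (@unit_cube R K k)).
  by rewrite I1 mulr1.
have Sf : Sch f by case: fw.
apply: (inv_fun_le hI).
- by apply: (Sch_comp (F := fun v : R => _ * v)) => //; rewrite mulr0.
- exact: Sch_nc_exp.
move=> y; case: (boolP (qball 0 _)) => [h|_]; last by rewrite mulr0 exprn_ge0 ?normc_ge0.
rewrite mulr1 -[y](subrK x) addrC (nc_wave_shift x fw)//.
exact: (qball_mono _ h).
Qed.

(** Cutting off by the modulus commutes with the multiplication by phases, so that
    it turns waves into waves. *)
Definition truncation (v : R) (z : C) : C := if nc z <= v then z else 0.

Lemma truncationM (v : R) (z s : C) : nc z = 1 -> truncation v (z * s) = z * truncation v s.
Proof.
by move=> z1; rewrite /truncation ComplexField.Normc.normcM z1 mul1r; case: ifP; rewrite ?mulr0.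
Qed.

Lemma truncation0 v : truncation v 0 = 0.
Proof. by rewrite /truncation; case: ifP. Qed.

Lemma nc_truncation_le (v : R) (z : C) : 0 <= v -> nc (truncation v z) <= v.
Proof. by rewrite /truncation; case: ifP => // _ v0; rewrite ComplexField.Normc.normc0. Qed.

Lemma level_piece (v1 v2 : R) (z : C) : v1 <= v2 ->
  truncation v2 z - truncation v1 z = if v1 < nc z <= v2 then z else 0.
Proof.
move=> v12; rewrite /truncation ltNge; case: (leP (nc z) v1) => /= h1.
  by rewrite (le_trans h1 v12) subrr.
by case: ifP; rewrite subr0.
Qed.

Section OneBall.
Variables (n r L : nat) (X Z : R) (y0 : pt).
Hypotheses (r_gt0 : (0 < r)%N) (X_ge0 : 0 <= X) (dX : decouples_restricted n r X)
  (XZ : 4 ^+ k * X <= Z) (Z_ge1 : 1 <= Z)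
  (hL : ((q ^ n) ^ (k * k + r + k) <= 2 ^ L)%N).
Variables (f : nat -> pt -> C) (b : nat -> R).
Hypotheses (fw : forall a, (a < q ^ n)%N -> wave n a (f a)) (b_ge0 : forall a, 0 <= b a)
  (fb : forall a, (a < q ^ n)%N ->
     I (fun x => nc (f a x) ^+ (2 * (r + k))) <= b a ^+ (2 * (r + k)))
  (fy0 : forall a, (a < q ^ n)%N -> forall x, f a x != 0 -> qball (n * k)%N (x - y0)).

Let p := (2 * (r + k))%N.
Let p_gt0 : (0 < p)%N. Proof. by rewrite /p; lia. Qed.
Let S := (\sum_(a < q ^ n) b a ^+ 2) ^+ (r + k).
Let S_ge0 : 0 <= S.
Proof. by rewrite exprn_ge0// sumr_ge0// => a _; rewrite exprn_ge0. Qed.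

Let level (l a : nat) : R := b a / 2 ^+ l.
Let level_ge0 l a : 0 <= level l a. Proof. by rewrite divr_ge0// exprn_ge0. Qed.
Let levelS l a : level l.+1 a <= level l a.
Proof. by rewrite ler_wpM2l// lef_pV2 ?posrE ?exprn_gt0// ler_weXn2l// ler1n. Qed.

Let piece (l a : nat) x : C := truncation (level l a) (f a x) - truncation (level l.+1 a) (f a x).

Let piece_wave l a : (a < q ^ n)%N -> wave n a (piece l a).
Proof.
move=> an; apply: (@wave_comp n a (f a)
  (fun z => truncation (level l a) z - truncation (level l.+1 a) z)); last exact: fw.
  by rewrite !truncation0 subr0.
by move=> z v z1; rewrite !truncationM// mulrBr.
Qed.

(** On a level piece the modulus exceeds b a / 2 ^ l.+1, so the L^2r norm is
    controlled by the L^p norm b a (Chebyshev); tau is the resulting constant. The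
    powers of 2 ^ l from the supremum and L^2r norms cancel. *)
Let high_level l : I (fun x => nc (\sum_(a < q ^ n) piece l a x) ^+ p) <= Z * S.
Proof.
have two0 m : (2 : R) ^+ m != 0 by rewrite expf_neq0// pnatr_eq0.
have r20 : (0 < 2 * r)%N by rewrite muln_gt0.
have [tau tau0 tauE] := @root_exists R (2 ^+ (2 * k * l.+1)) (2 * r) (exprn_ge0 _ (ler0n _ _)) r20.
have e : p = (2 * r + 2 * k)%N by rewrite /p mulnDr.
have := dX (f := piece l) (h := level l) (b := fun a => tau * b a) (piece_wave l) _ _ _ _.
rewrite -e => /(_ (level_ge0 l) (fun a => mulr_ge0 tau0 (b_ge0 a))) main.
apply: le_trans (main _ _) _.
- move=> a an x; rewrite /piece level_piece//; case: ifP => [/andP[]//|_].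
  by rewrite ComplexField.Normc.normc0.
- move=> a an; have Sp : Sch (fun x => nc (piece l a x) ^+ (2 * r)).
    by apply: Sch_nc_exp => //; case: (piece_wave l an).
  have := b_ge0 a; rewrite le_eqVlt => /predU1P[ba|ba].
    rewrite (_ : (fun _ => _) = fun=> 0).
      by rewrite (inv_fun0 hI) -ba mulr0 expr0n gtn_eqF.
    apply/funext => x; have : nc (f a x) <= b a.
      exact: (wave_sup_le p_gt0 (fw an) (b_ge0 a) (fb an)).
    rewrite -ba => h; have /ComplexField.Normc.eq0_normc fx0 : nc (f a x) = 0.
      by apply/eqP; rewrite eq_le h normc_ge0.
    by rewrite /piece fx0 !truncation0 subr0 ComplexField.Normc.normc0 expr0n gtn_eqF.
  have lv0 : 0 < level l.+1 a ^+ (2 * k) by rewrite exprn_gt0// divr_gt0// exprn_gt0.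
  rewrite -(ler_pM2l lv0) -(inv_funZ hI)//.
  apply: (@le_trans _ _ (b a ^+ p)).
    apply: le_trans (fb an); apply: (inv_fun_le hI).
    + by apply: (Sch_comp (F := fun v : R => _ * v)) => //; rewrite mulr0.
    + by apply: Sch_nc_exp => //; case: (fw an).
    move=> x; rewrite /piece level_piece//; case: ifP => [/andP[h1 _]|_]; last first.
      by rewrite ComplexField.Normc.normc0 expr0n gtn_eqF// mulr0 exprn_ge0 ?normc_ge0.
    rewrite -/p e [in leRHS]addnC exprD ler_wpM2r ?exprn_ge0 ?normc_ge0//.
    by rewrite lerXn2r ?nnegrE ?normc_ge0// ltW.
  rewrite [(tau * _) ^+ _]exprMn tauE /level exprMn exprVn -exprM e exprD le_eqVlt; apply/orP; left; apply/eqP.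
  have -> : (l.+1 * (2 * k) = 2 * k * l.+1)%N by rewrite mulnC.
  by rewrite -mulrA mulKf// mulrC.
have -> : \sum_(a < q ^ n) level l a ^+ 2 = (4 ^+ l)^-1 * \sum_(a < q ^ n) b a ^+ 2.
  rewrite mulr_sumr; apply: eq_bigr => a _; rewrite /level exprMn exprVn -exprM mulnC exprM mulrC.
  by rewrite (_ : 2 ^+ 2 = 4)//; rewrite -natrX.
have -> : \sum_(a < q ^ n) (tau * b a) ^+ 2 = tau ^+ 2 * \sum_(a < q ^ n) b a ^+ 2.
  by rewrite mulr_sumr; apply: eq_bigr => a _; rewrite exprMn.
have : (tau ^+ 2) ^+ r = 2 ^+ (2 * k * l.+1) by rewrite -exprM.
move: (tau ^+ 2) => tau2 tau2E; rewrite 2!exprMn tau2E.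
apply: (@le_trans _ _ (4 ^+ k * X * S)); last by rewrite ler_wpM2r.
rewrite /S exprD le_eqVlt; apply/orP; left; apply/eqP.
have -> : (2 : R) ^+ (2 * k * l.+1) = 4 ^+ k * (4 ^+ l) ^+ k.
  rewrite -mulnA exprM (_ : 2 ^+ 2 = 4)//; last by rewrite -natrX.
  by rewrite mulnS exprD mulnC exprM.
rewrite exprVn; have : (4 ^+ l : R) ^+ k != 0 by rewrite !expf_neq0// pnatr_eq0.
move: ((4 ^+ l : R) ^+ k) (\sum_(a < q ^ n) b a ^+ 2) => u s u0.
by field; rewrite u0.
Qed.

(** Here the trivial estimate is enough: the waves are below 2 ^- L of their norms
    and everything takes place in a single ball of radius q^(nk). *)
Let low_level :
  I (fun x => nc (\sum_(a < q ^ n) truncation (level L a) (f a x)) ^+ p) <= Z * S.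
Proof.
pose B := \sum_(a < q ^ n) level L a.
have B0 : 0 <= B by exact: sumr_ge0.
have ST : Sch (fun x => \sum_(a < q ^ n) truncation (level L a) (f a x)).
  apply: Sch_sum => a _; apply: Sch_comp; first exact: truncation0.
  by case: (fw (ltn_ord a)).
have Sb := @Sch_ball K k R (n * k)%N y0.
apply: (@le_trans _ _ (B ^+ p * (q ^ (n * k))%:R ^+ k)).
  rewrite -(haar_ball hI I1 (n * k)) -(inv_fun_ball hI _ y0) -(inv_funZ hI)//.
  apply: (inv_fun_le hI).
  - exact: Sch_nc_exp.
  - by apply: (Sch_comp (F := fun v : R => _ * v)) => //; rewrite mulr0.
  move=> x; case: (boolP (qball _ _)) => [_|xb].
    rewrite mulr1 lerXn2r ?nnegrE ?normc_ge0//.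
    by apply: (le_trans (normc_sum _ _ _)); apply: ler_sum => a _; exact: nc_truncation_le.
  rewrite big1 ?ComplexField.Normc.normc0 ?mulr0 ?expr0n ?gtn_eqF// => a _.
  have [->|/(fy0 (ltn_ord a))] := eqVneq (f a x) 0; first exact: truncation0.
  by rewrite (negPf xb).
have BE : B = (\sum_(a < q ^ n) b a) / 2 ^+ L by rewrite mulr_suml.
have bS : (\sum_(a < q ^ n) b a) ^+ p <= (q ^ n)%:R ^+ (r + k) * S.
  rewrite /p exprM /S -exprMn lerXn2r ?nnegrE ?exprn_ge0 ?mulr_ge0 ?sumr_ge0//.
    by move=> a _; rewrite exprn_ge0.
  by have := @sqr_sum_le R _ (fun a : 'I_(q ^ n) => b a); rewrite card_ord; apply.
apply: (@le_trans _ _ S); last by rewrite ler_peMl.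
rewrite BE exprMn exprVn -mulrA mulrC -mulrA mulrC ler_pdivrMr ?exprn_gt0//.
apply: (@le_trans _ _ ((q ^ (n * k))%:R ^+ k * ((q ^ n)%:R ^+ (r + k) * S))).
  by rewrite mulrC ler_wpM2r ?exprn_ge0 ?sumr_ge0 ?ler0n// || rewrite ler_wpM2l ?exprn_ge0.
rewrite mulrA [_ * S]mulrC ler_wpM2l//.
have -> : ((q ^ (n * k))%:R : R) ^+ k * (q ^ n)%:R ^+ (r + k) = ((q ^ n) ^ (k * k + r + k))%:R.
  by rewrite -!natrX -natrM -expnM -mulnA expnM -expnD addnA.
apply: (@le_trans _ _ (2 ^+ L)); first by rewrite -natrX ler_nat.
by rewrite -exprM ler_weXn2l ?ler1n// leq_pmulr.
Qed.

Lemma decouples_one_ball :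
  I (fun x => nc (\sum_(a < q ^ n) f a x) ^+ p) <= L.+1%:R ^+ p * Z * S.
Proof.
have Z0 : 0 <= Z by exact: le_trans ler01 Z_ge1.
have [zeta zeta0 zetaE] := root_exists (mulr_ge0 Z0 S_ge0) p_gt0.
pose G (l : 'I_L.+1) x : C := if (l < L)%N then \sum_(a < q ^ n) piece l a x
  else \sum_(a < q ^ n) truncation (level L a) (f a x).
have SG l : Sch (G l).
  rewrite /G; case: (l < L)%N; apply: Sch_sum => a _.
    by case: (piece_wave l (ltn_ord a)).
  apply: Sch_comp; first exact: truncation0.
  by case: (fw (ltn_ord a)).
have e : p = p.-1.+1 by rewrite prednK.
have GI l : I (fun x => nc (G l x) ^+ p.-1.+1) <= zeta ^+ p.-1.+1.
  by rewrite -e zetaE /G; case: (l < L)%N; [exact: high_level|exact: low_level].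
have := sum_minkowski hI I1 SG (fun=> zeta0) GI; rewrite -e sumr_const card_ord.
rewrite -[zeta *+ _]mulr_natl exprMn zetaE mulrA.
rewrite (_ : (fun x => nc (\sum_j G j x) ^+ p) = fun x => nc (\sum_(a < q ^ n) f a x) ^+ p)//.
apply/funext => x; congr (nc _ ^+ _); rewrite big_ord_recr/= {2}/G ltnn.
have -> : \sum_(l < L) G (widen_ord (leqnSn L) l) x = \sum_(l < L) \sum_(a < q ^ n) piece l a x.
  by apply: eq_bigr => l _; rewrite /G /= ltn_ord.
rewrite exchange_big/= -big_split/=; apply: eq_bigr => a _.
(* The pieces telescope, from truncation at the level b a, which is no truncation. *)
have -> : \sum_(l < L) piece l a x = f a x - truncation (level L a) (f a x).
  rewrite -(big_mkord xpredT (fun l => piece l a x)) /piece.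
  pose T l := truncation (level l a) (f a x).
  have -> : \sum_(0 <= l < L) (T l - T l.+1) = T 0%N - T L.
    rewrite -[LHS]opprK -sumrN -[RHS]opprB; congr (- _).
    by rewrite -telescope_sumr//; apply: eq_bigr => l _; rewrite opprB.
  congr (_ - _).
  rewrite /T /truncation /level expr0 divr1.
  by rewrite (wave_sup_le p_gt0 (fw (ltn_ord a)) (b_ge0 a) (fb (ltn_ord a))).
by rewrite subrK.
Qed.

End OneBall.

(** Multiplication by the indicator function of a ball of radius q^(nk) preserves
    waves, since the dual lattices lie in that ball around 0. The inequality thus
    follows from the case of one ball, the norms bl (l, a) of the localised waves
    being recombined by the power mean inequality. *)
Lemma decouples_of_restricted (n r L : nat) (X Z : R) :
  (0 < r)%N -> 0 <= X -> decouples_restricted n r X -> 4 ^+ k * X <= Z -> 1 <= Z ->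
  ((q ^ n) ^ (k * k + r + k) <= 2 ^ L)%N ->
  decouples n (r + k) (L.+1%:R ^+ (2 * (r + k)) * Z).
Proof.
move=> r0 X0 dX XZ Z1 hL f b fw b0 fb; set p := (2 * (r + k))%N.
have p0 : (0 < p)%N by rewrite /p; lia.
have Z0 : 0 <= Z by exact: le_trans ler01 Z1.
have Sf (a : 'I_(q ^ n)) : Sch (f a) by case: (fw a (ltn_ord a)).
have SF : Sch (fun x => \sum_(a < q ^ n) nc (f a x)).
  by apply: Sch_sum => a _; exact: Sch_nc.
have [_ [d hd]] := SF.
have fsupp (a : 'I_(q ^ n)) x : f a x != 0 -> qball ((n * k)%N%:Z + d%:Z) x.
  move=> fx; have := hd x; rewrite psumr_eq0 => [|c _]; last exact: normc_ge0.
  have -> : all (fun c : 'I_(q ^ n) => nc (f c x) == 0) (index_enum 'I_(q ^ n)) = false.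
    apply/negP => /allP/(_ a); rewrite mem_index_enum => /(_ isT) /eqP.
    by move/ComplexField.Normc.eq0_normc => h; rewrite h eqxx in fx.
  by move=> /(_ isT) h; apply: (qball_mono _ h); lia.
pose J := {ffun 'I_k -> 'I_(q ^ d)}.
pose cell (l : J) x := qball (n * k)%N (x - grid (n * k)%N l).
pose fl (l : J) (a : nat) x : C := if cell l x then f a x else 0.
have flw l a : (a < q ^ n)%N -> wave n a (fl l a).
  move=> an; have [Sfa efa] := fw a an; split.
    by apply: Sch_indic => //; exact: locconst_ball.
  move=> x t tT; have cellt : cell l (x + t) = cell l x.
    by rewrite /cell addrAC; apply: qballDr; apply: (qball_Tset _ tT); exact: rpred_nat.
  by rewrite /fl cellt efa//; case: ifP; rewrite ?mulr0.
have ncell (g : pt -> C) l x : (if cell l x then nc (g x) ^+ p else 0) =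
    nc (if cell l x then g x else 0) ^+ p.
  by case: ifP; rewrite ?ComplexField.Normc.normc0 ?expr0n ?gtn_eqF.
have Ige0 l a : (a < q ^ n)%N -> 0 <= I (fun x => nc (fl l a x) ^+ p).
  move=> an; apply: (inv_fun_ge0 hI); last by move=> x; rewrite exprn_ge0 ?normc_ge0.
  by apply: Sch_nc_exp => //; case: (flw l a an).
have /choice[bl hbl] (la : J * nat) : exists v : R, 0 <= v /\
    ((la.2 < q ^ n)%N -> v ^+ p = I (fun x => nc (fl la.1 la.2 x) ^+ p)).
  case: (ltnP la.2 (q ^ n)) => an; last by exists 0.
  by have [v v0 vE] := root_exists (Ige0 la.1 _ an) p0; exists v.
have split_cells (g : pt -> C) : Sch g -> (forall x, g x != 0 -> qball ((n * k)%N%:Z + d%:Z) x) ->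
    I (fun x => nc (g x) ^+ p) = \sum_(l : J) I (fun x => nc (if cell l x then g x else 0) ^+ p).
  move=> Sg gs; rewrite (inv_fun_cells hI (z := (n * k)%N) (d := d)).
  - apply: eq_bigr => l _; congr I; apply/funext => x; exact: ncell.
  - exact: Sch_nc_exp.
  move=> x; have [->|/gs//] := eqVneq (g x) 0.
  by rewrite ComplexField.Normc.normc0 expr0n gtn_eqF// eqxx.
rewrite split_cells; [|exact: Sch_sum|]; last first.
  move=> x sx; apply: contrapT => xb; case/eqP: sx; apply: big1 => a _.
  by apply/eqP; apply: contrapT => /negP /fsupp.
pose Y : R := \sum_(l : J) L.+1%:R ^+ p * Z * (\sum_(a < q ^ n) bl (l, nat_of_ord a) ^+ 2) ^+ (r + k).
apply: (@le_trans _ _ Y).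
  apply: ler_sum => l _.
  rewrite (_ : (fun _ => _) = fun x => nc (\sum_(a < q ^ n) fl l a x) ^+ p); last first.
    by apply/funext => x; rewrite /fl; case: ifP => // _; rewrite big1.
  apply: (decouples_one_ball (X := X) (y0 := grid (n * k)%N l) r0 X0 dX XZ Z1 hL (b := fun a => bl (l, a))).
  - exact: flw.
  - by move=> a; have [] := hbl (l, a).
  - by move=> a an; have [_ ->] := hbl (l, a).
  - move=> a an x; rewrite /fl /cell; case: ifP => //; by rewrite eqxx.
rewrite /Y -mulr_sumr ler_wpM2l ?mulr_ge0 ?exprn_ge0//.
have -> : (r + k = (r + k).-1.+1)%N by rewrite prednK// addn_gt0 r0.
set N := (r + k).-1.
have eN : p = (2 * N.+1)%N by rewrite /N prednK// addn_gt0 r0.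
have sumb (a : 'I_(q ^ n)) : \sum_(l : J) bl (l, nat_of_ord a) ^+ p <= b a ^+ p.
  apply: le_trans (fb a (ltn_ord a)); rewrite -/p split_cells//; last exact: fsupp.
  by apply: ler_sum => l _; have [_ /(_ (ltn_ord a)) ->] := hbl (l, nat_of_ord a).
have bl0 l a : 0 <= bl (l, a) by have [] := hbl (l, a).
have zero l (a : 'I_(q ^ n)) : b a ^+ 2 = 0 -> bl (l, nat_of_ord a) ^+ 2 = 0.
  move=> /eqP; rewrite expf_eq0/= => /eqP ba.
  have : bl (l, nat_of_ord a) ^+ p <= 0.
    apply: le_trans (_ : _ <= b a ^+ p) _; last by rewrite ba expr0n gtn_eqF.
    apply: le_trans (sumb a); rewrite (bigD1 l)//= lerDl sumr_ge0// => l' _.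
    by rewrite exprn_ge0.
  move=> h; have : bl (l, nat_of_ord a) ^+ p == 0 by rewrite eq_le h exprn_ge0.
  by rewrite expf_eq0 p0/= => /eqP ->; rewrite expr0n.
apply: (@le_trans _ _ (\sum_(l : J) (\sum_(a < q ^ n) b a ^+ 2) ^+ N *
    \sum_(a < q ^ n) (bl (l, nat_of_ord a) ^+ 2) ^+ N.+1 / (b a ^+ 2) ^+ N)).
  apply: ler_sum => l _.
  apply: (@power_sum_le R _ (fun a : 'I_(q ^ n) => bl (l, nat_of_ord a) ^+ 2) (fun a => b a ^+ 2)).
  - by move=> a; rewrite exprn_ge0.
  - by move=> a; rewrite exprn_ge0.
  - by move=> a; exact: zero.
rewrite -mulr_sumr exprSr ler_wpM2l ?exprn_ge0 ?sumr_ge0//.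
  by move=> a _; rewrite exprn_ge0.
rewrite exchange_big/=; apply: ler_sum => a _; rewrite -mulr_suml.
have := b0 a; rewrite le_eqVlt => /predU1P[ba|ba].
  rewrite big1 ?mul0r ?exprn_ge0// => l _.
  by rewrite (zero l a) ?expr0n// -ba expr0n.
rewrite ler_pdivrMr ?exprn_gt0// -exprS -exprM -eN.
by under eq_bigr => l _ do rewrite -exprM -eN.
Qed.

End Interpolation.

(** * One step of the bootstrap *)

Section Growth.
Variable R : realType.

Lemma powR_unbounded (eta M : R) : 0 < eta -> exists2 Q0 : nat, (0 < Q0)%N & M <= Q0%:R `^ eta.
Proof.
move=> eta0; pose v := Num.max M 1 `^ eta^-1.
exists (Num.truncn v).+1 => //.
have v0 : 0 <= v by exact: powR_ge0.
have vQ : v <= (Num.truncn v).+1%:R by rewrite ltW// truncnS_gt.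
have M0 : 0 <= Num.max M 1 by rewrite le_max ler01 orbT.
apply: (@le_trans _ _ (v `^ eta)); last by apply: ge0_ler_powR; rewrite ?nnegrE//; exact: ltW.
by rewrite /v -powRrM mulVf ?gt_eqF// powRr1// le_max lexx.
Qed.

Lemma poly_le_exp (eta : R) (p : nat) : 0 < eta ->
  exists2 A : R, 0 <= A & forall t : nat, t.+2%:R ^+ p <= A * 2 `^ (t%:R * eta).
Proof.
move=> eta0; case: p => [|p].
  exists 1 => // t; rewrite expr0 mul1r -[leLHS](powRr0 2) ler_powR ?ler1n//.
  by rewrite mulr_ge0// ltW.
have e0 : 0 < eta / p.+1%:R by rewrite divr_gt0.
have [x x0 xE] : exists2 x : R, 0 < x & 1 + x = 2 `^ (eta / p.+1%:R).
  exists (2 `^ (eta / p.+1%:R) - 1); last by rewrite addrC subrK.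
  have := @gt0_ltr_powR R _ e0 1 2; rewrite powR1 !nnegrE subr_gt0 => h.
  by apply: h; rewrite ?ler01 ?ler0n ?ltr1n.
have x0' := ltW x0.
have bern (t : nat) : 1 + t%:R * x <= (1 + x) ^+ t.
  elim: t => [|t IH]; first by rewrite mul0r addr0 expr0.
  rewrite exprS; apply: le_trans (_ : _ <= (1 + x) * (1 + t%:R * x)) _; last first.
    by rewrite ler_wpM2l// addr_ge0// ltW.
  have -> : (1 + x) * (1 + t%:R * x) = 1 + t.+1%:R * x + t%:R * x ^+ 2.
    by rewrite -natr1; ring.
  by rewrite lerDl mulr_ge0// sqr_ge0.
exists ((2 + x^-1) ^+ p.+1) => [|t]; first by rewrite exprn_ge0// addr_ge0// invr_ge0 ltW.
have -> : 2 `^ (t%:R * eta) = ((1 + x) ^+ t) ^+ p.+1.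
  rewrite xE -!powR_mulrn ?powR_ge0// -!powRrM; congr (_ `^ _).
  by rewrite mulrCA divfK ?pnatr_eq0.
rewrite -exprMn lerXn2r ?nnegrE//.
  by rewrite mulr_ge0 ?exprn_ge0 ?addr_ge0 ?invr_ge0.
apply: (@le_trans _ _ ((2 + x^-1) * (1 + t%:R * x))); last first.
  by rewrite ler_wpM2l// addr_ge0// invr_ge0 ltW.
have -> : (2 + x^-1) * (1 + t%:R * x) = t.+2%:R + (2 * t%:R * x + x^-1).
  by rewrite -addn2 natrD; field; rewrite gt_eqF.
by rewrite lerDl addr_ge0 ?mulr_ge0 ?invr_ge0.
Qed.

End Growth.

(** The scale q^m0 of the broad-narrow decomposition has to exceed a constant Q0;
    for the dependence on q it matters that it can be kept below q Q0. *)
Lemma exponent_threshold (q Q0 : nat) : (1 < q)%N -> (0 < Q0)%N ->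
  exists m0 : nat, [/\ (0 < m0)%N, (Q0 <= q ^ m0)%N & (q ^ m0.-1 <= Q0)%N].
Proof.
move=> q1 Q00; have ex : exists m, (Q0 <= q ^ m.+1)%N.
  by exists Q0; rewrite (leq_trans (ltnW (ltn_expl Q0 q1)))// leq_pexp2l// ltnW.
case: (ex_minnP ex) => m hm hmin; exists m.+1; split => //=.
case: m hm hmin => [|m] _ hmin; first by rewrite expn0.
by rewrite leqNgt; apply/negP => /ltnW/hmin; rewrite ltnn.
Qed.

Lemma ceil_div (n k : nat) : (0 < k)%N -> exists m : nat,
  [/\ (n <= m * k)%N, (m * k <= n + k.-1)%N & (0 < n)%N -> (m <= n)%N].
Proof.
move=> k0; exists ((n + k.-1) %/ k)%N.
have e := divn_eq (n + k.-1) k; have lt := ltn_pmod (n + k.-1) k0.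
move: e lt; set m := (_ %/ k)%N; set r := (_ %% k)%N => e lt.
split; [lia|lia|move=> n0; rewrite -(leq_pmul2r k0); nia].
Qed.

Lemma sum_rev_ord (k : nat) : (2 * \sum_(j < k) (k - j.+1) = k * k.-1)%N.
Proof.
elim: k => [|k IH]; first by rewrite big_ord0.
rewrite big_ord_recl /= subSS subn0 mulnDr.
by under eq_bigr => j _ do rewrite /bump/= add1n subSS; rewrite IH; case: k {IH} => //= k; lia.
Qed.

(** Since m is at least n / k, the sum of the n - min(mj, n) is at most n (k-1) / 2. *)
Lemma interaction_exponent (k m n : nat) : (n <= m * k)%N ->
  (2 * \sum_(j < k) (n - minn (m * j.+1) n) <= n * k.-1)%N.
Proof.
case: k => [|k] nm; first by rewrite big_ord0.
rewrite -(@leq_pmul2l k.+1)// [(k.+1 * (n * _))%N]mulnCA -sum_rev_ord.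
rewrite mulnCA [leqRHS]mulnCA leq_mul2l /= 2!big_distrr/=; apply: leq_sum => j _.
have jk := ltn_ord j.
suff : (n * j.+1 <= k.+1 * (m * j.+1))%N.
  rewrite mulnBr mulnBr; case: (leqP (m * j.+1) n) => h; nia.
by rewrite mulnA leq_mul2r [(k.+1 * m)%N]mulnC nm orbT.
Qed.

Section ExponentStep.
Variables (R : realType).
Local Notation C := R[i].

Section Monotone.
Variables (K : discreteField) (k : nat) (chi : K -> C) (I : ('rV[K]_k -> R) -> R).

Lemma decouples_mono n r (X Y : R) : X <= Y -> decouples chi I n r X -> decouples chi I n r Y.
Proof.
move=> XY dX f b fw b0 fb; apply: (le_trans (dX f b fw b0 fb)).
by rewrite ler_wpM2r// exprn_ge0// sumr_ge0// => a _; rewrite exprn_ge0.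
Qed.

Lemma decouples_restricted_mono n r (X Y : R) : X <= Y ->
  decouples_restricted chi I n r X -> decouples_restricted chi I n r Y.
Proof.
move=> XY dX f h b fw h0 b0 fh fb; apply: (le_trans (dX f h b fw h0 b0 fh fb)).
by rewrite -!mulrA ler_wpM2r// mulr_ge0// exprn_ge0// sumr_ge0// => a _; rewrite exprn_ge0.
Qed.

End Monotone.

(** The exponent of 1 / delta produced by one step: (k - 1) / 2 comes from the
    interactions, r / k from the number q^m of intervals J, and (1 - 1/k) e from
    decoupling at relative scale q^-(n-m). *)
Definition next_exponent (k r : nat) (e : R) : R :=
  (k%:R - 1) / 2 + r%:R / k%:R + (1 - k%:R^-1) * e.
(** The increment of a(p, p0) from p = 2r to 2(r + k). *)
Definition step_loss (k r : nat) : R :=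
  (r + k)%:R + (k%:R ^+ 2 + 7 * k%:R - 4) / 2.

(** Induction on n. For n < m0 the trivial bound is a constant; otherwise the narrow
    term takes half of the right-hand side because q^(m0 eps1) >= 2 k^p, and the
    broad term the other half. Of the loss q^(4k) q^r, the first factor comes from
    q^m0 <= q Q0 and the second from rounding n / k up to m. *)
Lemma restricted_bound (k r : nat) (eps1 C0 : R) : (2 <= k)%N -> (0 < r)%N ->
  0 < eps1 -> 0 <= C0 -> exists2 C1 : R, 1 <= C1 &
  forall (K : discreteField) (chi : K -> C) (I : ('rV[K]_k -> R) -> R),
  standard_char chi -> invariant_functional I -> I (@unit_cube R K k) = 1 ->
  (k < resid K)%N -> forall (al e : R), 0 <= al -> 0 <= e ->
  (forall n, decouples chi I n r
     (C0 * (resid K)%:R `^ al * (resid K)%:R `^ (n%:R * e))) ->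
  forall n, decouples_restricted chi I n r
     (C1 * (resid K)%:R `^ (al + step_loss k r) *
        (resid K)%:R `^ (n%:R * (next_exponent k r e + eps1))).
Proof.
move=> k2 r0 eps10 C00; have k0 : (0 < k)%N by apply: ltn_trans k2.
set p := (2 * r + 2 * k)%N.
have [Q0 Q00 hQ0] := powR_unbounded (2 * k%:R ^+ p) eps10.
pose B1 : R := Q0%:R ^+ (k + r) + Q0%:R ^+ (4 * k + k * k.-1) * C0.
have Q01 : 1 <= Q0%:R :> R by rewrite ler1n.
have B1_1 : 1 <= B1 by rewrite ler_wpDr ?exprn_ege1// mulr_ge0// exprn_ge0.
exists (2 * B1); first by rewrite -[leLHS]mulr1 ler_pM// ler1n.
move=> K chi I hchi hI I1 kq al e al0 e0 dX.
set q := resid K in kq dX *; have q1 : (1 < q)%N := prime_gt1 (resid_prime K).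
pose Q : R := q%:R; have Q1 : 1 <= Q by rewrite ler1n ltnW.
have Q0' : 0 < Q by rewrite ltr0n ltnW.
have Qn0 : Q != 0 by rewrite gt_eqF.
have powD x y : Q `^ (x + y) = Q `^ x * Q `^ y by rewrite powRD// Qn0 implybT.
have pown (n : nat) : Q ^+ n = Q `^ n%:R by rewrite powR_mulrn// ltW.
have [m0 [m00 hm0 hm0']] := exponent_threshold q1 Q00.
set be := step_loss k r; set e' := next_exponent k r e.
have kR : 2 <= k%:R :> R by rewrite ler_nat.
have kn0 : k%:R != 0 :> R by rewrite pnatr_eq0 -lt0n.
have ki : 0 <= 1 - k%:R^-1 :> R by rewrite subr_ge0 invf_le1 ?ltr0n// ler1n.
have e'0 : 0 <= e'.
  rewrite /e' /next_exponent !addr_ge0 ?divr_ge0 ?mulr_ge0//.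
  by rewrite subr_ge0 (le_trans _ kR)// ler1n.
have be0 : (4 * k)%:R + r%:R <= be.
  rewrite /be /step_loss natrD natrM -subr_ge0.
  have -> : r%:R + k%:R + (k%:R ^+ 2 + 7 * k%:R - 4) / 2 - (4 * k%:R + r%:R) =
     ((k%:R - 2) * (k%:R + 3) + 2) / 2 :> R by field.
  rewrite divr_ge0// addr_ge0// mulr_ge0 ?subr_ge0// addr_ge0//.
have be00 : 0 <= be by apply: le_trans be0; rewrite addr_ge0.
have ge1 x : 0 <= x -> 1 <= Q `^ x.
  by move=> x0; rewrite -(powRr0 Q) ler_powR.
elim/ltn_ind => n IH; case: (ltnP n m0) => nm0.
  apply: (decouples_restricted_mono _ (decouples_restricted_trivial (chi := chi) hI I1 (n := n) r0)).
  apply: (@le_trans _ _ (Q0%:R ^+ (k + r))).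
    rewrite lerXn2r ?nnegrE// ler_nat (leq_trans _ hm0')// leq_pexp2l ?(ltnW q1)//.
    by rewrite -ltnS prednK.
  apply: (@le_trans _ _ (2 * B1)).
    rewrite (@le_trans _ _ B1)//; first by rewrite /B1 lerDl mulr_ge0// exprn_ge0.
    by rewrite ler_peMl ?ler1n// (le_trans ler01).
  rewrite -mulrA ler_peMr ?mulr_ge0// ?(le_trans ler01 B1_1)//.
  rewrite -[leLHS]mulr1 ler_pM//; apply: ge1; first exact: addr_ge0 al0 be00.
  exact: mulr_ge0 (ler0n R n) (addr_ge0 e'0 (ltW eps10)).
have [m [mk_ge mk_le mn0]] := ceil_div n k0.
have mn : (m <= n)%N by apply: mn0; exact: leq_trans nm0.
have em : (m + (n - m) = n)%N by rewrite subnKC.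
have em0 : (m + (n - m) = m0 + (n - m0))%N by rewrite em subnKC.
have Xge0 (n1 : nat) : 0 <= C0 * Q `^ al * Q `^ (n1%:R * e).
  by rewrite !mulr_ge0 ?powR_ge0.
have lt1 : (n - m0 < n)%N by rewrite -subn_gt0 subKn.
have Yge0 : 0 <= 2 * B1 * Q `^ (al + be) * Q `^ ((n - m0)%N%:R * (e' + eps1)).
  by rewrite !mulr_ge0 ?powR_ge0 ?(le_trans ler01 B1_1).
have := @decouples_restricted_step R K k chi I hchi hI I1 k0 kq m (n - m) r m0 (n - m0) _ _
  r0 (Xge0 (n - m)%N) Yge0 m00 em0 (dX (n - m)%N) (IH _ lt1).
rewrite em; apply: decouples_restricted_mono.
have nE : n%:R = (n - m0)%N%:R + m0%:R :> R by rewrite -natrD subnK.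
have -> : 2 * B1 * Q `^ (al + be) * Q `^ (n%:R * (e' + eps1)) =
    B1 * Q `^ (al + be) * Q `^ (n%:R * (e' + eps1)) +
    B1 * Q `^ (al + be) * Q `^ (n%:R * (e' + eps1)) by ring.
apply: lerD.
  (* m0 was chosen so that q^(m0 eps1) exceeds 2 k^p: the narrow term shrinks by half. *)
  have half : k%:R ^+ p * 2 <= Q `^ (m0%:R * (e' + eps1)).
    rewrite mulrC; apply: (le_trans hQ0).
    apply: (@le_trans _ _ ((q ^ m0)%:R `^ eps1)).
      by apply: ge0_ler_powR; rewrite ?nnegrE ?ler_nat//; exact: ltW.
    rewrite natrX -/Q pown -powRrM ler_powR// ler_wpM2l//.
    by rewrite lerDr.
  rewrite -/p -/Q nE [(_ + m0%:R) * _]mulrDl (powD (_ * _)).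
  have -> : k%:R ^+ p * (2 * B1 * Q `^ (al + be) * Q `^ ((n - m0)%N%:R * (e' + eps1))) =
     (B1 * Q `^ (al + be) * Q `^ ((n - m0)%N%:R * (e' + eps1))) * (k%:R ^+ p * 2) by ring.
  rewrite [leRHS]mulrA ler_wpM2l//.
  by rewrite !mulr_ge0 ?powR_ge0// (le_trans ler01 B1_1).
(* The factors of the broad term: the cost of the broad-narrow inequality, the
   interactions, the decoupling of the J, the number of the J. *)
have f1 : (q ^ m0)%:R ^+ (4 * k) <= Q `^ (4 * k)%:R * Q0%:R ^+ (4 * k) :> R.
  rewrite -pown -exprMn lerXn2r ?nnegrE ?mulr_ge0//.
  by rewrite -natrM ler_nat -(prednK m00) expnS leq_mul2l hm0' orbT.
have f2 : (interaction_bound K k m n m0)%:R <=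
    Q `^ (n%:R * ((k%:R - 1) / 2)) * Q0%:R ^+ (k * k.-1) :> R.
  rewrite /interaction_bound natrM ler_pM//.
    rewrite -/q -expn_sum natrX -/Q pown ler_powR//.
    have := interaction_exponent mk_ge; rewrite -(ler_nat R) !natrM.
    have <- : k.-1%:R = k%:R - 1 :> R by rewrite -subn1 natrB.
    by rewrite mulrA ler_pdivlMr// mulrC.
  rewrite -expnM natrX -/q; have -> : (m0.-1 * k.-1 * k = m0.-1 * (k * k.-1))%N by rewrite -mulnA [(k.-1 * k)%N]mulnC.
  by rewrite -natrX expnM natrX lerXn2r ?nnegrE// ler_nat.
have f3 : Q `^ ((n - m)%N%:R * e) <= Q `^ (n%:R * ((1 - k%:R^-1) * e)).
  rewrite ler_powR// mulrA ler_wpM2r// natrB// mulrBr mulr1 lerD2l lerN2.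
  by rewrite ler_pdivrMr ?ltr0n// -natrM ler_nat.
have f4 : (q ^ m)%:R ^+ r <= Q `^ (n%:R * (r%:R / k%:R)) * Q `^ r%:R :> R.
  rewrite natrX -exprM -/Q pown -powD ler_powR// natrM.
  have : m%:R <= n%:R / k%:R + 1 :> R.
    rewrite -(ler_pM2r (_ : 0 < k%:R :> R)) ?ltr0n// mulrDl divfK// mul1r -natrM -natrD ler_nat.
    by rewrite (leq_trans mk_le)// leq_add2l leq_pred.
  move=> h; apply: (@le_trans _ _ ((n%:R / k%:R + 1) * r%:R)); first by rewrite ler_wpM2r.
  by rewrite le_eqVlt; apply/orP; left; apply/eqP; field.
apply: (@le_trans _ _ ((Q `^ (4 * k)%:R * Q0%:R ^+ (4 * k)) *
  ((Q `^ (n%:R * ((k%:R - 1) / 2)) * Q0%:R ^+ (k * k.-1)) *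
   (C0 * Q `^ al * Q `^ (n%:R * ((1 - k%:R^-1) * e))) *
   (Q `^ (n%:R * (r%:R / k%:R)) * Q `^ r%:R)))).
  apply: ler_pM => //; rewrite ?exprn_ge0 ?mulr_ge0 ?exprn_ge0 ?powR_ge0//.
  apply: ler_pM => //; rewrite ?exprn_ge0 ?mulr_ge0 ?exprn_ge0 ?powR_ge0//.
  apply: ler_pM => //; rewrite ?exprn_ge0 ?mulr_ge0 ?exprn_ge0 ?powR_ge0//.
  by rewrite ler_wpM2l// mulr_ge0 ?powR_ge0.
have -> : (Q `^ (4 * k)%:R * Q0%:R ^+ (4 * k)) *
  ((Q `^ (n%:R * ((k%:R - 1) / 2)) * Q0%:R ^+ (k * k.-1)) *
   (C0 * Q `^ al * Q `^ (n%:R * ((1 - k%:R^-1) * e))) *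
   (Q `^ (n%:R * (r%:R / k%:R)) * Q `^ r%:R)) =
  (Q0%:R ^+ (4 * k + k * k.-1) * C0) * Q `^ (al + ((4 * k)%:R + r%:R)) * Q `^ (n%:R * e').
  have -> : n%:R * e' = n%:R * ((k%:R - 1) / 2) + n%:R * ((1 - k%:R^-1) * e) + n%:R * (r%:R / k%:R).
    by rewrite /e' /next_exponent; ring.
  by rewrite exprD !powD; ring.
apply: ler_pM; rewrite ?mulr_ge0 ?exprn_ge0 ?powR_ge0//.
  apply: ler_pM; rewrite ?mulr_ge0 ?exprn_ge0 ?powR_ge0//.
    by rewrite /B1 lerDr exprn_ge0.
  by rewrite ler_powR// lerD2l.
by rewrite ler_powR// ler_wpM2l// lerDl ltW.
Qed.

(** The contraction factor 1 - 1/k applied to e + eps leaves a room of eps / k, which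
    is shared by the losses of the restricted bound and of the dyadic levels. *)
Lemma decouples_next (k r : nat) (eps C0 : R) : (2 <= k)%N -> (0 < r)%N ->
  0 < eps -> 0 <= C0 -> exists2 C1 : R, 0 <= C1 &
  forall (K : discreteField) (chi : K -> C) (I : ('rV[K]_k -> R) -> R),
  standard_char chi -> invariant_functional I -> I (@unit_cube R K k) = 1 ->
  (k < resid K)%N -> forall (al e : R), 0 <= al -> 0 <= e ->
  (forall n, decouples chi I n r
     (C0 * (resid K)%:R `^ al * (resid K)%:R `^ (n%:R * (e + eps)))) ->
  forall n, decouples chi I n (r + k)
     (C1 * (resid K)%:R `^ (al + step_loss k r) *
        (resid K)%:R `^ (n%:R * (next_exponent k r e + eps))).
Proof.
move=> k2 r0 eps0 C00; have k0 : (0 < k)%N by apply: ltn_trans k2.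
have kn0 : k%:R != 0 :> R by rewrite pnatr_eq0 -lt0n.
pose eps1 := eps / (2 * k%:R).
have eps10 : 0 < eps1 by rewrite divr_gt0// mulr_gt0// ltr0n.
have [C1 C11 hC1] := restricted_bound k2 r0 eps10 C00.
have C10 : 0 <= C1 by exact: le_trans C11.
pose D := (k * k + r + k)%N.
have D0 : (0 < D)%N by rewrite /D; lia.
have Dn0 : D%:R != 0 :> R by rewrite pnatr_eq0 -lt0n.
have eta0 : 0 < eps1 / D%:R by rewrite divr_gt0// ltr0n.
have [A A0 hA] := poly_le_exp (2 * (r + k)) eta0.
exists (A * (4 ^+ k * C1)); first by rewrite !mulr_ge0// exprn_ge0.
move=> K chi I hchi hI I1 kq al e al0 e0 dX n.
set q := resid K in kq dX *; have q1 : (1 < q)%N := prime_gt1 (resid_prime K).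
pose Q : R := q%:R; have Q1 : 1 <= Q by rewrite ler1n ltnW.
have Q0' : 0 < Q by rewrite ltr0n ltnW.
have Qn0 : Q != 0 by rewrite gt_eqF.
have powD x y : Q `^ (x + y) = Q `^ x * Q `^ y by rewrite powRD// Qn0 implybT.
have ee0 : 0 <= e + eps by rewrite addr_ge0// ltW.
have dR := hC1 K chi I hchi hI I1 kq al (e + eps) al0 ee0 dX n.
set X := _ * _ in dR.
have kR : 2 <= k%:R :> R by rewrite ler_nat.
have ki : 0 <= 1 - k%:R^-1 :> R by rewrite subr_ge0 invf_le1 ?ltr0n// ler1n.
have ge1 x : 0 <= x -> 1 <= Q `^ x.
  by move=> x0; rewrite -(powRr0 Q) ler_powR.
have ne0 : 0 <= next_exponent k r (e + eps).
  rewrite /next_exponent !addr_ge0 ?divr_ge0 ?mulr_ge0//.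
  by rewrite subr_ge0 (le_trans _ kR)// ler1n.
have sl0 : 0 <= step_loss k r.
  rewrite /step_loss addr_ge0// divr_ge0//.
  have -> : k%:R ^+ 2 + 7 * k%:R - 4 = (k%:R - 2) * (k%:R + 9) + 14 :> R by ring.
  by rewrite addr_ge0// mulr_ge0 ?subr_ge0// addr_ge0.
have X1 : 1 <= X.
  rewrite /X -[leLHS]mulr1 ler_pM//.
    by rewrite -[leLHS]mulr1 ler_pM// ge1// addr_ge0.
  by rewrite ge1// mulr_ge0// addr_ge0// ltW.
have X0 : 0 <= X by exact: le_trans X1.
(* t.+1 dyadic levels suffice. *)
pose t := trunc_log 2 ((q ^ n) ^ D).
have NP : (0 < (q ^ n) ^ D)%N by rewrite !expn_gt0 ltnW.
have [tlo thi] : (2 ^ t <= (q ^ n) ^ D)%N /\ ((q ^ n) ^ D < 2 ^ t.+1)%N.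
  by have /andP[] := trunc_log_bounds (isT : (1 < 2)%N) NP.
have Z1 : 1 <= 4 ^+ k * X.
  by rewrite -[leLHS]mulr1 ler_pM// exprn_ege1// ler1n.
have := decouples_of_restricted hchi hI I1 k0 r0 X0 dR (lexx _) Z1 (ltnW thi).
apply: decouples_mono.
apply: (@le_trans _ _ (A * Q `^ (n%:R * eps1) * (4 ^+ k * X))).
  rewrite ler_wpM2r ?mulr_ge0 ?exprn_ge0//; apply: (le_trans (hA t)).
  rewrite ler_wpM2l//.
  have -> : n%:R * eps1 = (n * D)%:R * (eps1 / D%:R) by rewrite natrM; field.
  rewrite powRrM [leRHS]powRrM; apply: ge0_ler_powR; rewrite ?nnegrE ?powR_ge0//; first exact: ltW.
  by rewrite powR_mulrn// powR_mulrn ?(ltW Q0')// /Q -!natrX ler_nat expnM.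
have ne : next_exponent k r e + eps = next_exponent k r (e + eps) + eps1 + eps1.
  by rewrite /next_exponent /eps1; field.
have -> : q%:R `^ (n%:R * (next_exponent k r e + eps)) =
    Q `^ (n%:R * (next_exponent k r (e + eps) + eps1)) * Q `^ (n%:R * eps1).
  by rewrite ne mulrDr powD.
rewrite /X -/q -/Q.
by rewrite le_eqVlt; apply/orP; left; apply/eqP; ring.
Qed.

End ExponentStep.

(** * Iteration of the exponents *)

Section Iteration.
Variable R : realType.
Local Notation C := R[i].

(** The exponent of 1 / delta in the theorem for p = 2r, multiplied by p. *)
Definition decoupling_exponent (k : nat) (c : R) (r : nat) : R :=
  r%:R - k%:R * (k%:R + 1) / 2 + c * (1 - k%:R^-1) `^ (r%:R / k%:R).

Lemma next_decoupling_exponent k c r : (2 <= k)%N ->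
  next_exponent k r (decoupling_exponent k c r) = decoupling_exponent k c (r + k).
Proof.
move=> k2; have k0 : (0 < k)%N by apply: ltn_trans k2.
have kn0 : k%:R != 0 :> R by rewrite pnatr_eq0 -lt0n.
have th0 : 0 < 1 - k%:R^-1 :> R by rewrite subr_gt0 invf_lt1 ?ltr0n// ltr1n.
rewrite /decoupling_exponent.
have -> : (1 - k%:R^-1) `^ ((r + k)%:R / k%:R) = (1 - k%:R^-1) `^ (r%:R / k%:R) * (1 - k%:R^-1) :> R.
  by rewrite natrD mulrDl divff// powRD ?(gt_eqF th0) ?implybT// powRr1// ltW.
rewrite natrD /next_exponent; move: (_ `^ _) => P; by field.
Qed.

Lemma next_exponent_ge0 k r (e : R) : (0 < k)%N -> 0 <= e -> 0 <= next_exponent k r e.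
Proof.
move=> k0 e0; rewrite /next_exponent !addr_ge0 ?divr_ge0 ?mulr_ge0//.
  by rewrite subr_ge0 ler1n.
by rewrite subr_ge0 invf_le1 ?ltr0n// ler1n.
Qed.

(** The constant depends on k, r0, eps, C0 and j only: it is chosen before the field,
    the character, the measure and c. *)
Lemma decouples_iterate (k r0 : nat) (eps C0 : R) (j : nat) : (2 <= k)%N -> (0 < r0)%N ->
  0 < eps -> 0 <= C0 -> exists2 C1 : R, 0 <= C1 &
  forall (K : discreteField) (chi : K -> C) (I : ('rV[K]_k -> R) -> R),
  standard_char chi -> invariant_functional I -> I (@unit_cube R K k) = 1 ->
  (k < resid K)%N -> forall c : R, 0 <= decoupling_exponent k c r0 ->
  (forall n, decouples chi I n r0
     (C0 * (resid K)%:R `^ (n%:R * (decoupling_exponent k c r0 + eps)))) ->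
  forall n, decouples chi I n (r0 + k * j)
     (C1 * (resid K)%:R `^ (a_exponent k (2 * (r0 + k * j))%:R (2 * r0)%:R) *
        (resid K)%:R `^ (n%:R * (decoupling_exponent k c (r0 + k * j) + eps))).
Proof.
move=> k2 r00 eps0 C00; have k0 : (0 < k)%N by apply: ltn_trans k2.
have kn0 : k%:R != 0 :> R by rewrite pnatr_eq0 -lt0n.
have aE i : a_exponent k (2 * (r0 + k * i))%:R (2 * r0)%:R =
    i%:R * (r0%:R + (k%:R ^+ 2 + 7 * k%:R - 4) / 2) + k%:R / 2 * i%:R * (i%:R + 1) :> R.
  rewrite /a_exponent.
  have -> : ((2 * (r0 + k * i))%:R - (2 * r0)%:R) / (2 * k%:R) = i%:R :> R.
    by rewrite !natrM natrD natrM; field.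
  by rewrite natrM; field.
have a0 i : 0 <= a_exponent k (2 * (r0 + k * i))%:R (2 * r0)%:R :> R.
  rewrite aE addr_ge0 ?mulr_ge0 ?addr_ge0 ?divr_ge0//.
  have -> : k%:R ^+ 2 + 7 * k%:R - 4 = (k%:R - 2) * (k%:R + 9) + 14 :> R by ring.
  by rewrite addr_ge0// mulr_ge0 ?subr_ge0 ?addr_ge0// ler_nat.
have e_ge0 c i : 0 <= decoupling_exponent k c r0 -> 0 <= decoupling_exponent k c (r0 + k * i).
  move=> e0; elim: i => [|i IH]; first by rewrite muln0 addn0.
  by rewrite mulnSr addnA -next_decoupling_exponent// next_exponent_ge0.
elim: j => [|j [C1 C10 IH]].
  exists C0 => // K chi I hchi hI I1 kq c e0 dX n; rewrite muln0 addn0.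
  have -> : a_exponent k (2 * r0)%:R (2 * r0)%:R = 0 :> R.
    by have := aE 0%N; rewrite muln0 addn0 => ->; rewrite !mulr0 !mul0r addr0.
  by rewrite powRr0 mulr1.
have rj0 : (0 < r0 + k * j)%N by rewrite addn_gt0 r00.
have [C2 C20 hC2] := decouples_next k2 rj0 eps0 C10.
exists C2 => // K chi I hchi hI I1 kq c e0 dX n.
have := hC2 K chi I hchi hI I1 kq _ _ (a0 j) (e_ge0 c j e0)
  (IH K chi I hchi hI I1 kq c e0 dX) n.
rewrite next_decoupling_exponent// mulnSr addnA.
suff -> : a_exponent k (2 * (r0 + k * j))%:R (2 * r0)%:R + step_loss R k (r0 + k * j) =
  a_exponent k (2 * (r0 + k * j + k))%:R (2 * r0)%:R by [].
have -> : (r0 + k * j + k = r0 + k * j.+1)%N by rewrite mulnSr addnA.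
by rewrite !aE /step_loss -addnA -mulnSr natrD natrM -natr1; field.
Qed.

End Iteration.

(** * The Fourier transform of Schwartz functions *)

Section FourierSide.
Variables (R : realType) (K : discreteField) (k : nat).
Local Notation pt := 'rV[K]_k.
Local Notation q := (resid K).
Local Notation w := (unif K).
Local Notation O := (@valring K).
Local Notation C := R[i].
Local Notation Re := complex.Re.
Local Notation Im := complex.Im.
Implicit Types (x y t xi : pt).

Variables (chi : K -> C) (I : (pt -> R) -> R).
Hypotheses (hchi : standard_char chi) (hI : invariant_functional I)
  (I1 : I (@unit_cube R K k) = 1).
Hypotheses (k_gt0 : (0 < k)%N) (kq : (k < q)%N).

Let q_gt0 : (0 < q)%N := prime_gt0 (resid_prime K).
Let w0 : w != 0 := unif_neq0 K.

Definition dotk x xi : K := \sum_i x 0 i * xi 0 i.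

Lemma dotkDl x y xi : dotk (x + y) xi = dotk x xi + dotk y xi.
Proof. by rewrite -big_split/=; apply: eq_bigr => i _; rewrite mxE mulrDl. Qed.

Lemma dotkDr x xi eta : dotk x (xi + eta) = dotk x xi + dotk x eta.
Proof. by rewrite -big_split/=; apply: eq_bigr => i _; rewrite mxE mulrDr. Qed.

Lemma dotkZl (c : K) x xi : dotk (c *: x) xi = c * dotk x xi.
Proof. by rewrite mulr_sumr; apply: eq_bigr => i _; rewrite mxE mulrA. Qed.

Lemma dotkZr (c : K) x xi : dotk x (c *: xi) = c * dotk x xi.
Proof. by rewrite mulr_sumr; apply: eq_bigr => i _; rewrite mxE mulrCA. Qed.

Lemma dotk_suml (J : Type) (s : seq J) (P : pred J) (F : J -> pt) xi :
  dotk (\sum_(j <- s | P j) F j) xi = \sum_(j <- s | P j) dotk (F j) xi.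
Proof.
apply: (big_morph (dotk^~ xi)); first by move=> x y; exact: dotkDl.
by rewrite /dotk big1// => i _; rewrite mxE mul0r.
Qed.

Lemma dotk_sumr (J : Type) (s : seq J) (P : pred J) (F : J -> pt) x :
  dotk x (\sum_(j <- s | P j) F j) = \sum_(j <- s | P j) dotk x (F j).
Proof.
apply: (big_morph (dotk x)); first by move=> y z; exact: dotkDr.
by rewrite /dotk big1// => i _; rewrite mxE mulr0.
Qed.

Lemma dotkNl x xi : dotk (- x) xi = - dotk x xi.
Proof. by rewrite -scaleN1r dotkZl mulN1r. Qed.

Lemma dotk_delta i xi : dotk (delta_mx 0 i) xi = xi 0 i.
Proof.
rewrite /dotk (bigD1 i)//= mxE !eqxx mul1r big1 ?addr0// => j ji.
by rewrite mxE eqxx (negPf ji) mul0r.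
Qed.

Definition cint (G : pt -> C) : C := (I (fun x => Re (G x)) +i* I (fun x => Im (G x)))%C.

Lemma Sch_Re (G : pt -> C) : Sch G -> Sch (fun x => Re (G x)).
Proof. exact: (Sch_comp (F := fun z : C => Re z)). Qed.

Lemma Sch_Im (G : pt -> C) : Sch G -> Sch (fun x => Im (G x)).
Proof. exact: (Sch_comp (F := fun z : C => Im z)). Qed.

Lemma cint_shift (G : pt -> C) t : Sch G -> cint (fun x => G (x + t)) = cint G.
Proof.
move=> SG; rewrite /cint; congr (_ +i* _)%C.
  exact: (inv_fun_shift hI t (Sch_Re SG)).
exact: (inv_fun_shift hI t (Sch_Im SG)).
Qed.

Lemma cintD (G H : pt -> C) : Sch G -> Sch H -> cint (fun x => G x + H x) = cint G + cint H.
Proof.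
move=> SG SH; rewrite /cint; apply/eqP; rewrite eq_complex /=.
rewrite -(inv_funD hI (Sch_Re SG) (Sch_Re SH)) -(inv_funD hI (Sch_Im SG) (Sch_Im SH)).
by apply/andP; split; apply/eqP; congr I; apply/funext => x; rewrite raddfD.
Qed.

Lemma cintZ (c : C) (G : pt -> C) : Sch G -> cint (fun x => c * G x) = c * cint G.
Proof.
move=> SG; have SR v := Sch_comp (F := fun u : R => v * u) (mulr0 v) (Sch_Re SG).
have SI v := Sch_comp (F := fun u : R => v * u) (mulr0 v) (Sch_Im SG).
rewrite /cint; case: c => a b; apply/eqP; rewrite eq_complex /=; apply/andP; split; apply/eqP.
  rewrite -(inv_funZ hI _ (Sch_Re SG)) -(inv_funZ hI _ (Sch_Im SG)) -mulN1r.
  rewrite -(inv_funZ hI _ (SI b)) -(inv_funD hI) //; last first.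
    by apply: (Sch_comp (F := fun u : R => -1 * u)) => //; rewrite mulr0.
  by congr I; apply/funext => x; case: (G x) => u v /=; rewrite mulN1r.
rewrite -(inv_funZ hI _ (Sch_Re SG)) -(inv_funZ hI _ (Sch_Im SG)) -(inv_funD hI) //.
by congr I; apply/funext => x; case: (G x) => u v /=.
Qed.

Lemma cint_sum (J : Type) (s : seq J) (P : pred J) (F : J -> pt -> C) :
  (forall j, P j -> Sch (F j)) ->
  cint (fun x => \sum_(j <- s | P j) F j x) = \sum_(j <- s | P j) cint (F j).
Proof.
move=> SF; elim: s => [|j s IH].
  rewrite big_nil /cint; apply/eqP; rewrite eq_complex /=.
  by apply/andP; split; apply/eqP; rewrite -[RHS](inv_fun0 hI); congr I; apply/funext => x;
    rewrite big_nil.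
rewrite big_cons -IH; case: (boolP (P j)) => Pj.
  rewrite -cintD//; [|exact: SF|exact: Sch_sum].
  by congr cint; apply/funext => x; rewrite big_cons Pj.
by congr cint; apply/funext => x; rewrite big_cons (negPf Pj).
Qed.

Definition ft (f : pt -> C) xi : C := cint (fun x => f x * chi (- dotk x xi)).

Lemma locconst_char xi : locconst (fun x => chi (- dotk x xi)).
Proof.
have [N /qballP hN] := qball_exists xi; exists N => x t /qballP ht.
rewrite dotkDl opprD (std_charD hchi); suff /eqP -> : chi (- dotk t xi) == 1 by rewrite mulr1.
rewrite (std_char_ker hchi) rpredN rpred_sum// => i _.
have -> : t 0 i * xi 0 i = (w ^ (- N%:Z) * t 0 i) * (w ^ N%:Z * xi 0 i).
  by rewrite mulrACA -expfzDr// addNr expr0z mul1r.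
by apply: rpredM; [exact: ht|exact: hN].
Qed.

Lemma Sch_ft (f : pt -> C) xi : Sch f -> Sch (fun x => f x * chi (- dotk x xi)).
Proof. by move=> Sf; apply: (Sch_lc (fun v => mul0r v) Sf); exact: locconst_char. Qed.

Lemma ft_shift (f : pt -> C) t xi : Sch f ->
  ft (fun x => f (x + t)) xi = chi (dotk t xi) * ft f xi.
Proof.
move=> Sf; rewrite /ft -(cint_shift t (Sch_ft xi Sf)) -cintZ; last exact: Sch_shift (Sch_ft xi Sf).
congr cint; apply/funext => x; rewrite dotkDl opprD (std_charD hchi) mulrCA; congr (_ * _).
by rewrite mulrCA -(std_charD hchi) subrr (std_char0 hchi) mulr1.
Qed.

Lemma ft_sum (J : Type) (s : seq J) (P : pred J) (F : J -> pt -> C) xi :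
  (forall j, P j -> Sch (F j)) ->
  ft (fun x => \sum_(j <- s | P j) F j x) xi = \sum_(j <- s | P j) ft (F j) xi.
Proof.
move=> SF; rewrite /ft -cint_sum; last by move=> j Pj; exact: Sch_ft (SF j Pj).
by congr cint; apply/funext => x; rewrite mulr_suml.
Qed.

Lemma ftZ (c : C) (f : pt -> C) xi : Sch f -> ft (fun x => c * f x) xi = c * ft f xi.
Proof.
move=> Sf; rewrite /ft -cintZ; last exact: Sch_ft.
by congr cint; apply/funext => x; rewrite mulrA.
Qed.

Lemma SchZ (c : C) (f : pt -> C) : Sch f -> Sch (fun x => c * f x).
Proof. by apply: (Sch_comp (F := fun z : C => c * z)); rewrite mulr0. Qed.

Lemma SchB (f g : pt -> C) : Sch f -> Sch g -> Sch (fun x => f x - g x).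
Proof. exact: (Sch_comp2 (F := fun z v : C => z - v) (subr0 0)). Qed.

Lemma ftB (f g : pt -> C) xi : Sch f -> Sch g -> ft (fun x => f x - g x) xi = ft f xi - ft g xi.
Proof.
move=> Sf Sg; rewrite -mulN1r -(ftZ _ _ Sg) /ft -cintD; [|exact: Sch_ft|exact/Sch_ft/SchZ].
by congr cint; apply/funext => x; rewrite mulN1r mulrBl mulNr.
Qed.

(** Orthogonality of the characters of the cyclic group w^-d O / O. *)
Lemma char_geometric_sum (y : K) (d : nat) : w ^+ d * y \in O ->
  \sum_(l < q ^ d) chi (l%:R * y) = if y \in O then (q ^ d)%:R else 0.
Proof.
move=> wy; have chiX (l : nat) : chi (l%:R * y) = chi y ^+ l.
  elim: l => [|l IH]; first by rewrite mul0r expr0 (std_char0 hchi).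
  by rewrite -natr1 mulrDl mul1r (std_charD hchi) IH exprSr.
rewrite (eq_bigr (fun l : 'I_(q ^ d) => chi y ^+ l)) => [|l _]; last exact: chiX.
case: ifP => [|yO].
  rewrite -(std_char_ker hchi) => /eqP ->; under eq_bigr => l _ do rewrite expr1n.
  by rewrite sumr_const card_ord.
have chi1 : chi y != 1 by rewrite (std_char_ker hchi) yO.
apply/eqP; have /eqP : (chi y - 1) * \sum_(l < q ^ d) chi y ^+ l = 0.
  rewrite -subrX1; apply/eqP; rewrite subr_eq0 -chiX (std_char_ker hchi) natrX.
  by rewrite -(unifE K).
by rewrite mulf_eq0 subr_eq0 (negPf chi1).
Qed.

(** Summing chi(x0.xi) times the Fourier transform over a fine enough finite grid
    of frequencies xi isolates the integral of f over a small ball around x0, on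
    which f is constant. *)
Lemma ft_injective (f : pt -> C) : Sch f -> (forall xi, ft f xi = 0) -> forall x, f x = 0.
Proof.
move=> Sf f0 x0; have [N1 [fc1 fs1]] := Sch_stage Sf; have [N2 hN2] := qball_exists x0.
pose N := (N1 + N2)%N.
have fc x t : qball (- N%:Z) t -> f (x + t) = f x.
  by move=> h; apply: fc1; apply: (qball_mono _ h); rewrite /N; lia.
have fs x : f x != 0 -> qball N (x0 - x).
  move=> /fs1 h; apply: qballB; [apply: (qball_mono _ hN2)|apply: (qball_mono _ h)];
    rewrite /N; lia.
pose J := {ffun 'I_k -> 'I_(q ^ (N + N))}.
pose xi (l : J) : pt := \row_i (w ^ (- N%:Z) * (l i)%:R).
have char_sum y : qball N y -> \sum_(l : J) chi (dotk y (xi l)) =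
    if qball (- N%:Z) y then ((q ^ (N + N)) ^ k)%:R else 0.
  move=> /qballP yN.
  have term l : chi (dotk y (xi l)) = \prod_i chi ((l i)%:R * (w ^ (- N%:Z) * y 0 i)).
    rewrite /dotk (big_morph chi (std_charD hchi) (std_char0 hchi)); apply: eq_bigr => i _.
    by rewrite mxE; congr chi; rewrite mulrCA mulrA mulrC mulrCA.
  rewrite (eq_bigr _ (fun l _ => term l)).
  have -> : \sum_(l : J) \prod_i chi ((l i)%:R * (w ^ (- N%:Z) * y 0 i)) =
      \prod_i \sum_(c < q ^ (N + N)) chi (c%:R * (w ^ (- N%:Z) * y 0 i)).
    by rewrite bigA_distr_bigA.
  have wy i : w ^+ (N + N) * (w ^ (- N%:Z) * y 0 i) \in O.
    rewrite exprnP mulrA -expfzDr//; have -> : (N + N)%N%:Z + - N%:Z = N%:Z by lia.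
    exact: yN.
  case: (boolP (qball _ y)) => [/qballP yb|].
    rewrite (eq_bigr (fun=> (q ^ (N + N))%:R)) => [|i _]; last first.
      by rewrite char_geometric_sum// yb.
    by rewrite prodr_const card_ord [RHS]natrX.
  rewrite negb_forall => /existsP[i yi]; apply/eqP; rewrite prodf_seq_eq0; apply/hasP.
  by exists i; rewrite ?mem_index_enum//= char_geometric_sum// (negPf yi).
have Sball : Sch (fun x => (qball (- N%:Z) (x - x0))%:R : R) by exact: Sch_ball.
have key : \sum_(l : J) chi (dotk x0 (xi l)) * ft f (xi l) =
    ((q ^ (N + N)) ^ k)%:R * (f x0 * cint (fun x => (qball (- N%:Z) (x - x0))%:R)).
  rewrite -cintZ; last exact: Sch_ball.
  rewrite -cintZ; last exact/SchZ/Sch_ball.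
  rewrite (eq_bigr (fun l : J => cint (fun x => chi (dotk x0 (xi l)) *
    (f x * chi (- dotk x (xi l)))))) => [|l _]; last by rewrite cintZ//; exact: Sch_ft.
  rewrite -cint_sum; last by move=> l _; exact/SchZ/Sch_ft.
  congr cint; apply/funext => x.
  under eq_bigr => l _ do rewrite mulrCA -(std_charD hchi) -dotkNl -dotkDl.
  rewrite -mulr_sumr; have [fx|/fs xb] := eqVneq (f x) 0.
    rewrite fx mul0r; case: (boolP (qball _ _)) => [h|_]; last by rewrite !mulr0.
    by have := fc x0 _ h; rewrite addrC subrK fx => <-; rewrite mul0r mulr0.
  rewrite char_sum// -[qball _ (x0 - x)]qballN opprB.
  case: (boolP (qball _ _)) => [h|_]; last by rewrite !mulr0.
  by rewrite mulr1 mulrC; congr (_ * _); have := fc x0 _ h; rewrite addrC subrK.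
move: key; rewrite big1 => [/esym/eqP|l _]; last by rewrite f0 mulr0.
rewrite !mulf_eq0 pnatr_eq0 -!expnM expn_eq0 gtn_eqF//= => /orP[/eqP//|].
rewrite /cint eq_complex /= => /andP[/eqP h _].
have := @haar_gt0 R K k I hI I1 (fun x => (qball (- N%:Z) (x - x0))%:R) x0 Sball.
rewrite subrr qball0 ltr01 => /(_ (fun _ => ler0n _ _) isT).
rewrite (_ : (fun x => _) = fun x => Re ((qball (- N%:Z) (x - x0))%:R : C)) ?h ?ltxx//.
by apply/funext => x; case: qball.
Qed.

Lemma ft_inj2 (f g : pt -> C) : Sch f -> Sch g -> (forall xi, ft f xi = ft g xi) -> f = g.
Proof.
move=> Sf Sg fg; apply/funext => x; apply/eqP; rewrite -subr_eq0; apply/eqP.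
apply: (ft_injective (f := fun x => f x - g x)); first exact: SchB.
by move=> xi; rewrite ftB// fg subrr.
Qed.

Definition curve (a : K) : pt := \row_(i < k) a ^+ i.+1.
Definition curve_deriv (j : nat) (a : K) : pt := \row_(i < k) ('X^(i.+1) : {poly K})^`(j).[a].

(** The anisotropic neighbourhood theta of the arc over a + w^n O. *)
Definition theta_set (a : K) (n : nat) xi : Prop :=
  exists2 a' : K, (a' - a) / w ^+ n \in O & exists2 s : 'I_k -> K,
    (forall j, s j / w ^+ (n * j.+1) \in O) &
    xi = curve a' + \sum_j s j *: curve_deriv j.+1 a'.

Lemma dotk_curve t (a : K) : dotk t (curve a) = (ppoly t).[a].
Proof.
rewrite /dotk /ppoly horner_sum; apply: eq_bigr => i _.
by rewrite mxE hornerZ hornerXn.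
Qed.

Lemma dotk_curve_deriv t (a : K) j : dotk t (curve_deriv j a) = (ppoly t)^`(j).[a].
Proof.
rewrite /dotk /ppoly linear_sum/= horner_sum; apply: eq_bigr => i _.
by rewrite mxE linearZ/= hornerZ.
Qed.

Lemma Tset_recenter (a a' : K) (n : nat) t : (a' - a) / w ^+ n \in O ->
  Tset a n t -> Tset a' n t.
Proof.
move=> aa tT i; set b := (a' - a) / w ^+ n in aa.
have wn0 : w ^+ n != 0 by rewrite expf_neq0.
pose r := ppoly t \Po (a%:P + w ^+ n *: 'X).
have -> : ppoly t \Po (a'%:P + w ^+ n *: 'X) = (r - (r`_0)%:P) \Po (b%:P + 'X) + (r`_0)%:P.
  rewrite comp_polyB comp_polyC subrK -comp_polyA; congr (_ \Po _).
  rewrite comp_polyD comp_polyC comp_polyZ comp_polyX scalerDr addrA; congr (_ + _).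
  rewrite -mul_polyC -polyCM -polyCD; congr (_%:P).
  by rewrite /b mulrC divfK// addrC subrK.
rewrite coefD coefC addr0.
have rO : r - (r`_0)%:P \is a polyOver O.
  apply/polyOverP => -[|j]; first by rewrite coefB coefC /= subrr rpred0.
  by rewrite coefB coefC /= subr0; exact: tT.
suff /polyOverP : (r - (r`_0)%:P) \Po (b%:P + 'X) \is a polyOver O by apply.
by apply: polyOver_comp => //; rewrite rpredD ?polyOverC ?polyOverX.
Qed.

(** The coefficients of P_t(a' + w^n Y) are w^(nj) P_t^(j)(a') / j!, and pairing t
    with the point of theta having coefficients s gives P_t(a') plus the sum of
    the s_j P_t^(j)(a'). *)
Lemma theta_pairing (a : K) (n : nat) xi t : theta_set a n xi -> Tset a n t ->
  dotk t xi - (ppoly t).[a] \in O.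
Proof.
move=> [a' aa [s sO ->]] tT; have wn0 : w ^+ n != 0 by rewrite expf_neq0.
rewrite dotkDr dotk_curve addrAC rpredD//.
  have -> : a' = a + w ^+ n * ((a' - a) / w ^+ n) by rewrite mulrC divfK// addrC subrK.
  exact: Tset_horner.
rewrite dotk_sumr rpred_sum// => j _; rewrite dotkZr dotk_curve_deriv.
have := Tset_recenter aa tT j; rewrite coef_comp_affine -exprM => h.
rewrite nderivn_def hornerMn mulrnAr -mulr_natr rpredM ?rpred_nat//.
have -> : s j * (ppoly t)^`N(j.+1).[a'] =
    (s j / w ^+ (n * j.+1)) * (w ^+ (n * j.+1) * (ppoly t)^`N(j.+1).[a']).
  by rewrite mulrA divfK// expf_neq0.
by apply: rpredM => //; exact: sO.
Qed.

(** This is where Taylor coefficients and derivatives become interchangeable: j! is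
    prime to q for j <= k < q. *)
Lemma fact_unit (j : nat) : (j <= k)%N -> exists2 v : K, v \in O & v * j`!%:R = 1.
Proof.
move=> jk; have qj : ~~ (q %| j`!)%N.
  elim: j jk => [|j IH] jk; first by rewrite fact0 Euclid_dvd1 ?resid_prime.
  rewrite factS Euclid_dvdM ?resid_prime// negb_or IH ?(ltnW jk)// andbT.
  by apply/negP => /dvdn_leq; rewrite ltnS => /(_ isT); lia.
have j0 : (j`!%:R : K) != 0.
  apply: contraNneq qj => j0; have := valring_intV K j`! 1.
  by rewrite expn1 dvdzE /= => <-; rewrite -pmulrn j0 mul0r rpred0.
have cop : coprime j`! q by rewrite coprime_sym prime_coprime ?resid_prime.
have [u u' uu _] := egcdnP q (fact_gt0 j).
have [N hN] := valring_bounded (j`!%:R^-1 : K).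
exists (j`!%:R^-1); last by rewrite mulVf.
elim: N hN => [|N IH] hN; first by move: hN; rewrite expr0 mul1r.
apply: IH; set v := j`!%:R^-1 in hN *.
have e : u%:R * j`!%:R = u'%:R * w + 1 :> K.
  by rewrite -natrM uu (eqP cop) natrD natrM (unifE K).
have vE : v = u%:R - u'%:R * (w * v).
  have -> : u%:R = (u'%:R * w + 1) * v by rewrite -e /v mulfK.
  by rewrite mulrDl mul1r mulrA addrAC subrr add0r.
have : w ^+ N * v = w ^+ N * u%:R - u'%:R * (w ^+ N.+1 * v).
  by rewrite {1}vE mulrBr; congr (_ - _); rewrite mulrCA exprSr -mulrA.
move=> ->; apply: rpredB; first by rewrite rpredM ?rpred_nat// rpredX// unifO.
by rewrite rpredM ?rpred_nat.
Qed.

Lemma row_of_sum (J : Type) (s : seq J) (P : pred J) (c : J -> K) (F : J -> {poly K}) :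
  row_of k (\sum_(j <- s | P j) c j *: F j) = \sum_(j <- s | P j) c j *: row_of k (F j).
Proof.
rewrite raddf_sum; apply: eq_bigr => j _.
by apply/rowP => i; rewrite !mxE coefZ.
Qed.

(** Duality of lattices: expand xi - gamma(a) in the basis of the derivatives of the
    curve at a. Its coefficients are the pairings with the coefficient vectors of
    (X - a)^j, divided by j!, and w^(-nj) (X - a)^j is in the lattice Tset a n. *)
Lemma theta_of_pairing (a : K) (n : nat) xi :
  (forall t, Tset a n t -> dotk t xi - (ppoly t).[a] \in O) -> theta_set a n xi.
Proof.
move=> h; pose eta := xi - curve a.
have hE t : dotk t xi - (ppoly t).[a] = dotk t eta.
  by rewrite /eta dotkDr -scaleN1r dotkZr mulN1r dotk_curve.
pose mono j : pt := row_of k (('X - a%:P) ^+ j.+1).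
pose s' j := dotk (mono j) eta.
have s'O (j : 'I_k) : s' j / w ^+ (n * j.+1) \in O.
  have wj0 : w ^+ (n * j.+1) != 0 by rewrite expf_neq0.
  rewrite mulrC -dotkZl -hE; apply: h => i.
  have -> : (w ^+ (n * j.+1))^-1 *: mono j = row_of k ((w ^+ (n * j.+1))^-1 *: ('X - a%:P) ^+ j.+1).
    by apply/rowP => l; rewrite !mxE coefZ.
  rewrite ppoly_row_of; last first.
    by rewrite (leq_trans (size_scale_leq _ _))// size_exp_XsubC ltnS ltn_ord.
  rewrite comp_polyB comp_polyC coefB coefC subr0 comp_polyZ coefZ.
  have -> : (('X - a%:P : {poly K}) ^+ j.+1) \Po (a%:P + w ^+ n *: 'X) =
      w ^+ (n * j.+1) *: 'X^(j.+1).
    by rewrite rmorphXn/= comp_polyB comp_polyX comp_polyC addrAC subrr add0r exprZn exprM.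
  by rewrite coefZ mulrA mulVf// mul1r coefXn rpred_nat.
have expand t : dotk t eta = \sum_(j < k) s' j * (ppoly t)^`N(j.+1).[a].
  pose r := ppoly t \Po (a%:P + 1 *: 'X).
  have sr : (size r <= k.+1)%N by rewrite size_affine_comp ?oner_eq0// size_ppoly.
  have pE : ppoly t = \sum_(j < k.+1) r`_j *: ('X - a%:P) ^+ j.
    have -> : ppoly t = r \Po ('X - a%:P).
      rewrite /r -comp_polyA comp_polyD comp_polyC comp_polyZ comp_polyX scale1r.
      by rewrite addrC subrK comp_polyXr.
    rewrite comp_polyE (big_ord_widen _ (fun j => r`_j *: ('X - a%:P) ^+ j) sr) big_mkcond/=.
    by apply: eq_bigr => j _; case: ltnP => // /(nth_default 0) ->; rewrite scale0r.
  have tE : t = \sum_(j < k) r`_j.+1 *: mono j.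
    rewrite -[LHS]row_of_ppoly pE row_of_sum big_ord_recl /= expr0.
    have -> : row_of k (1 : {poly K}) = 0 by apply/rowP => i; rewrite !mxE coef1.
    by rewrite scaler0 add0r.
  rewrite {1}tE dotk_suml; apply: eq_bigr => j _; rewrite dotkZl mulrC; congr (_ * _).
  by rewrite /r coef_comp_affine expr1n mul1r.
have /choice[v hv] (j : 'I_k) : exists v : K, v \in O /\ v * (j.+1)`!%:R = 1.
  by have [v vO vE] := fact_unit (ltn_ord j); exists v.
exists a; first by rewrite subrr mul0r rpred0.
exists (fun j : 'I_k => s' j * v j) => [j|].
  by rewrite mulrAC rpredM//; have [] := hv j.
suff -> : \sum_(j < k) (s' j * v j) *: curve_deriv j.+1 a = eta by rewrite /eta addrC subrK.
apply/rowP => i; rewrite -!dotk_delta expand dotk_sumr; apply: eq_bigr => j _.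
rewrite dotkZr dotk_curve_deriv nderivn_def hornerMn -mulr_natr mulrACA.
have [_ vE] := hv j; by rewrite vE mulr1.
Qed.

Lemma ft_equivariant (a : nat) (n : nat) (f : pt -> C) xi : wave chi n a f ->
  ft f xi != 0 -> theta_set a%:R n xi.
Proof.
move=> [Sf ef] f0; apply: theta_of_pairing => t tT.
rewrite -(std_char_ker hchi) (std_charD hchi).
have : chi (dotk t xi) * ft f xi = chi (ppoly t).[a%:R] * ft f xi.
  rewrite -ft_shift// -ftZ//; congr (ft _ xi); apply/funext => x; exact: ef.
move/(mulIf f0) => ->; rewrite -(std_charD hchi) subrr (std_char0 hchi) eqxx.
by [].
Qed.

(** Translation by t multiplies the Fourier transform at xi by chi(t.xi), which is
    chi(P_t(a)) for all xi in theta; conclude by injectivity. *)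
Lemma equivariant_of_ft (a : nat) (n : nat) (f : pt -> C) : Sch f ->
  (forall xi, ft f xi != 0 -> theta_set a%:R n xi) -> wave chi n a f.
Proof.
move=> Sf fth; split => // x t tT.
suff h : (fun x => f (x + t)) = fun x => chi (ppoly t).[a%:R] * f x by exact: (congr1 (fun F => F x) h).
apply: ft_inj2; [exact: Sch_shift|exact: SchZ|move=> xi].
rewrite ft_shift// ftZ//; have [->|f0] := eqVneq (ft f xi) 0; first by rewrite !mulr0.
congr (_ * _); have := theta_pairing (fth xi f0) tT.
rewrite -(std_char_ker hchi) => /eqP h.
by rewrite -[in LHS](subrK (ppoly t).[a%:R] (dotk t xi)) (std_charD hchi) h mul1r.
Qed.

Local Notation i0 := (Ordinal k_gt0).

Definition in_strip (a n : nat) xi : bool := (xi 0 i0 - a%:R) / w ^+ n \in O.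

Lemma theta_in_strip (a n : nat) xi : theta_set a%:R n xi -> in_strip a n xi.
Proof.
have wn0 : w ^+ n != 0 by rewrite expf_neq0.
move=> h; have tT : Tset a%:R n ((w ^+ n)^-1 *: delta_mx 0 i0 : pt).
  have -> : (w ^+ n)^-1 *: delta_mx 0 i0 = row_of k ((w ^+ n)^-1 *: 'X : {poly K}).
    by apply/rowP => i; rewrite !mxE coefZ coefX eqxx.
  move=> i; rewrite ppoly_row_of; last first.
    by rewrite (leq_trans (size_scale_leq _ _))// size_polyX ltnS.
  rewrite coefZ coefX mulr0 subr0 comp_polyZ comp_polyX scalerDr scalerA mulVf// scale1r.
  by rewrite coefD coefZ coefC mulr0 add0r coefX rpred_nat.
have := theta_pairing h tT; rewrite -dotk_curve !dotkZl !dotk_delta -mulrBr mulrC.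
by rewrite mxE expr1.
Qed.

Lemma strip_disjoint (a a' n : nat) xi : (a < q ^ n)%N -> (a' < q ^ n)%N ->
  in_strip a n xi -> in_strip a' n xi -> a = a'.
Proof. exact: residue_unique. Qed.

(** The projection is an average over a finite cyclic group of translations in the
    first coordinate, weighted by characters. The group is as large as the
    frequencies of f require. *)
Lemma strip_projection (a n : nat) (f : pt -> C) : Sch f -> exists2 g : pt -> C, Sch g &
  forall xi, ft g xi = ft f xi * (in_strip a n xi)%:R.
Proof.
move=> Sf; have [N [fc _]] := Sch_stage Sf; pose d := (N + n)%N.
pose e l : pt := - ((l%:R / w ^+ n) *: delta_mx 0 i0).
pose ph (l : nat) : C := (q ^ d)%:R^-1 * chi (l%:R * (a%:R / w ^+ n)).
exists (fun x => \sum_(l < q ^ d) ph l * f (x + e l)).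
  by apply: Sch_sum => l _; apply: SchZ; exact: Sch_shift.
move=> xi; rewrite ft_sum; last by move=> l _; apply: SchZ; exact: Sch_shift.
have term (l : 'I_(q ^ d)) : ft (fun x => ph l * f (x + e l)) xi =
    ft f xi * (q ^ d)%:R^-1 * chi (l%:R * ((a%:R - xi 0 i0) / w ^+ n)).
  rewrite ftZ; last exact: Sch_shift.
  rewrite ft_shift// /e dotkNl dotkZl dotk_delta /ph mulrA mulrC -!mulrA; congr (_ * (_ * _)).
  by rewrite -(std_charD hchi); congr chi; rewrite mulrBl mulrBr [_ * xi 0 i0]mulrC.
rewrite (eq_bigr _ (fun l _ => term l)) -mulr_sumr.
have [->|f0] := eqVneq (ft f xi) 0; first by rewrite !mul0r.
have wxi : w ^+ N * xi 0 i0 \in O.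
  pose t : pt := w ^+ N *: delta_mx 0 i0.
  have tb : qball (- N%:Z) t.
    apply/qballP => i; rewrite !mxE mulrA exprnP -expfzDr// addNr expr0z mul1r.
    exact: rpred_nat.
  have : chi (dotk t xi) * ft f xi = ft f xi.
    by rewrite -ft_shift//; congr (ft _ xi); apply/funext => x; exact: fc.
  rewrite -[X in _ = X]mul1r => /(mulIf f0)/eqP.
  by rewrite (std_char_ker hchi) dotkZl dotk_delta.
have wn0 : w ^+ n != 0 by rewrite expf_neq0.
rewrite char_geometric_sum; last first.
  rewrite /d exprD -mulrA [w ^+ n * _]mulrC divfK// mulrBr rpredB//.
  by rewrite rpredM ?rpred_nat// rpredX// unifO.
have -> : ((a%:R - xi 0 i0) / w ^+ n \in O) = in_strip a n xi.
  by rewrite /in_strip -opprB mulNr rpredN.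
case: in_strip; rewrite ?mulr0 ?mulr1// mulfVK// pnatr_eq0 expn_eq0 gtn_eqF//.
Qed.

(** Theta lies over the strip of its interval and the strips are disjoint, so
    cutting the Fourier transform of f along the strips yields waves. *)
Lemma ft_decomposition (n : nat) (f : pt -> C) (F : nat -> pt -> C) : Sch f ->
  (forall xi, ft f xi != 0 -> exists2 a, (a < q ^ n)%N & theta_set a%:R n xi) ->
  (forall a, (a < q ^ n)%N -> Sch (F a)) ->
  (forall a, (a < q ^ n)%N -> forall xi, ft (F a) xi = ft f xi * (in_strip a n xi)%:R) ->
  (forall a, (a < q ^ n)%N -> wave chi n a (F a)) /\ f = (fun x => \sum_(a < q ^ n) F a x).
Proof.
move=> Sf fth SF ftF; split=> [a an|].
  apply: equivariant_of_ft; first exact: SF.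
  move=> xi; rewrite ftF//; have [->|f0] := eqVneq (ft f xi) 0; first by rewrite mul0r eqxx.
  case: (boolP (in_strip a n xi)) => [ha _|]; last by rewrite mulr0 eqxx.
  have [a' a'n th] := fth xi f0.
  by rewrite (strip_disjoint an a'n ha (theta_in_strip th)).
apply: ft_inj2 => //; first by apply: Sch_sum => a _; exact: SF.
move=> xi; rewrite ft_sum; last by move=> a _; exact: SF.
rewrite (eq_bigr (fun a : 'I_(q ^ n) => ft f xi * (in_strip a n xi)%:R)) => [|a _]; last exact: ftF.
have [->|f0] := eqVneq (ft f xi) 0; first by rewrite big1// => a _; rewrite mul0r.
have [a an th] := fth xi f0; rewrite (bigD1 (Ordinal an))//= (theta_in_strip th) mulr1.
rewrite big1 ?addr0// => a' a'a; case: (boolP (in_strip a' n xi)) => [h|_]; last by rewrite mulr0.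
by case/eqP: a'a; apply: val_inj => /=; exact: strip_disjoint h (theta_in_strip th).
Qed.

Lemma ft_wave_strip (n : nat) (F : nat -> pt -> C) (a : nat) xi : (a < q ^ n)%N ->
  (forall c, (c < q ^ n)%N -> wave chi n c (F c)) ->
  ft (F a) xi = ft (fun x => \sum_(c < q ^ n) F c x) xi * (in_strip a n xi)%:R.
Proof.
move=> an Fw; rewrite ft_sum; last by move=> c _; case: (Fw c (ltn_ord c)).
have strip (c : nat) : (c < q ^ n)%N -> ft (F c) xi != 0 -> in_strip c n xi.
  by move=> cn h; apply: theta_in_strip; exact: ft_equivariant (Fw c cn) h.
rewrite (bigD1 (Ordinal an))//=; case: (boolP (in_strip a n xi)) => h; last first.
  by rewrite mulr0; apply/eqP; apply: contraNT h; exact: strip.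
rewrite big1 ?addr0 ?mulr1// => c ca; apply/eqP; apply: contraNT ca => /(strip c (ltn_ord c)) hc.
by apply/eqP/val_inj => /=; exact: strip_disjoint hc h.
Qed.

End FourierSide.

(** * The field of q-adic numbers and its characters *)

Section QadicIntegers.
Variables (R : realType) (q : nat) (q_pr : prime q).
Local Notation Kq := (qadic q_pr).
Local Notation Zq := (qadic_int q_pr).
Local Notation w := (q%:R : Kq).
Local Notation "x %:F" := (FracField.tofrac x : Kq).
Implicit Types x y : Kq.

Let q_gt0 : (0 < q)%N := prime_gt0 q_pr.
Let q_gt1 : (1 : R) < q%:R.
Proof. by rewrite ltr1n prime_gt1. Qed.

Lemma qadic_norm_ge0 x : 0 <= qadic_norm R x.
Proof. by rewrite /qadic_norm; case: eqP => // _; rewrite exprz_ge0. Qed.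

Lemma qadic_norm1 : qadic_norm R (1 : Kq) = 1.
Proof.
have := qadic_normM R (1 : Kq) 1; rewrite mulr1 => /eqP.
rewrite -subr_eq0 -{1}[qadic_norm _ _]mulr1 -mulrBr mulf_eq0 => /orP[|].
  by rewrite /qadic_norm oner_eq0 expfz_eq0 pnatr_eq0 gtn_eqF// andbF.
by rewrite subr_eq0 => /eqP.
Qed.

Lemma qadic_normN x : qadic_norm R (- x) = qadic_norm R x.
Proof.
have h : qadic_norm R (-1 : Kq) = 1.
  have := qadic_normM R (-1 : Kq) (-1); rewrite mulrNN mulr1 qadic_norm1 => /esym/eqP.
  by rewrite -expr2 sqrf_eq1 => /orP[/eqP//|/eqP h]; have := qadic_norm_ge0 (-1); rewrite h oppr_ge0 ler10.
by rewrite -mulN1r qadic_normM h mul1r.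
Qed.

Definition integral : pred Kq := fun x => qadic_norm R x <= 1.

Fact integral_subring : subring_closed integral.
Proof.
split; rewrite ?unfold_in /integral ?qadic_norm1// => x y; rewrite ?unfold_in => hx hy.
  apply: (le_trans (qadic_normD R x (- y))).
  by rewrite ge_max qadic_normN; apply/andP.
by rewrite qadic_normM mulr_ile1 ?qadic_norm_ge0.
Qed.
HB.instance Definition _ := GRing.isSubringClosed.Build Kq integral integral_subring.

Lemma qadic_norm_eq0 x : (qadic_norm R x == 0) = (x == 0).
Proof.
rewrite /qadic_norm; have [_|x0] := eqVneq x 0; first exact: eqxx.
by rewrite expfz_eq0 pnatr_eq0 gtn_eqF// andbF.
Qed.

Lemma uniformizer_neq0 : w != 0.
Proof. by rewrite -qadic_norm_eq0 qadic_norm_prime invr_eq0 pnatr_eq0 -lt0n. Qed.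

Lemma qadic_normX (z : int) : qadic_norm R (w ^ z) = q%:R ^ (- z).
Proof.
have normX (n : nat) : qadic_norm R (w ^+ n) = q%:R ^- n.
  elim: n => [|n IH]; first by rewrite !expr0 qadic_norm1 invr1.
  by rewrite !exprS qadic_normM IH qadic_norm_prime invfM.
case: z => n; first by rewrite -exprnP normX exprnN.
rewrite NegzE opprK -exprnN -exprnP.
apply: (mulIf (x := qadic_norm R (w ^+ n.+1))).
  by rewrite qadic_norm_eq0 expf_neq0// uniformizer_neq0.
rewrite -qadic_normM mulVf ?expf_neq0 ?uniformizer_neq0// qadic_norm1 normX mulfV//.
by rewrite expf_neq0// pnatr_eq0 -lt0n.
Qed.

Lemma qadic_norm_le x (z : int) :
  (qadic_norm R x <= q%:R ^ z) = (w ^ z * x \in integral).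
Proof.
rewrite unfold_in /integral qadic_normM qadic_normX -invr_expz.
by rewrite ler_pdivrMl ?mulr1// exprz_gt0// ltr0n.
Qed.

Lemma integral_bounded x : exists N : nat, w ^+ N * x \in integral.
Proof.
have [->|x0] := eqVneq x 0; first by exists 0%N; rewrite mulr0 rpred0.
exists (`|qadic_val x|%N); rewrite [_ ^+ _]exprnP -qadic_norm_le /qadic_norm (negPf x0).
by rewrite ler_eXz2l//; lia.
Qed.

Lemma qadic_norm_tofrac (a : Zq) : a != 0 ->
  qadic_norm R a%:F = q%:R ^ (- (qadic_int_val a)%:Z).
Proof.
move=> a0; rewrite (@qadic_norm_frac _ _ _ _ a 1) ?oner_neq0//; last first.
  by rewrite tofrac1 mulr1.
suff -> : qadic_int_val (1 : Zq) = 0%N by rewrite sub0r.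
apply: qadic_int_val_uniq; first by rewrite /= expn0 modz1.
by rewrite /= expn1 modz_nat modn_small// prime_gt1.
Qed.

Lemma integral_natV (m n : nat) : (m%:R / w ^+ n \in integral) = (q ^ n %| m)%N.
Proof.
have [->|m0] := posnP m; first by rewrite mul0r rpred0 dvdn0.
have mn0 : (m%:R : Zq) != 0.
  have mq : (m < q ^ m)%N by rewrite ltn_expl// prime_gt1.
  apply: contraTneq m0 => /(congr1 (fun x : Zq => x m)).
  by rewrite qadic_int_natr /= mod0z modz_nat modn_small// => -[->].
have -> : (m%:R / w ^+ n : Kq) = w ^ (- n%:Z) * (m%:R : Zq)%:F.
  by rewrite mulrC tofracMn tofrac1 exprnN.
rewrite -qadic_norm_le qadic_norm_tofrac// ler_eXz2l// lerN2.
rewrite lez_nat qadic_int_val_ge// qadic_int_natr modz_nat.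
by rewrite eqz_nat /dvdn.
Qed.

Lemma integral_intV (z : int) (n : nat) :
  (z%:~R / w ^+ n \in integral) = ((q ^ n)%N %| z)%Z.
Proof.
case: z => m; rewrite dvdzE -?pmulrn ?integral_natV//.
by rewrite NegzE abszN mulrNz mulNr rpredN -pmulrn integral_natV.
Qed.

(** Write x = a / b with q-adic integers a and b, divide both by the exact power q^v
    of q in b, and invert the unit part t of b modulo q^n. *)
Lemma integral_dense x (n : nat) : x \in integral ->
  exists2 l : nat, (l < q ^ n)%N & (x - l%:R) / w ^+ n \in integral.
Proof.
move=> xint; have [->|x0] := eqVneq x 0.
  by exists 0%N; rewrite ?expn_gt0 ?q_gt0// subr0 mul0r rpred0.
set a := qadic_num x; set b := qadic_den x.
have a0 : a != 0 by rewrite qadic_num_eq0.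
have b0 : b != 0 by exact: qadic_den_neq0.
set v := qadic_int_val b.
have va : (v <= qadic_int_val a)%N.
  move: xint; rewrite unfold_in /integral (qadic_norm_frac R a0 b0 (qadic_numden x)).
  by rewrite -[leRHS](expr0z q%:R) ler_eXz2l// subr_le0.
have q0 m : (q ^ m)%N%:Z != 0 by rewrite eqz_nat -lt0n expn_gt0 q_gt0.
have av : a v = 0 by apply/eqP; rewrite -qadic_int_val_ge.
have [bv bv1] := qadic_int_valP b0; rewrite -/v in bv bv1.
set N := (v + n).+1.
have /dvdzP[t tE] : ((q ^ v)%N %| b N)%Z by rewrite qadic_int_val_dvd ?bv// /N; lia.
have /dvdzP[s sE] : ((q ^ v)%N %| a N)%Z by rewrite qadic_int_val_dvd ?av// /N; lia.
have tq : ~~ (q %| t)%Z.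
  apply: contra bv1 => qt; rewrite -(@qadic_int_val_dvd _ _ _ _ N); last by rewrite /N; lia.
  by rewrite tE expnS PoszM dvdz_mul.
have : coprimez t (q ^ n)%N.
  rewrite /coprimez /gcdz /= eqz_nat -/(coprime _ _) coprime_sym coprimeXl// prime_coprime//.
case/coprimezP => -[u u'] /= tu.
have cE : exists c : nat, (c < q ^ n)%N /\ c%:Z = ((u * s) %% (q ^ n)%N)%Z.
  exists `|modz (u * s) (q ^ n)%N|%N.
  have := modz_ge0 (u * s) (q0 n); have : modz (u * s) (q ^ n)%N < (q ^ n)%N.
    by rewrite ltz_pmod// ltz_nat expn_gt0 q_gt0.
  by lia.
have [c [cq {}cE]] := cE; exists c => //.
pose y : Zq := a - c%:R * b.
have yE : (x - c%:R) * b%:F = y%:F.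
  by rewrite mulrBl qadic_numden tofracB tofracM tofracMn tofrac1.
have yvn : y (v + n)%N = 0.
  rewrite qadic_intE.
  have aN : a (v + n).+1 = s * (q ^ v)%N := sE.
  have bN : b (v + n).+1 = t * (q ^ v)%N := tE.
  have -> : y (v + n).+1 = ((a (v + n).+1 - c%:Z * b (v + n).+1) %% (q ^ (v + n).+1)%N)%Z.
    by rewrite /y /= qadic_int_natr modzMml modzDmr -modzDmr modzNm modzDmr.
  rewrite qadic_mod_mod//; apply/eqP; rewrite -(sameP dvdz_mod0P eqP) aN bN mulrA -mulrBl.
  rewrite expnD mulnC PoszM dvdz_mul//.
  have -> : s - c%:Z * t = s * (u' * (q ^ n)%N) + t * (u * s - c%:Z).
    have -> : s * (u' * (q ^ n)%N) = s * (1 - u * t) by rewrite -tu; ring.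
    by ring.
  apply: rpredD; first by rewrite mulrA dvdz_mull.
  by rewrite dvdz_mull// -eqz_mod_dvd cE modz_mod.
have [y0|y0] := eqVneq y 0.
  have /eqP : (x - c%:R) * b%:F = 0 by rewrite yE y0 tofrac0.
  by rewrite mulf_eq0 tofrac_eq0 (negPf b0) orbF => /eqP ->; rewrite mul0r rpred0.
rewrite mulrC exprnN -qadic_norm_le (qadic_norm_frac R y0 b0 yE) ler_eXz2l//.
have : (v + n <= qadic_int_val y)%N by rewrite qadic_int_val_ge// yvn.
by rewrite -/v; lia.
Qed.

End QadicIntegers.

Section Character.
Variables (R : realType) (q : nat) (q_pr : prime q).
Local Notation Kq := (qadic q_pr).
Local Notation w := (q%:R : Kq).
Local Notation O := (@integral R q q_pr).
Variable chi : Kq -> R[i].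
Hypothesis chiP : qadic_character chi.

Lemma charD x y : chi (x + y) = chi x * chi y. Proof. by case: chiP. Qed.

Lemma char_integral x : x \in O -> chi x = 1.
Proof. by case: chiP => _ _ h _; exact: h. Qed.

Lemma char0 : chi 0 = 1. Proof. by rewrite char_integral// rpred0. Qed.

Lemma char_natmul x n : chi (x *+ n) = chi x ^+ n.
Proof. by elim: n => [|n IH]; [rewrite mulr0n char0 | rewrite mulrS charD IH exprS]. Qed.

Lemma normc_char x : ComplexField.Normc.normc (chi x) = 1.
Proof. by case: chiP => _ h _ _; have [] := h x. Qed.

(** A character that is trivial on Z_q but not on q^-1 Z_q has kernel Z_q, because
    q^-1 Z_q / Z_q has prime order: if chi x = 1 with x not integral, multiply x by
    a power of q to get y in q^-1 Z_q outside Z_q; y generates modulo Z_q. *)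
Lemma char_eq1 x : (chi x == 1) = (x \in O).
Proof.
apply/eqP/idP; last exact: char_integral.
move=> x1; apply: contrapT => /negP xint.
have [N0 hN0] := integral_bounded R x.
pose P N := w ^+ N * x \in O.
have exP : exists N, P N by exists N0.
case: (ex_minnP exP) => -[|N] PN minN.
  by move: PN; rewrite /P expr0 mul1r (negPf xint).
have y_notint : w ^+ N * x \notin O.
  by apply/negP => /minN; rewrite ltnn.
set y := w ^+ N * x in y_notint.
have wy : w * y \in O by rewrite /y mulrA -exprS.
have y1 : chi y = 1.
  by rewrite /y -natrX mulr_natl char_natmul x1 expr1n.
have w0 := uniformizer_neq0 R q_pr.
have [l _ hl] := integral_dense 1 wy; rewrite expr1 in hl.
case: chiP => _ _ _ [x0 x0int x0N].
have [l0 _ hl0] := integral_dense (R := R) 1 (x0int : x0 \in O); rewrite expr1 in hl0.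
have ql : coprime l q.
  rewrite coprime_sym prime_coprime//; apply: contra y_notint => ql.
  have : l%:R / w ^+ 1 \in O by rewrite integral_natV expn1.
  rewrite expr1 => h; have := rpredD hl h.
  by rewrite -mulrDl subrK mulrC mulKf.
have [l' ll'] : exists l', (l * l' = l0 %[mod q])%N.
  have l_gt0 : (0 < l)%N.
    by case: (posnP l) ql => // ->; rewrite /coprime gcd0n => /eqP q1; move: (prime_gt1 q_pr); rewrite q1.
  have [u u' uu _] := egcdnP q l_gt0.
  exists (u * l0)%N; rewrite mulnA [(l * u)%N]mulnC uu.
  by rewrite (eqP ql) mulnDl mul1n -mulnA [(q * l0)%N]mulnC mulnA modnMDl.
case/eqP: x0N.
have -> : w^-1 * x0 = (x0 - l0%:R) / w + (l0%:R - (l * l')%N%:R) / w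
    - ((w * y - l%:R) / w) * l'%:R + y *+ l'.
  rewrite natrM -[y *+ l']mulr_natr; have -> : y * l'%:R = (w * y) / w * l'%:R.
    by rewrite [w * y]mulrC mulfK.
  by ring.
rewrite charD char_natmul y1 expr1n mulr1 char_integral//.
apply: rpredB; last by rewrite rpredM// rpred_nat.
apply: rpredD => //.
have -> : l0%:R - (l * l')%N%:R = (l0%:Z - (l * l')%N%:Z)%:~R :> Kq.
  by rewrite rmorphB.
rewrite -[in X in _ / X](expr1 w) integral_intV expn1 -eqz_mod_dvd !modz_nat.
by rewrite ll'.
Qed.

End Character.

(** * Integration of Schwartz functions against Haar measure *)

Section QadicField.
Variables (R : realType) (q : nat) (q_pr : prime q).

Fact uniformizer_integral : (q%:R : qadic q_pr) \in @integral R q q_pr.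
Proof. exact: rpred_nat. Qed.

Definition qadic_discreteField : discreteField :=
  @DiscreteField (qadic q_pr) (@integral R q q_pr) q%:R q (@integral_subring R q q_pr)
    q_pr erefl (uniformizer_neq0 R q_pr) uniformizer_integral (@integral_bounded R q q_pr)
    (fun n x => @integral_dense R q q_pr x n) (@integral_intV R q q_pr).

End QadicField.

Lemma sum_enum_val (V : nmodType) (J : finType) (F : J -> V) :
  \sum_(i < #|J|) F (enum_val i) = \sum_l F l.
Proof. by rewrite -(big_enum_val F); apply: eq_bigl. Qed.

Section Cells.
Variables (K : discreteField) (k : nat).
Local Notation pt := 'rV[K]_k.
Local Notation q := (resid K).

Definition cell (z : int) (c : pt) : set pt := [set x | qball z (x - c)].

Lemma indic_cell (V : pzRingType) z c : \1_(cell z c) = (fun x => (qball z (x - c))%:R : V).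
Proof.
by apply/funext => x; rewrite indicE /cell; case: (boolP (qball z _)) => h;
  [rewrite mem_set|rewrite memNset//; apply/negP].
Qed.

Lemma cell_translate z c : [set c + y | y in cell z 0] = cell z c.
Proof.
apply/seteqP; split=> x; rewrite /cell /=.
  by case=> y; rewrite subr0 => h <-; rewrite addrC addKr.
by move=> h; exists (x - c); [rewrite /= subr0|rewrite addrC subrK].
Qed.

Lemma in_cell0 z x : cell z 0 x <-> qball z x.
Proof. by rewrite /cell /= subr0. Qed.

Lemma cell_mono z z' c : z <= z' -> cell z c `<=` cell z' c.
Proof. by move=> zz' x; exact: qball_mono. Qed.

(** The translate is part of the statement so that the same coefficients v serve
    for f and for all its translates. *)
Lemma Sch_step (V : pzRingType) (f : pt -> V) : Sch f -> exists (N : nat) (n : nat)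
  (v : 'I_n -> V) (c : 'I_n -> pt),
  forall x t, f (x + t) = \sum_i v i * \1_(cell (- N%:Z) (c i - t)) x.
Proof.
move=> Sf; have [N [fc fs]] := Sch_stage Sf.
pose J := {ffun 'I_k -> 'I_(q ^ (N + N))}.
pose g (l : J) : pt := grid (- N%:Z) l.
exists N, #|J|, (fun i => f (g (enum_val i))), (fun i => g (enum_val i)) => x t.
rewrite (sum_enum_val (fun l : J => f (g l) * \1_(cell (- N%:Z) (g l - t)) x)).
have cellt l : (\1_(cell (- N%:Z) (g l - t)) x : V) = (qball (- N%:Z) (x + t - g l))%:R.
  by rewrite indic_cell opprB addrA.
have cst l : qball (- N%:Z) (x + t - g l) -> f (x + t) = f (g l).
  by move=> h; rewrite -(fc (g l) _ h) [g l + _]addrC subrK.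
have [fx|/fs xN] := eqVneq (f (x + t)) 0; last first.
  have e : - N%:Z + (N + N)%N%:Z = N by lia.
  have := @grid_sum K k V (- N%:Z) (N + N) (f (x + t)) (x + t); rewrite e => /(_ xN) <-.
  apply: eq_bigr => l _; rewrite cellt; case: ifP => [/cst ->|]; by rewrite ?mulr1 ?mulr0.
rewrite fx big1// => l _; rewrite cellt; case: (boolP (qball _ _)) => [/cst h|]; last by rewrite mulr0.
by rewrite -h fx mul0r.
Qed.

Lemma step_Sch (V : nzRingType) (n : nat) (v : 'I_n -> V) (z : 'I_n -> int) (c : 'I_n -> pt) :
  Sch (fun x => \sum_i v i * \1_(cell (z i) (c i)) x).
Proof.
apply: Sch_sum => i _; rewrite indic_cell.
by apply: (Sch_comp (F := fun u => v i * u)); [exact: mulr0|exact: Sch_ball].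
Qed.

End Cells.

Section HaarMeasure.
Variables (R : realType) (q : nat) (q_pr : prime q) (k : nat).
Hypothesis k_gt0 : (0 < k)%N.
Local Notation K := (qadic_discreteField R q_pr).
Local Notation pt := 'rV[qadic q_pr]_k.

Local Notation cell := (@cell K k).

Lemma qadic_cubeP (A : set pt) : qadic_cube R A <-> exists z c, A = cell z c.
Proof.
split=> [[r [J hJ ->]]|[z [c ->]]].
  have [[z rz] _] := hJ (Ordinal k_gt0).
  have /choice[c hc] i : exists a, J i = [set x | qadic_norm R (x - a) <= r].
    by have [_] := hJ i.
  exists z, (\row_i c i); apply/seteqP; split=> x; rewrite /qadic_box /cell /=.
    move=> h; apply/qballP => i; have := h i; rewrite hc /= rz qadic_norm_le.
    by rewrite !mxE.
  move=> /qballP h i; have := h i; rewrite hc /= rz qadic_norm_le.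
  by rewrite !mxE.
exists (q%:R ^ z), (fun i => [set x | qadic_norm R (x - c 0 i) <= q%:R ^ z]).
  by move=> i; split; [exists z|exists (c 0 i)].
apply/seteqP; split=> x; rewrite /qadic_box /cell /=.
  move=> /qballP h i; rewrite qadic_norm_le; have := h i.
  by rewrite !mxE.
move=> h; apply/qballP => i; have := h i; rewrite qadic_norm_le.
by rewrite !mxE.
Qed.

Lemma schwartzP (f : pt -> R[i]) : schwartz f <-> @Sch K k _ f.
Proof.
split=> [[n [c [A [hA ->]]]]|/Sch_step[N [n [v [c fE]]]]].
  have /choice[z hz] i : exists z, exists y, A i = cell z y by exact/qadic_cubeP/hA.
  have /choice[y hy] i : exists y, A i = cell (z i) y by exact: hz.
  have := @step_Sch K k _ n c z y; congr Sch; apply/funext => x.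
  by apply: eq_bigr => i _; rewrite hy.
exists n, v, (fun i => cell (- N%:Z) (c i - 0)); split=> [i|].
  by apply/qadic_cubeP; exists (- N%:Z), (c i - 0).
by apply/funext => x; rewrite -fE; congr f; exact/esym/addr0.
Qed.

Variable mu : {measure set (qadic_space R q_pr k) -> \bar R}.
Hypothesis mu_haar : normalized_haar mu.

Lemma measurable_cell z c : measurable (cell z c : set (qadic_space R q_pr k)).
Proof. by apply: sub_sigma_algebra; apply/qadic_cubeP; exists z, c. Qed.

Lemma mu_cell z c : mu (cell z c) = mu (cell z 0).
Proof.
have [trans _] := mu_haar.
apply: etrans (trans c (cell z 0) (measurable_cell z 0)).
exact: (congr1 mu (esym (@cell_translate K k z c))).
Qed.

Lemma mu_unit_cell : mu (cell 0 0) = 1%E.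
Proof.
have [_ <-] := mu_haar; congr (mu _); apply/seteqP; split=> x.
  move=> /in_cell0 /qballP h i; have := h i; by rewrite expr0z mul1r.
move=> h; apply/in_cell0/qballP => i; rewrite expr0z mul1r; exact: h.
Qed.

Lemma mu_cell_fin (N : nat) c : (mu (cell (- N%:Z) c) < +oo)%E.
Proof.
rewrite mu_cell; apply: (@le_lt_trans _ _ (mu (cell 0 0))); last by rewrite mu_unit_cell ltry.
apply: le_measure; rewrite ?inE; [exact: measurable_cell|exact: measurable_cell|].
by move=> x; apply: (@cell_mono K k (- N%:Z) 0 0); lia.
Qed.

Definition integral_fun (f : pt -> R) : R := \int[mu]_x (f x).

Lemma integrable_cell (N : nat) c :
  mu.-integrable setT (EFin \o (\1_(cell (- N%:Z) c) : qadic_space R q_pr k -> R)).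
Proof.
pose S : set (qadic_space R q_pr k) := cell (- N%:Z) c.
have mS : measurable S := measurable_cell (- N%:Z) c.
rewrite -/S; apply/integrableP; split.
  by apply/measurable_EFinP; exact: measurable_indic.
rewrite (eq_integral (fun x => (\1_S x)%:E)); last first.
  by move=> t _; rewrite gee0_abs// lee_fin.
rewrite integral_indic// setIT; exact: mu_cell_fin.
Qed.

Lemma integral_fun_cell (N : nat) c :
  integral_fun (\1_(cell (- N%:Z) c)) = fine (mu (cell (- N%:Z) 0)).
Proof.
pose S : set (qadic_space R q_pr k) := cell (- N%:Z) c.
have mS : measurable S := measurable_cell (- N%:Z) c.
rewrite -(mu_cell _ c) /integral_fun /Rintegral.
by have := integral_indic mu measurableT mS; rewrite setIT => <-.
Qed.

Lemma integrable_steps (N n : nat) (v : 'I_n -> R) (c : 'I_n -> pt) :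
  mu.-integrable setT (EFin \o (fun x : qadic_space R q_pr k =>
     \sum_i v i * \1_(cell (- N%:Z) (c i)) x)).
Proof.
have -> : EFin \o (fun x : qadic_space R q_pr k => \sum_i v i * \1_(cell (- N%:Z) (c i)) x) =
    fun x => (\sum_i (v i)%:E * (\1_(cell (- N%:Z) (c i)) x)%:E)%E.
  by apply/funext => x /=; rewrite sumEFin.
apply: integrable_sum => // i _; apply: integrableZl => //; exact: integrable_cell.
Qed.

Lemma integral_fun_steps (N n : nat) (v : 'I_n -> R) (c : 'I_n -> pt) :
  integral_fun (fun x => \sum_i v i * \1_(cell (- N%:Z) (c i)) x) =
  \sum_i v i * fine (mu (cell (- N%:Z) 0)).
Proof.
elim: n v c => [|n IH] v c.
  rewrite big_ord0 /integral_fun (_ : (fun _ => _) = fun=> 0); last first.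
    by apply/funext => x; rewrite big_ord0.
  by rewrite /Rintegral integral0.
rewrite big_ord_recr/= -(IH (fun i => v (widen_ord (leqnSn n) i)) (fun i => c (widen_ord (leqnSn n) i))).
rewrite -(integral_fun_cell N (c ord_max)) /integral_fun -RintegralZl//; last exact: integrable_cell.
rewrite -RintegralD//; first by apply: eq_Rintegral => x _; rewrite big_ord_recr.
- exact: integrable_steps.
- have := integrable_steps N (fun _ : 'I_1 => v ord_max) (fun _ => c ord_max).
  by apply: eq_integrable => // x _ /=; rewrite big_ord1.
Qed.

Lemma Sch_integrable (f : pt -> R) : @Sch K k _ f ->
  mu.-integrable setT (EFin \o (f : qadic_space R q_pr k -> R)).
Proof.
move=> /Sch_step[N [n [v [c fE]]]]; have := integrable_steps N v (fun i => c i - 0).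
apply: eq_integrable => // x _ /=; rewrite -fE; congr (f _)%:E; exact: addr0.
Qed.

(** Invariance is clear for step functions: all cells of one size have the same
    measure. *)
Lemma integral_fun_invariant : @invariant_functional R K k integral_fun.
Proof.
split=> [f g Sf Sg|a f Sf|f Sf f0|f t Sf].
- by rewrite /integral_fun RintegralD//; exact: Sch_integrable.
- by rewrite /integral_fun RintegralZl//; exact: Sch_integrable.
- exact: Rintegral_ge0.
have [N [n [v [c fE]]]] := Sch_step Sf.
rewrite (_ : (fun x => f (x + t)) = fun x => \sum_i v i * \1_(cell (- N%:Z) (c i - t)) x); last first.
  by apply/funext => x; exact: fE.
rewrite integral_fun_steps -(integral_fun_steps N v (fun i => c i - 0)).
by congr integral_fun; apply/funext => x; rewrite -fE; congr (f _); exact: addr0.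
Qed.

Lemma integral_fun_unit : integral_fun (@unit_cube R K k) = 1.
Proof.
have := integral_fun_cell 0 0; rewrite oppr0 mu_unit_cell /= => h.
apply: etrans h; congr integral_fun; apply/funext => x.
have := congr1 (fun F => F x) (@indic_cell K k R 0 0); rewrite /cell subr0 => ->.
by rewrite /unit_cube.
Qed.

Lemma LpnormE (p : nat) (f : pt -> R[i]) : (0 < p)%N -> @Sch K k _ f ->
  Lpnorm mu p%:R f =
  ((integral_fun (fun x => ComplexField.Normc.normc (f x) ^+ p)) `^ p%:R^-1)%:E.
Proof.
move=> p0 Sf; have Snp : @Sch K k R (fun x => ComplexField.Normc.normc (f x) ^+ p).
  exact: Sch_nc_exp.
rewrite /Lpnorm unlock; have -> : (\int[mu]_x `|(ComplexField.Normc.normc (f x))%:E| `^ p%:R)%E =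
    (integral_fun (fun x => ComplexField.Normc.normc (f x) ^+ p))%:E.
  rewrite /integral_fun /Rintegral fineK; last first.
    by apply: integrable_fin_num => //; exact: Sch_integrable.
  apply: eq_integral => x _; rewrite abse_EFin ger0_norm ?normc_ge0//.
  by rewrite poweR_EFin powR_mulrn ?normc_ge0.
by rewrite poweR_EFin.
Qed.

End HaarMeasure.

(** * The decoupling constant as a spatial inequality *)

Section DecouplingConstant.
Variables (R : realType) (q : nat) (q_pr : prime q) (k : nat).
Hypotheses (k_gt0 : (0 < k)%N) (kq : (k < q)%N).
Local Notation K := (qadic_discreteField R q_pr).
Local Notation Qq := (qadic q_pr).
Local Notation pt := 'rV[Qq]_k.
Local Notation nc := ComplexField.Normc.normc.

Variable mu : {measure set (qadic_space R q_pr k) -> \bar R}.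
Hypothesis mu_haar : normalized_haar mu.
Variable chi : Qq -> R[i].
Hypothesis chi_char : qadic_character chi.

Local Notation I := (integral_fun mu).
Local Notation arcs n := (@qadic_partition R q q_pr (q%:R ^- n)).

Let hI : @invariant_functional R K k I := integral_fun_invariant k_gt0 mu_haar.
Let I1 : I (@unit_cube R K k) = 1 := integral_fun_unit k_gt0 mu_haar.

Lemma qadic_standard_char : @standard_char R K chi.
Proof.
split; [exact: (charD chi_char)|exact: (normc_char chi_char)|exact: (char_eq1 chi_char)].
Qed.
Let hchi := qadic_standard_char.
Let schP (f : pt -> R[i]) : schwartz f <-> @Sch K k _ f := @schwartzP R q q_pr k k_gt0 f.

Lemma fourierE (f : pt -> R[i]) xi : fourier mu chi f xi = @ft R K k chi I f xi.
Proof. by []. Qed.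

(** The elements of the partition, indexed by the integers below q^n. *)
Definition qadic_arc (n a : nat) : set Qq := [set x | qadic_norm R (x - a%:R) <= q%:R ^- n].

Lemma qadic_norm_le_inv (x : Qq) (n : nat) :
  (qadic_norm R x <= q%:R ^- n) = (x / q%:R ^+ n \in @integral R q q_pr).
Proof.
by rewrite exprnN qadic_norm_le -exprnN mulrC.
Qed.

Lemma theta_arc (n a : nat) (xi : pt) :
  theta (q%:R ^- n : R) (qadic_arc n a) xi <-> @theta_set K k a%:R n xi.
Proof.
have sE (s : Qq) (j : nat) :
    (qadic_norm R s <= (q%:R ^- n : R) ^+ j) = (s / q%:R ^+ (n * j) \in @integral R q q_pr).
  by rewrite -qadic_norm_le_inv exprVn -exprM.
split=> [[b ba [s hs ->]]|[b ba [s hs ->]]].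
  exists b; first by move: ba; rewrite /qadic_arc /= qadic_norm_le_inv.
  by exists s => // j; have := hs j; rewrite sE.
exists b; first by rewrite /qadic_arc /= qadic_norm_le_inv.
by exists s => // j; rewrite sE; exact: hs.
Qed.

Lemma strip_arc (n a : nat) (xi : pt) :
  strip (qadic_arc n a) xi <-> @in_strip K k k_gt0 a n xi.
Proof.
rewrite /strip /in_strip /qadic_arc /=; split=> [h|h i i0].
  by have := h (Ordinal k_gt0) erefl; rewrite qadic_norm_le_inv.
by rewrite qadic_norm_le_inv (_ : i = Ordinal k_gt0)//; apply: val_inj.
Qed.

Lemma qadic_arcs_partition (n : nat) :
  set_bij `I_(q ^ n) (arcs n) (qadic_arc n).
Proof.
have wn : (q%:R ^+ n : Qq) \in @integral R q q_pr by rewrite rpredX// rpred_nat.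
have wn0 : (q%:R ^+ n : Qq) != 0 by rewrite expf_neq0// uniformizer_neq0.
split.
- move=> a /= an; split.
    by split; [exists (- n%:Z); rewrite -exprnN|exists a%:R].
  move=> x; rewrite /qadic_arc /= qadic_norm_le_inv => xa.
  suff : x \in @integral R q q_pr by [].
  have -> : x = (x - a%:R) / q%:R ^+ n * q%:R ^+ n + a%:R by rewrite divfK// subrK.
  by rewrite rpredD ?rpred_nat// rpredM.
- move=> a a' /set_mem an /set_mem a'n h.
  have : qadic_arc n a a%:R.
    by rewrite /qadic_arc /= qadic_norm_le_inv subrr mul0r rpred0.
  rewrite h /qadic_arc /= qadic_norm_le_inv => ha.
  apply: (@residue_unique K a%:R a a' n) => //; first by rewrite subrr mul0r rpred0.
- move=> J [[_ [b Jb]] JO].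
  have bO : b \in @integral R q q_pr.
    apply: JO; rewrite Jb /= qadic_norm_le_inv subrr mul0r; exact: rpred0.
  have [l ln bl] := integral_dense n bO; exists l => //.
  rewrite Jb; apply/seteqP; split=> x; rewrite /qadic_arc /= !qadic_norm_le_inv => h.
    exact: etrans (@residue_recenter K x b l%:R n bl) h.
  exact: etrans (esym (@residue_recenter K x b l%:R n bl)) h.
Qed.

Lemma sum_qadic_partition (n : nat) (F : set Qq -> \bar R) :
  (\sum_(J \in arcs n) F J = \sum_(a < q ^ n) F (qadic_arc n a))%E.
Proof. by rewrite (reindex_fsbig (qadic_arc n) _ _ F (qadic_arcs_partition n)) -fsbig_ord. Qed.

(** The frequency restriction is a choice among the Schwartz functions with the
    prescribed Fourier transform; such functions exist by averaging. *)
Lemma freq_restrict_arc (n a : nat) (f : pt -> R[i]) : @Sch K k _ f ->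
  @Sch K k _ (freq_restrict mu chi (qadic_arc n a) f) /\
  forall xi, @ft R K k chi I (freq_restrict mu chi (qadic_arc n a) f) xi =
    @ft R K k chi I f xi * (@in_strip K k k_gt0 a n xi)%:R.
Proof.
move=> Sf.
have stripE xi : (\1_(strip (qadic_arc n a)) xi : R[i]) = (@in_strip K k k_gt0 a n xi)%:R.
  rewrite indicE; congr ((_ : bool)%:R); apply/idP/idP => [/set_mem/strip_arc//|h].
  exact/mem_set/strip_arc.
have [g Sg gf] := strip_projection hchi hI k_gt0 a n Sf.
have [] : [set g | schwartz g /\ forall xi, fourier mu chi g xi =
    fourier mu chi f xi * \1_(strip (qadic_arc n a)) xi] (freq_restrict mu chi (qadic_arc n a) f).
  apply: xgetPex; exists g; split; first exact/schP.
  by move=> xi; rewrite stripE; exact: gf.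
move=> /schP Sh hE; split=> // xi.
by have := hE xi; rewrite stripE.
Qed.

Lemma Lpnorm_even (r : nat) (f : pt -> R[i]) : (0 < r)%N -> @Sch K k _ f ->
  Lpnorm mu (2 * r)%:R f = ((I (fun x => nc (f x) ^+ (2 * r))) `^ (2 * r)%:R^-1)%:E.
Proof. by move=> r0; apply: LpnormE; rewrite // muln_gt0. Qed.

Lemma I_pow_ge0 (m : nat) (f : pt -> R[i]) : 0 <= I (fun x => nc (f x) ^+ m).
Proof. by apply: Rintegral_ge0 => x _; rewrite exprn_ge0// normc_ge0. Qed.

Lemma decoupling_rhsE (D : R) (N : nat) (F : 'I_N -> R) : (forall a, 0 <= F a) ->
  (D%:E * (\sum_(a < N) (F a)%:E ^+ 2) `^ 2^-1)%E = (D * (\sum_(a < N) F a ^+ 2) `^ 2^-1)%:E.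
Proof.
by move=> F0; under eq_bigr do rewrite -EFin_expe; rewrite sumEFin poweR_EFin.
Qed.

Lemma le_root_power (x D s : R) (r : nat) : (0 < r)%N -> 0 <= x -> 0 <= D -> 0 <= s ->
  (x `^ (2 * r)%:R^-1 <= D * s `^ 2^-1) = (x <= D ^+ (2 * r) * s ^+ r).
Proof.
move=> r0 x0 D0 s0; have p0 : (0 < 2 * r)%N by rewrite muln_gt0.
rewrite -(@ler_pXn2r _ (2 * r)) ?nnegrE ?powR_ge0 ?mulr_ge0 ?powR_ge0//.
by rewrite powR_rootK// exprMn [(_ `^ _) ^+ (2 * r)]exprM powR_rootK.
Qed.

(** The pieces of a sum of waves are the waves themselves, by injectivity of the
    Fourier transform. *)
Lemma decouples_of_bound (n r : nat) (D : R) : (0 < r)%N -> 0 <= D ->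
  decoupling_bound mu chi (2 * r)%:R (q%:R ^- n) D -> @decouples R K k chi I n r (D ^+ (2 * r)).
Proof.
move=> r0 D0 bD F b Fw b0 Fb; have p0 : (0 < 2 * r)%N by rewrite muln_gt0.
set f : pt -> R[i] := fun x => \sum_(a < q ^ n) F a x.
have SF a : (a < q ^ n)%N -> @Sch K k _ (F a) by move=> /Fw[].
have Sf : @Sch K k _ f by apply: Sch_sum => a _; exact: SF.
have FE a : (a < q ^ n)%N -> freq_restrict mu chi (qadic_arc n a) f = F a.
  move=> an; have [Sg gE] := freq_restrict_arc n a Sf.
  apply: (ft_inj2 hchi hI I1 k_gt0 kq Sg (SF a an)) => xi; rewrite gE.
  by rewrite -(ft_wave_strip hchi hI k_gt0 kq xi an Fw).
have /bD : schwartz f by exact/schP.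
have fth xi : fourier mu chi f xi != 0 -> exists2 J,
    arcs n J & theta (q%:R ^- n : R) J xi.
  rewrite fourierE /f ft_sum//; last by move=> a _; exact: SF.
  move=> fx; have /existsP[a Fax] : [exists a : 'I_(q ^ n), @ft R K k chi I (F a) xi != 0].
    apply: contraNT fx; rewrite negb_exists => /forallP h; apply/eqP/big1 => a _.
    by apply/eqP; have := h a; rewrite negbK.
  exists (qadic_arc n a).
    by have [h _ _] := qadic_arcs_partition n; apply: h; exact: ltn_ord.
  by apply/theta_arc; apply: (ft_equivariant hchi hI k_gt0 kq _ Fax); exact/Fw/ltn_ord.
move=> /(_ fth); rewrite sum_qadic_partition Lpnorm_even//.
have nF (a : 'I_(q ^ n)) : Lpnorm mu (2 * r)%:R (freq_restrict mu chi (qadic_arc n a) f) =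
    ((I (fun x => nc (F a x) ^+ (2 * r))) `^ (2 * r)%:R^-1)%:E.
  by rewrite FE// Lpnorm_even//; exact: SF.
under eq_bigr do rewrite nF.
rewrite decoupling_rhsE; last by move=> a; exact: powR_ge0.
rewrite lee_fin le_root_power ?I_pow_ge0 ?sumr_ge0// => [|a _]; last by rewrite sqr_ge0.
move=> /le_trans; apply; rewrite ler_wpM2l ?exprn_ge0//.
apply: lerXn2r; rewrite ?nnegrE ?sumr_ge0//; try by move=> a _; rewrite sqr_ge0.
apply: ler_sum => a _; apply: lerXn2r; rewrite ?nnegrE ?powR_ge0 ?b0//.
rewrite -(@ler_pXn2r _ (2 * r)) ?nnegrE ?powR_ge0 ?b0// powR_rootK ?I_pow_ge0//.
exact: Fb.
Qed.

Lemma bound_of_decouples (n r : nat) (Z : R) : (0 < r)%N -> 0 <= Z ->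
  @decouples R K k chi I n r (Z ^+ (2 * r)) -> decoupling_bound mu chi (2 * r)%:R (q%:R ^- n) Z.
Proof.
move=> r0 Z0 dZ f /schP Sf fth.
have p0 : (0 < 2 * r)%N by rewrite muln_gt0.
pose F a := freq_restrict mu chi (qadic_arc n a) f.
have SF a : @Sch K k _ (F a) by have [] := freq_restrict_arc n a Sf.
have ftF a xi := proj2 (freq_restrict_arc n a Sf) xi.
have [Fw fE] : (forall a, (a < q ^ n)%N -> @wave R K k chi n a (F a)) /\
    f = (fun x => \sum_(a < q ^ n) F a x).
  apply: (ft_decomposition hchi hI I1 kq Sf) => [xi fx|a _|a _ xi]; [|exact: SF|exact: ftF].
  have [J hJ] := fth xi fx; have [_ _ surj] := qadic_arcs_partition n.
  have [a an <-] := surj J hJ => th; exists a; first exact: an.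
  exact: (proj1 (theta_arc n a xi) th).
pose b a := (I (fun x => nc (F a x) ^+ (2 * r))) `^ (2 * r)%:R^-1.
have b0 a : 0 <= b a by exact: powR_ge0.
rewrite sum_qadic_partition Lpnorm_even//.
have nF (a : 'I_(q ^ n)) : Lpnorm mu (2 * r)%:R (freq_restrict mu chi (qadic_arc n a) f) =
    (b a)%:E by rewrite Lpnorm_even//; exact: SF.
under eq_bigr do rewrite nF.
rewrite decoupling_rhsE// lee_fin le_root_power ?I_pow_ge0 ?sumr_ge0// => [|a _]; last by rewrite sqr_ge0.
rewrite [in leLHS]fE; apply: dZ => // a _.
by rewrite /b powR_rootK ?I_pow_ge0.
Qed.

(** Y' is strictly larger than Y because the decoupling constant is an infimum. *)
Lemma decouples_of_constant (n r : nat) (Y Y' : R) : (0 < r)%N -> Y < Y' ->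
  (decoupling_constant mu chi (2 * r)%:R (q%:R ^- n) <= Y%:E)%E ->
  @decouples R K k chi I n r (Y' ^+ (2 * r)).
Proof.
move=> r0 YY' hY.
have /ereal_inf_lt[_ [D [D0 hD] <-]] : (decoupling_constant mu chi (2 * r)%:R (q%:R ^- n) < Y'%:E)%E.
  by apply: le_lt_trans hY _; rewrite lte_fin.
rewrite lte_fin => DY'; apply: (decouples_mono (X := D ^+ (2 * r))); last exact: decouples_of_bound.
by apply: lerXn2r; rewrite ?nnegrE ?(ltW DY')// (le_trans D0 (ltW DY')).
Qed.

Lemma constant_of_decouples (n r : nat) (Z : R) : (0 < r)%N -> 0 <= Z ->
  @decouples R K k chi I n r (Z ^+ (2 * r)) ->
  (decoupling_constant mu chi (2 * r)%:R (q%:R ^- n) <= Z%:E)%E.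
Proof.
by move=> r0 Z0 dZ; apply: ereal_inf_lbound; exists Z => //; split=> //; exact: bound_of_decouples.
Qed.

End DecouplingConstant.

(** * The bootstrapped bound *)

Section Exponents.
Variable R : realType.

Lemma expNn_powR (q n : nat) (s : R) : (q%:R ^- n : R) `^ (- s) = q%:R `^ (n%:R * s).
Proof.
by rewrite -powR_mulrn ?ler0n// -powRN -powRrM mulrNN.
Qed.

Lemma exponent_ge0 (q : nat) (B e : R) : (1 < q)%N ->
  (forall n : nat, 1 <= B * q%:R `^ (n%:R * e)) -> 0 <= e.
Proof.
move=> q1 h; rewrite leNgt; apply/negP => e0.
have [|N N0 hN] := @powR_unbounded R (- e) (B + 1); first by rewrite oppr_gt0.
have q0 : 0 < (q%:R : R) by rewrite ltr0n ltnW.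
have Nq : N%:R `^ (- e) <= q%:R `^ (N%:R * - e).
  rewrite powRrM powR_mulrn ?ler0n// ge0_ler_powR ?nnegrE ?exprn_ge0//; first by rewrite oppr_ge0 ltW.
  by rewrite -natrX ler_nat ltnW// ltn_expl.
have := h N; rewrite -[_ * e]opprK -mulrN powRN ler_pdivlMr ?powR_gt0// mul1r => hB.
by have := le_trans hN (le_trans Nq hB); rewrite gerDl ler10.
Qed.

Lemma decoupling_exponent_div (k r : nat) (c : R) : (0 < r)%N -> (0 < k)%N ->
  decoupling_exponent k c r / (2 * r)%:R =
  1 / 2 - k%:R * (k%:R + 1) / (2 * (2 * r)%:R) +
    c / (2 * r)%:R * (1 - 1 / k%:R) `^ ((2 * r)%:R / (2 * k%:R)).
Proof.
move=> r0 k0; have rn0 : r%:R != 0 :> R by rewrite pnatr_eq0 -lt0n.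
have kn0 : k%:R != 0 :> R by rewrite pnatr_eq0 -lt0n.
have -> : (2 * r)%:R / (2 * k%:R) = r%:R / k%:R :> R by rewrite natrM; field.
rewrite /decoupling_exponent [1 / k%:R]div1r; move: (_ `^ _) => P.
by rewrite natrM; field.
Qed.

End Exponents.

Theorem theorem1p1 (R : realType) (k : nat) (k_ge2 : (2 <= k)%N) (p : nat)
    (eps C1 : R) (eps_gt0 : 0 < eps) (eps_lt1 : eps < 1) :
  exists C : R,
  forall (q : nat) (q_pr : prime q) (q_gtk : (k < q)%N)
    (mu : {measure set (qadic_space R q_pr k) -> \bar R})
    (mu_haar : normalized_haar mu)
    (chi : qadic q_pr -> R[i]) (chi_char : qadic_character chi)
    (p0 : nat) (p0_gt0 : (0 < p0)%N) (p0_even : ~~ odd p0)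
    (p_p0 : exists2 n : nat, (0 < n)%N & p = (p0 + 2 * k * n)%N)
    (c : R) (c_ge0 : 0 <= c),
    (forall delta : R, qadic_scale q delta ->
       (decoupling_constant mu chi p0%:R delta <=
          (C1 * delta `^ (- (1 / 2 - k%:R * (k%:R + 1) / (2 * p0%:R))
                 - c / p0%:R * (1 - 1 / k%:R) `^ (p0%:R / (2 * k%:R))))%:E)%E) ->
    forall delta : R, qadic_scale q delta ->
      (decoupling_constant mu chi p%:R delta <=
         (C * q%:R `^ (a_exponent k p%:R p0%:R / p%:R)
            * delta `^ (- (1 / 2 - k%:R * (k%:R + 1) / (2 * p%:R))
                 - c / p%:R * (1 - 1 / k%:R) `^ (p%:R / (2 * k%:R))
                 - eps))%:E)%E.
Proof.
have k0 : (0 < k)%N by apply: ltn_trans k_ge2.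
(* M is at least 1 so that the bound extends to delta = 1; the factor 2 in C0 makes
   room for a strict inequality. *)
pose M : R := Num.max C1 1.
have M1 : 1 <= M by rewrite le_max lexx orbT.
pose C0 (r : nat) : R := (2 * M) ^+ (2 * r).
have M20 : 0 <= 2 * M by rewrite mulr_ge0// (le_trans ler01).
have C0_ge0 r : 0 <= C0 r by rewrite exprn_ge0.
have C0_ge1 r : 1 <= C0 r.
  by rewrite exprn_ege1// mulr_ege1// ler1n.
(* The constant is chosen before p0, that is before r = p0 / 2 and the number j of
   steps; p bounds both of them, so a sum over all possible values will do. *)
have /choice[A hA] (rj : nat * nat) : exists A : R, 0 <= A /\ ((0 < rj.1)%N ->
    forall (K : discreteField) (chi : K -> R[i]) (I : ('rV[K]_k -> R) -> R),
    standard_char chi -> invariant_functional I -> I (@unit_cube R K k) = 1 ->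
    (k < resid K)%N -> forall c : R, 0 <= decoupling_exponent k c rj.1 ->
    (forall n, decouples chi I n rj.1
       (C0 rj.1 * (resid K)%:R `^ (n%:R * (decoupling_exponent k c rj.1 + eps)))) ->
    forall n, decouples chi I n (rj.1 + k * rj.2)
       (A * (resid K)%:R `^ (a_exponent k (2 * (rj.1 + k * rj.2))%:R (2 * rj.1)%:R) *
        (resid K)%:R `^ (n%:R * (decoupling_exponent k c (rj.1 + k * rj.2) + eps)))).
  have [r0|r0] := posnP rj.1; first by exists 0; split=> //; rewrite r0.
  have [A A0 hA] := @decouples_iterate R k rj.1 eps (C0 rj.1) rj.2 k_ge2 r0 eps_gt0 (C0_ge0 _).
  by exists A; split=> // _; exact: hA.
pose A' (rj : 'I_p.+1 * 'I_p.+1) : R := A (rj.1 : nat, rj.2 : nat) `^ p%:R^-1.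
exists (\sum_rj A' rj) => q q_pr q_gtk mu mu_haar chi chi_char p0 p0_gt0 p0_even.
move=> [j j0 pE] c c_ge0 hyp _ [n /= n0 <-].
have q1 := prime_gt1 q_pr.
have q1R : 1 <= (q%:R : R) by rewrite ler1n ltnW.
pose r := p0./2; have p0E : p0 = (2 * r)%N by rewrite mul2n /r halfK (negPf p0_even) subn0.
have r0 : (0 < r)%N by move: p0_gt0; rewrite p0E; case: (r).
have pE2 : p = (2 * (r + k * j))%N by rewrite pE p0E mulnDr mulnA.
have rp : (r < p.+1)%N by rewrite ltnS pE2; lia.
have jp : (j < p.+1)%N by rewrite ltnS pE2; nia.
have s0 : (0 < r + k * j)%N by rewrite addn_gt0 r0.
have p_gt0 : (0 < p)%N by rewrite pE2 muln_gt0.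
have pR0 : 0 < (p%:R : R) by rewrite ltr0n.
pose K := qadic_discreteField R q_pr; pose I := integral_fun mu.
have hchi := qadic_standard_char chi_char.
have hI := integral_fun_invariant k0 mu_haar.
have I1 := integral_fun_unit k0 mu_haar.
pose e := decoupling_exponent k c r.
(* The hypothesis in spatial form, including the scale 1. *)
have start m : @decouples R K k chi I m r (C0 r * q%:R `^ (m%:R * e)).
  have [->|m0] := posnP m.
    rewrite mul0r powRr0 mulr1; apply: decouples_mono (C0_ge1 r) _.
    move=> F b _ b0 Fb; rewrite mul1r expn0 big_ord1 -exprM.
    under [X in I X]eq_fun do rewrite big_ord1.
    exact: Fb.
  have hm := hyp (q%:R ^- m) (ex_intro2 _ _ m m0 erefl).
  rewrite p0E -opprD -decoupling_exponent_div// expNn_powR in hm.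
  set Q := _ `^ _ in hm; have Q0 : 0 < Q by rewrite powR_gt0// (lt_le_trans ltr01).
  have lt : C1 * Q < 2 * M * Q.
    rewrite ltr_pM2r// (@le_lt_trans _ _ M)// ?le_max ?lexx//.
    by rewrite mulr_natl mulr2n ltrDl (lt_le_trans ltr01).
  have := decouples_of_constant k0 q_gtk mu_haar chi_char r0 lt hm.
  rewrite exprMn -/(C0 r) /Q -powR_mulrn ?powR_ge0// -powRrM -mulrA divfK//.
  by rewrite pnatr_eq0 muln_eq0 -lt0n.
have e0 : 0 <= e.
  apply: (@exponent_ge0 R q (C0 r)) => // m.
  exact: (decouples_ge1 hchi hI I1 r0 (start m)).
have start' m : @decouples R K k chi I m r (C0 r * q%:R `^ (m%:R * (e + eps))).
  apply: decouples_mono (start m); rewrite ler_wpM2l// ler_powR// ler_wpM2l//.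
  by rewrite lerDl ltW.
have [A0 hAr] := hA (r, j).
have := hAr r0 K chi I hchi hI I1 q_gtk c e0 start' n.
rewrite /= -/(qadic_discreteField R q_pr).
set a := a_exponent _ _ _; set X := _ * _ * _.
have X0 : 0 <= X by rewrite !mulr_ge0 ?powR_ge0.
have XE : X = (X `^ p%:R^-1) ^+ (2 * (r + k * j)) by rewrite -pE2 powR_rootK.
rewrite XE => /(constant_of_decouples k0 q_gtk mu_haar chi_char s0 (powR_ge0 _ _)).
rewrite -pE2 => /le_trans; apply; rewrite lee_fin.
rewrite /X !powRM ?mulr_ge0 ?powR_ge0// -!powRrM.
have -> : a = a_exponent k p%:R p0%:R by rewrite /a -pE2 -p0E.
rewrite -2!opprD expNn_powR.
have -> : 1 / 2 - k%:R * (k%:R + 1) / (2 * p%:R) +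
    (c / p%:R * (1 - 1 / k%:R) `^ (p%:R / (2 * k%:R))) + eps =
  decoupling_exponent k c (r + k * j) / p%:R + eps.
  by rewrite pE2 decoupling_exponent_div.
apply: ler_pM; rewrite ?mulr_ge0 ?powR_ge0//.
  rewrite ler_wpM2r ?powR_ge0// (bigD1 (Ordinal rp, Ordinal jp))//=.
  by rewrite /A' /= lerDl sumr_ge0// => i _; exact: powR_ge0.
rewrite ler_powR// -mulrA ler_wpM2l// mulrDl lerD2l ler_pdivrMr//.
by rewrite ler_peMr ?ler1n// ltW.
Qed.
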